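(* Let $E$ be a complex infinite-dimensional separable Banach space of stable type $\alpha \in (0,2]$ and let $J$ be a subset of $\mathbb{Z}$. Let $T$ be a bounded linear operator on $E$ and suppose that there exists a sequence $(u_n)_{n \in J}$ of vectors in $E$ with $\sum_{n \in J} \lVert u_n \rVert^\alpha < \infty$ such that $T u_n = \lambda_n u_{n}$ for every $n \in J$, with $\lambda_n \in \mathbb{T}=\{z\in\mathbb{C}:|z|=1\}$. Let $M$ be a complex isotropic $\alpha$-stable random measure on $(J,\mathcal{P}(J))$ with the counting measure as control measure. Suppose that $\operatorname{span}\{ u_n : n \in J \}$ is dense in $E$. Then the distribution of the random vector $$v:= \sum_{n \in J} u_n X_n,$$ where $X_n := M(\{n \})$ for every $n \in J$, is invariant with full support under $T$, and $v$ is an isotropic $\alpha$-stable random vector. This distribution is never ergodic with respect to $T$.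
   Context: All random variables are defined on a suitable probability space $(\Omega,\mathcal{F},\mathbb{P})$. Random measures. Let $(J,\Sigma,m)$ be a $\sigma$-finite measure space and $\Sigma_0=\{A\in\Sigma: m(A)<\infty\}$. A complex random measure on it is a map $M$ from $\Sigma_0$ to complex random variables such that $M(A_1),\dots,M(A_n)$ are independent for pairwise disjoint $A_1,\dots,A_n\in\Sigma_0$, and for pairwise disjoint $(A_k)_{k\ge1}\subset\Sigma_0$ with $\bigcup_k A_k\in\Sigma_0$ the series $\sum_k M(A_k)$ converges in probability and equals $M(\bigcup_k A_k)$ a.s. It is complex isotropic $\alpha$-stable with control measure $m$ if $\mathbb{E}(e^{i(\theta_1\operatorname{Re}M(A)+\theta_2\operatorname{Im}M(A))})=\exp\left(-m(A)\int_{\mathbb{S}_2}|\theta_1 s_1+\theta_2 s_2|^\alpha\gamma(ds)\right)$ for all $A\in\Sigma_0$, $\theta_1,\theta_2\in\mathbb{R}$, where $\gamma$ is the uniform probability measure on the unit circle $\mathbb{S}_2\subset \mathbb{R}^2$. (Here $m$ is the counting measure on $J\subset\mathbb{Z}$, so the $X_n$ are i.i.d. with $\mathbb{E}(e^{i(\theta_1\operatorname{Re}X_n+\theta_2\operatorname{Im}X_n)})=\exp\left(-\int_{\mathbb{S}_2}|\theta_1 s_1+\theta_2 s_2|^\alpha\gamma(ds)\right)$ for all $\theta_1,\theta_2\in\mathbb{R}$.) Stable type. $E$ is of stable type $\alpha\in(0,2]$ if for every sequence $(x_n)_{n\ge1}$ in $E$ with $\sum_n\|x_n\|^\alpha<\infty$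 the series $\sum_n\theta_n x_n$ converges a.s. in $E$, where $(\theta_n)$ are i.i.d. real random variables with $\mathbb{E}(e^{it\theta_n})=\exp(-|t|^\alpha)$. Stable vectors. An $E$-valued random vector $X$ is $\alpha$-stable if for all $a,b>0$ there is $z\in E$ such that $aX^{(1)}+bX^{(2)}$ has the same distribution as $z+(a^\alpha+b^\alpha)^{1/\alpha}X$, with $X^{(1)},X^{(2)}$ independent copies of $X$; it is symmetric $\alpha$-stable if moreover $X$ and $-X$ have the same distribution, and isotropic $\alpha$-stable if furthermore $\lambda X$ has the same distribution as $X$ for every $\lambda\in\mathbb{T}$. Dynamics. A Borel probability measure $\mu$ on $E$ is invariant under $T$ if $\mu(T^{-1}(A))=\mu(A)$ for all Borel $A$; an invariant $\mu$ is ergodic if every Borel $A$ with $T^{-1}(A)=A$ satisfies $\mu(A)\in\{0,1\}$; $\mu$ has full support if $\mu(U)>0$ for every nonempty open $U\subset E$. *)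

(* Defs.v *)
From HB Require Import structures.
From mathcomp Require Import all_boot all_order all_algebra.
From mathcomp Require Import all_classical all_reals all_analysis.
From mathcomp Require Import complex.

Set Implicit Arguments.
Unset Strict Implicit.
Unset Printing Implicit Defensive.

Import Order.TTheory GRing.Theory Num.Theory.
Import numFieldNormedType.Exports.

Local Open Scope classical_set_scope.
Local Open Scope ring_scope.

(* A complex Banach space is a [completeNormedModType R[i]]; the library norm
   takes its values in [R[i]], and [rnorm] is the same norm read in [R]. *)
Definition rnorm (R : realType) (E : normedModType R[i]) (x : E) : R :=
  complex.Re `|x|.

Definition lin_span (K : numFieldType) (E : lmodType K) (A : set E) : set E :=
  [set x | exists (n : nat) (c : 'I_n -> K) (e : 'I_n -> E),
     (forall i, A (e i)) /\ x = \sum_(i < n) c i *: e i].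

Definition finite_dimensional (K : numFieldType) (E : lmodType K) : Prop :=
  exists2 A : set E, finite_set A & lin_span A = setT.

Definition separable (T : topologicalType) : Prop :=
  exists2 D : set T, countable D & dense D.

Definition borel (T : ptopologicalType) := g_sigma_algebraType (@open T).

Definition independent d d' (Omega : measurableType d) (T : measurableType d')
    (R : realType) (P : probability Omega R) (I : choiceType)
    (X : I -> {RV P >-> T}) : Prop :=
  forall (s : seq I) (B : I -> set T),
    uniq s -> (forall i, measurable (B i)) ->
    P (\bigcap_(i in [set` s]) (X i @^-1` B i)) =
    (\prod_(i <- s) P (X i @^-1` B i))%E.

Definition eq_law d1 d2 d' (Omega1 : measurableType d1)
    (Omega2 : measurableType d2) (T : measurableType d') (R : realType)
    (P1 : probability Omega1 R) (X1 : Omega1 -> T)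
    (P2 : probability Omega2 R) (X2 : Omega2 -> T) : Prop :=
  forall A : set T, measurable A -> P1 (X1 @^-1` A) = P2 (X2 @^-1` A).

Definition expi (R : realType) (t : R) : R[i] := (cos t +i* sin t)%C.

Definition Cexpectation d (Omega : measurableType d) (R : realType)
    (P : probability Omega R) (f : Omega -> R[i]) : R[i] :=
  ((\int[P]_w complex.Re (f w)) +i* (\int[P]_w complex.Im (f w)))%C.

Definition stable_type (R : realType) (E : normedModType R[i]) (alpha : R)
    : Prop :=
  forall x : nat -> E,
  (\sum_(0 <= n <oo) ((rnorm (x n)) `^ alpha)%:E < +oo)%E ->
  forall (d : measure_display) (Omega : measurableType d)
    (P : probability Omega R) (theta : nat -> {RV P >-> R}),
  independent theta ->
  (forall (n : nat) (t : R),
     Cexpectation P (fun w => expi (t * theta n w)) =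
     (expR (- (`|t| `^ alpha)))%:C%C) ->
  {ae P, forall w, cvg (series (fun n => (theta n w)%:C%C *: x n) @ \oo)}.

Definition unit_circle (R : realType) : set (R * R) :=
  [set s | s.1 ^+ 2 + s.2 ^+ 2 = 1].

Lemma two_pi_gt0 (R : realType) : (0 : R) < 2 * pi.
Proof. by rewrite mulr_gt0 ?pi_gt0. Qed.

Definition circle_param (R : realType) (t : measurableTypeR R) : R * R := (cos t, sin t).

Lemma measurable_circle_param (R : realType) :
  measurable_fun [set: R] (@circle_param R).
Proof.
apply: measurable_fun_pair;
  apply: measurable_realfun.continuous_measurable_fun.
- exact: continuous_cos.
- exact: continuous_sin.
Qed.

HB.instance Definition _ (R : realType) := isMeasurableFun.Build _ _
  (measurableTypeR R)
  (R * R)%type (@circle_param R) (@measurable_circle_param R).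

(* The uniform probability measure on the unit circle, as a measure on the
   plane carried by [unit_circle]. *)
Definition uniform_circle (R : realType) : probability (R * R)%type R :=
  distribution (uniform_prob (two_pi_gt0 R)) (@circle_param R).

Definition cvg_in_probability d (Omega : measurableType d) (R : realType)
    (P : probability Omega R) (E : normedModType R[i])
    (Z : nat -> Omega -> E) (Y : Omega -> E) : Prop :=
  forall eps : R, 0 < eps ->
    P [set w | eps <= rnorm (Z n w - Y w)] @[n --> \oo] --> 0%E.

(* Measure spaces [(S, Sigma, m)] are given here by a family of sets and a set
   function, so that the underlying space may be any subset of the type [S]. *)
Definition finite_measure_sets (R : realType) (S : Type) (Sigma : set (set S))
    (m : set S -> \bar R) : set (set S) :=
  [set A | Sigma A /\ (m A < +oo)%E].

(* Only the values of [M] on the sets of finite measure matter. *)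
Definition complex_random_measure d (Omega : measurableType d) (R : realType)
    (P : probability Omega R) (S : Type) (Sigma : set (set S))
    (m : set S -> \bar R) (M : set S -> {RV P >-> borel R[i]^o}) : Prop :=
  (forall (n : nat) (A : 'I_n -> set S),
     (forall i, finite_measure_sets Sigma m (A i)) -> trivIset setT A ->
     independent (fun i => M (A i))) /\
  (forall A : nat -> set S,
     (forall k, finite_measure_sets Sigma m (A k)) -> trivIset setT A ->
     finite_measure_sets Sigma m (\bigcup_k A k) ->
     @cvg_in_probability _ _ _ P R[i]^o
       (fun n w => \sum_(k < n) (M (A k) w : R[i]^o)) (M (\bigcup_k A k))).

Definition isotropic_stable_random_measure d (Omega : measurableType d)
    (R : realType) (P : probability Omega R) (alpha : R) (S : Type)
    (Sigma : set (set S)) (m : set S -> \bar R)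
    (M : set S -> {RV P >-> borel R[i]^o}) : Prop :=
  complex_random_measure Sigma m M /\
  forall A : set S, finite_measure_sets Sigma m A ->
  forall theta1 theta2 : R,
    Cexpectation P (fun w => expi (theta1 * complex.Re (M A w : R[i])
                                   + theta2 * complex.Im (M A w : R[i]))) =
    (expR (- (fine (m A) *
       \int[uniform_circle R]_(s in @unit_circle R)
          (`|theta1 * s.1 + theta2 * s.2| `^ alpha))))%:C%C.

(* Random series indexed by a countable set [J]: almost sure convergence of the
   partial sums along every increasing sequence of finite sets exhausting [J].
   It thus includes all enumerations of [J] and, for [J] a set of integers, the
   symmetric partial sums. *)
Definition finite_exhaustion (I : Type) (J : set I) (F : nat -> set I) : Prop :=
  [/\ forall k, finite_set (F k),
      forall k l, (k <= l)%N -> F k `<=` F l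
    & \bigcup_k F k = J].

Definition as_series_sum d (Omega : measurableType d) (R : realType)
    (P : probability Omega R) (E : normedModType R[i]) (I : choiceType)
    (J : set I) (f : I -> Omega -> E) (Y : Omega -> E) : Prop :=
  forall F : nat -> set I, finite_exhaustion J F ->
    {ae P, forall w, \sum_(n \in F k) f n w @[k --> \oo] --> Y w}.

(* The copies may live on any probability space. *)
Definition stable_vector d (Omega : measurableType d) (R : realType)
    (P : probability Omega R) (E : normedModType R[i]) (alpha : R)
    (X : {RV P >-> borel E}) : Prop :=
  forall a b : R, 0 < a -> 0 < b ->
  exists z : E,
  forall (d' : measure_display) (Omega' : measurableType d')
    (P' : probability Omega' R) (X1 X2 : {RV P' >-> borel E}),
  independent (fun i : bool => if i then X1 else X2) ->
  eq_law P' X1 P X -> eq_law P' X2 P X ->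
  eq_law P' (fun w => a%:C%C *: (X1 w : E) + b%:C%C *: (X2 w : E) : borel E)
    P (fun w => z + ((a `^ alpha + b `^ alpha) `^ alpha^-1)%:C%C *: (X w : E)
       : borel E).

Definition symmetric_stable_vector d (Omega : measurableType d) (R : realType)
    (P : probability Omega R) (E : normedModType R[i]) (alpha : R)
    (X : {RV P >-> borel E}) : Prop :=
  stable_vector alpha X /\ eq_law P X P (fun w => - (X w : E) : borel E).

Definition isotropic_stable_vector d (Omega : measurableType d) (R : realType)
    (P : probability Omega R) (E : normedModType R[i]) (alpha : R)
    (X : {RV P >-> borel E}) : Prop :=
  symmetric_stable_vector alpha X /\
  forall lambda : R[i], `|lambda| = 1 ->
    eq_law P (fun w => lambda *: (X w : E) : borel E) P X.

Definition invariant_measure (R : realType) (E : ptopologicalType) (T : E -> E)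
    (mu : probability (borel E) R) : Prop :=
  forall A : set (borel E), measurable A -> mu (T @^-1` A) = mu A.

Definition ergodic_measure (R : realType) (E : ptopologicalType) (T : E -> E)
    (mu : probability (borel E) R) : Prop :=
  invariant_measure T mu /\
  forall A : set (borel E), measurable A -> T @^-1` A = A ->
    mu A = 0%E \/ mu A = 1%E.

Definition full_support (R : realType) (E : ptopologicalType)
    (mu : probability (borel E) R) : Prop :=
  forall U : set E, open U -> U !=set0 -> (0 < mu U)%E.

(* Main.v *)
(* An almost sure limit of sums of c_n X_n u_n along finite sets has a law that
   depends only on the |c_n|, because the joint characteristic function of the
   X_n is explicit and determines the law.  Taking c_n = lambda_n gives
   invariance, c_n = constant of modulus 1 gives isotropy, and the identity
   |a|^alpha + |b|^alpha = |c|^alpha for two independent copies gives stability;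
   the same identity with a, b in {0, 1} lets finitely many X_n be resampled,
   which together with the full support of each X_n in the plane gives full
   support.

   For the lack of ergodicity, fix n0 with u_n0 <> 0 and mu = lambda_n0.  A
   coefficient of modulus at most 1 is the mean of two coefficients of modulus
   1, so sums whose coefficients tend to 0 boundedly tend to 0 in probability;
   hence the means of mu^-k T^k v tend in probability, and almost surely along a
   subsequence, to the sum Z of the X_n u_n with lambda_n = mu.  Since T Z = mu Z,
   the norm of Z is an invariant function of v, and it is not almost surely
   constant since Z charges the neighbourhoods of 0 and of u_n0. *)

From HB Require Import structures.
Require Import Defs.
From mathcomp Require Import all_boot all_order all_algebra.
From mathcomp Require Import all_classical all_reals all_analysis.
From mathcomp Require Import measurable_realfun complex ring lra.

Set Implicit Arguments.
Unset Strict Implicit.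
Unset Printing Implicit Defensive.

Import Order.TTheory GRing.Theory Num.Theory.
Import numFieldNormedType.Exports.

Local Open Scope classical_set_scope.
Local Open Scope ring_scope.

(** * Trigonometric approximation of half-lines *)

Section smooth_step.
Context {R : realType}.
Implicit Types x y a : R.

(** Laws are determined by characteristic functions through explicit trigonometric polynomials that
    converge boundedly to indicators of half-spaces; integrals of cosines with a phase suffice,
    because all the transforms are real. Laws of series in E are compared through their
    coefficients: membership of an almost sure limit in an open set is a countable condition on the
    partial sums. Stable type concerns real i.i.d. multipliers, while the real and imaginary parts
    of one X_n are in general dependent; the two real series are therefore treated separately. The
    null set of an almost sure limit depends on the exhaustion, and interleaving identifies the
    limits along different exhaustions. That X_n charges every disc is not read off a density: Re
    X_n is shown to be unbounded, by the order of the characteristic function at 0 when alpha < 2,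
    by the growth factor sqrt 2 of two independent copies when alpha = 2; rotations then turn large
    values into arbitrary points. Ergodicity is tested on sets with T^-1 B = B exactly, while Z is a
    function of v only almost surely; hence a set defined by infinitely many visits. *)

Lemma bernoulli_ineq x n : -1 <= x -> 1 + n%:R * x <= (1 + x) ^+ n.
Proof.
move=> x1; elim: n => [|n IH]; first by rewrite mul0r addr0 expr0.
rewrite exprS; apply: (@le_trans _ _ ((1 + x) * (1 + n%:R * x))).
  rewrite -natr1 mulrDl mul1r -subr_ge0.
  have -> : (1 + x) * (1 + n%:R * x) - (1 + (n%:R * x + x)) = n%:R * x ^+ 2.
    by ring.
  by rewrite mulr_ge0 ?sqr_ge0.
by rewrite ler_wpM2l// -lerBlDl sub0r.
Qed.

(** Bernoulli's inequality bounds the left side by (1 - x^2)^n. The decay (1 - x)^n <= 1/(1 + n x)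
    that results is the only rate that the estimates of [smooth_step] use. *)
Lemma exprB1_bound x n : 0 <= x <= 1 -> (1 - x) ^+ n * (1 + n%:R * x) <= 1.
Proof.
move=> /andP[x0 x1].
apply: (@le_trans _ _ ((1 - x) ^+ n * (1 + x) ^+ n)).
  rewrite ler_wpM2l ?exprn_ge0 ?subr_ge0// bernoulli_ineq//.
  by rewrite (le_trans _ x0).
rewrite -exprMn exprn_ile1//; first by nra.
by nra.
Qed.

Lemma sin_ge_lin x : 0 <= x <= 1 -> cos 1 * x <= sin x.
Proof.
move=> /andP[]; rewrite le_eqVlt => /orP[/eqP <- _|x0 x1].
  by rewrite mulr0 sin0.
have [c cx] : exists2 c, c \in `]0, x[%R & sin x - sin 0 = cos c * (x - 0).
  by apply: MVT => //; exact/continuous_subspaceT/continuous_sin.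
rewrite sin0 !subr0 => ->; rewrite ler_wpM2r ?(ltW x0)//.
move: cx; rewrite in_itv/= => /andP[c0 cx].
have pi2 := @pi_ge2 R.
have [->//|c1] := eqVneq c 1.
by rewrite ltW// ltr_cos ?in_itv/=; lra.
Qed.

Lemma norm_sin_le x : `|sin x| <= `|x|.
Proof.
wlog x0 : x / 0 <= x.
  move=> H; have [/H//|/ltW x0] := leP 0 x.
  by rewrite -normrN -sinN -[leRHS]normrN H// oppr_ge0.
move: x0; rewrite le_eqVlt => /orP[/eqP <-|x0]; first by rewrite sin0 normr0.
have [c _] : exists2 c, c \in `]0, x[%R & sin x - sin 0 = cos c * (x - 0).
  by apply: MVT => //; exact/continuous_subspaceT/continuous_sin.
by rewrite sin0 !subr0 => ->; rewrite normrM ler_piMl// cos_max.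
Qed.

Lemma subr1_cos_le x : 1 - cos x <= x ^+ 2 / 2.
Proof.
have -> : 1 - cos x = 2 * sin (x / 2) ^+ 2.
  have {1}-> : x = (x / 2) *+ 2 by rewrite -mulr_natr divfK.
  by rewrite cos_mulr2n sin2cos2; ring.
have -> : x ^+ 2 / 2 = 2 * (x / 2) ^+ 2 by field.
by rewrite ler_pM2l// -(real_normK (num_real (x / 2)))
  -(real_normK (num_real (sin _))) lerXn2r ?nnegrE// norm_sin_le.
Qed.

(* The polynomials 1 - (1 - g^n)^(2^n) converge to the indicator of g > 1/2 on
   [0, 1]; composed with g = (1 + sin(e (y - a - e)))/2 where e = 1/(j + 1) and
   n = (j + 1)^3, they give trigonometric polynomials in y that converge
   boundedly to the indicator of y > a. *)
Definition sin_level a j y : R :=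
  (1 + sin (j.+1%:R^-1 * y - j.+1%:R^-1 * (a + j.+1%:R^-1))) / 2.

Definition smooth_step a j y : R :=
  1 - (1 - sin_level a j y ^+ (j.+1 ^ 3)) ^+ (2 ^ (j.+1 ^ 3)).

Lemma sin_level_ge0 a j y : 0 <= sin_level a j y.
Proof. by rewrite divr_ge0// -lerBlDl sub0r sin_geN1. Qed.

Lemma sin_level_le1 a j y : sin_level a j y <= 1.
Proof.
by rewrite ler_pdivrMr// mul1r -lerBrDl (le_trans (sin_le1 _))//; lra.
Qed.

Lemma smooth_step_ge0 a j y : 0 <= smooth_step a j y.
Proof.
rewrite subr_ge0 exprn_ile1 ?subr_ge0 ?exprn_ile1 ?sin_level_ge0 ?sin_level_le1//.
by rewrite gerBl exprn_ge0// sin_level_ge0.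
Qed.

Lemma smooth_step_le1 a j y : smooth_step a j y <= 1.
Proof.
by rewrite gerBl exprn_ge0// subr_ge0 exprn_ile1 ?sin_level_ge0 ?sin_level_le1.
Qed.

(** The sine is taken at z = (y - a - 1/m)/m, which is at least (y - a)/(2m), so Bernoulli gives
    (2g)^n >= n sin z, of order m^2 for n = m^3. Then (1 - g^n)^(2^n) <= 1/(1 + (2g)^n) is small. *)
Lemma smooth_step_gt a j y : let m : R := j.+1%:R in
  2 / m <= y - a <= m ->
  1 - 2 / (cos 1 * (y - a)) / m <= smooth_step a j y.
Proof.
move=> m /andP[ya1 ya2].
have m0 : 0 < m by rewrite ltr0Sn.
have c1 := @cos1_gt0 R.
have ya0 : 0 < y - a by apply: lt_le_trans ya1; rewrite divr_gt0.
rewrite lerB// /smooth_step; set g := sin_level a j y; set n := (j.+1 ^ 3)%N.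
set z := m^-1 * y - m^-1 * (a + m^-1).
have z1 : (y - a) / 2 / m <= z.
  have : m^-1 <= (y - a) / 2 by rewrite ler_pdivlMr// mulrC.
  have -> : z = (y - a - m^-1) / m by rewrite /z; ring.
  move=> h; have {}h : (y - a) / 2 <= y - a - m^-1 by move: (m^-1) h => q; lra.
  by rewrite ler_wpM2r ?invr_ge0 ?(ltW m0)//.
have z2 : z <= 1.
  rewrite /z -mulrBr; apply: (@le_trans _ _ (m^-1 * m)); last by rewrite mulVf ?gt_eqF.
  have : 0 < m^-1 by rewrite invr_gt0.
  by move=> h; rewrite ler_wpM2l ?(ltW h)//; move: (m^-1) h => q; lra.
have z0 : 0 <= z by apply: le_trans z1; rewrite !divr_ge0 ?(ltW ya0) ?(ltW m0).
have gE : 2 * g = 1 + sin z by rewrite /g /sin_level -/m -/z; field.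
have s0 : 0 <= sin z.
  by apply: le_trans (sin_ge_lin _); rewrite ?z0// mulr_ge0 ?(ltW c1).
have key : cos 1 * (y - a) / 2 * m ^+ 2 <= 2 ^+ n * g ^+ n.
  rewrite -exprMn gE.
  apply: le_trans (bernoulli_ineq n _); last by rewrite (le_trans _ s0).
  apply: (@le_trans _ _ (n%:R * (cos 1 * ((y - a) / 2 / m)))).
    rewrite /n natrX -/m le_eqVlt; apply/orP; left; apply/eqP.
    by field; rewrite gt_eqF.
  apply: (@le_trans _ _ (n%:R * sin z)); last by rewrite lerDr.
  rewrite ler_wpM2l//; apply: le_trans (sin_ge_lin _); last by rewrite z0.
  by rewrite ler_wpM2l// ltW.
have := @exprB1_bound (g ^+ n) (2 ^ n).
rewrite exprn_ge0 ?sin_level_ge0// exprn_ile1 ?sin_level_ge0 ?sin_level_le1//.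
rewrite natrX => /(_ isT) H.
set q := (1 - g ^+ n) ^+ _ in H *.
have q0 : 0 <= q.
  by rewrite exprn_ge0// subr_ge0 exprn_ile1 ?sin_level_ge0 ?sin_level_le1.
have m1 : 1 <= m by rewrite ler1n.
have : q * (cos 1 * (y - a) / 2 * m) <= 1.
  apply: le_trans H; rewrite ler_wpM2l//.
  apply: le_trans (le_trans key _); last by rewrite lerDr.
  rewrite ler_wpM2l ?mulr_ge0 ?(ltW c1) ?(ltW ya0)//.
  by rewrite expr2 ler_peMr// ltW.
rewrite -ler_pdivlMr ?mulr_gt0 ?invr_gt0// => /le_trans; apply.
rewrite le_eqVlt; apply/orP; left; apply/eqP.
by field; rewrite -subr_eq0 !gt_eqF.
Qed.

(** Here 2g = 1 - sin z with z = (a - y + 1/m)/m >= m^-2. The shift of the level by 1/m gives this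
    even at y = a, which is why the limit is the indicator of a strict inequality; the cube in the
    exponent makes n sin z at least of order m. *)
Lemma smooth_step_le a j y : let m : R := j.+1%:R in
  a - y <= m - 1 -> y <= a -> smooth_step a j y <= 2 / cos 1 / m.
Proof.
move=> m ya1 ya2; rewrite /smooth_step.
set g := sin_level a j y; set n := (j.+1 ^ 3)%N.
have m0 : 0 < m by rewrite ltr0Sn.
have m1 : 1 <= m by rewrite ler1n.
have c1 := @cos1_gt0 R.
have g0 := sin_level_ge0 a j y; have g1 := sin_level_le1 a j y.
have H : 1 - (1 - g ^+ n) ^+ (2 ^ n) <= 2 ^+ n * g ^+ n.
  have := @bernoulli_ineq (- g ^+ n) (2 ^ n).
  rewrite lerN2 exprn_ile1// natrX => /(_ isT); lra.
apply: (le_trans H); rewrite -exprMn.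
set z := m^-1 * (a + m^-1) - m^-1 * y.
have z1 : m ^- 2 <= z.
  rewrite /z -mulrBr expr2 invfM ler_wpM2l ?invr_ge0 ?(ltW m0)//.
  by move: (m^-1) => q; lra.
have z2 : z <= 1.
  rewrite /z -mulrBr; apply: (@le_trans _ _ (m^-1 * m)); last by rewrite mulVf ?gt_eqF.
  have : m^-1 <= 1 by rewrite invf_le1.
  by move=> h; rewrite ler_wpM2l ?invr_ge0 ?(ltW m0)//; move: (m^-1) h => q; lra.
have z0 : 0 <= z by apply: le_trans z1; rewrite invr_ge0 exprn_ge0// ltW.
have gE : 2 * g = 1 - sin z.
  by rewrite /g /sin_level -/m -sinN /z opprB; field.
have s0 := sin_ge_lin (introT andP (conj z0 z2)).
have sz0 : 0 <= sin z by apply: le_trans s0; rewrite mulr_ge0 ?(ltW c1).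
have := @exprB1_bound (sin z) n; rewrite sz0 sin_le1 => /(_ isT).
rewrite -gE => K.
have : (2 * g) ^+ n * (cos 1 * m) <= 1.
  apply: le_trans K; rewrite ler_wpM2l ?exprn_ge0 ?mulr_ge0//.
  apply: (@le_trans _ _ (n%:R * (cos 1 * m ^- 2))).
    rewrite /n natrX -/m le_eqVlt; apply/orP; left; apply/eqP.
    by field; rewrite gt_eqF.
  apply: (@le_trans _ _ (n%:R * sin z)); last by rewrite lerDr.
  rewrite ler_wpM2l//; apply: le_trans s0.
  by rewrite ler_wpM2l// ltW.
rewrite -ler_pdivlMr ?mulr_gt0// => /le_trans; apply.
by rewrite -[2 / _ / _]mulrA -invfM ler_wpM2r ?invr_ge0 ?mulr_ge0 ?ltW//; lra.
Qed.

Lemma smooth_step_cvg a y :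
  smooth_step a j y @[j --> \oo] --> ((a < y)%R%:R : R).
Proof.
have cvg_m (C : R) : C / j.+1%:R @[j --> \oo] --> 0.
  by rewrite -[0](mulr0 C); apply: cvgM; [exact: cvg_cst|exact: cvg_harmonic].
have [ya|ya] := ltP a y.
  apply: (@squeeze_cvgr _ _ _ _
    (fun j => 1 - 2 / (cos 1 * (y - a)) / j.+1%:R) (cst 1)); last 2 first.
  - by rewrite -[X in _ --> X]subr0; apply: cvgB => //; exact: cvg_cst.
  - exact: cvg_cst.
  near=> j; rewrite smooth_step_le1 andbT smooth_step_gt//; apply/andP; split.
    near: j; have := cvg_m 2 => /(cvgr_le 0); apply; first by rewrite subr_gt0.
  near: j; have := nbhs_infty_ger (y - a); apply: filterS => j /le_trans; apply.
  by rewrite ler_nat.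
apply: (@squeeze_cvgr _ _ _ _ (cst 0) (fun j => 2 / cos 1 / j.+1%:R)) => //.
  near=> j; rewrite smooth_step_ge0/= smooth_step_le//.
  rewrite -natr1 addrK.
  by near: j; exact: nbhs_infty_ger.
exact: cvg_cst.
Unshelve. all: by end_near. Qed.

End smooth_step.

(** * Uniqueness of laws with given characteristic functions *)

(** The real inner product of the plane, Re (conj a b). Every real-linear functional of a complex
    number has this form, so characteristic functions are taken along [dot t]; the adjoint of
    multiplication by c is multiplication by its conjugate. *)
Definition dot (R : realType) (a b : R[i]) : R :=
  complex.Re a * complex.Re b + complex.Im a * complex.Im b.

Section dot.
Context {R : realType}.
Implicit Types a b c : R[i].

Lemma dotDl a b c : dot (a + b) c = dot a c + dot b c.
Proof. by case: a b c => [? ?] [? ?] [? ?]; rewrite /dot/=; ring. Qed.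

Lemma dotDr a b c : dot a (b + c) = dot a b + dot a c.
Proof. by case: a b c => [? ?] [? ?] [? ?]; rewrite /dot/=; ring. Qed.

Lemma dotNl a b : dot (- a) b = - dot a b.
Proof. by case: a b => [? ?] [? ?]; rewrite /dot/=; ring. Qed.

Lemma dot0l a : dot 0 a = 0.
Proof. by case: a => [? ?]; rewrite /dot/=; ring. Qed.

Lemma dot0r a : dot a 0 = 0.
Proof. by case: a => [? ?]; rewrite /dot/=; ring. Qed.

Lemma dotZl (k : R) a b : dot (k%:C%C * a) b = k * dot a b.
Proof. by case: a b => [? ?] [? ?]; rewrite /dot/=; ring. Qed.

Lemma dotMr c a b : dot a (c * b) = dot (c^*%C * a) b.
Proof. by case: a b c => [? ?] [? ?] [? ?]; rewrite /dot/=; ring. Qed.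

Lemma dot_suml (I : Type) (s : seq I) (Q : pred I) (f : I -> R[i]) b :
  dot (\sum_(i <- s | Q i) f i) b = \sum_(i <- s | Q i) dot (f i) b.
Proof.
by apply: (big_morph (fun a => dot a b)) => [? ?|]; rewrite ?dotDl ?dot0l.
Qed.

End dot.

(** * Integrals of bounded measurable functions *)

Section bounded_measurable.
Context {R : realType} d {T : measurableType d}.
Implicit Types f g : T -> R.

Definition bounded_measurable f :=
  measurable_fun setT f /\ exists C : R, forall x, `|f x| <= C.

Lemma bounded_measurableD f g : bounded_measurable f -> bounded_measurable g ->
  bounded_measurable (fun x => f x + g x).
Proof.
move=> [mf [C fC]] [mg [D gD]]; split; first exact: measurable_funD.
by exists (C + D) => x; rewrite (le_trans (ler_normD _ _))// lerD.
Qed.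

Lemma bounded_measurableM f g : bounded_measurable f -> bounded_measurable g ->
  bounded_measurable (fun x => f x * g x).
Proof.
move=> [mf [C fC]] [mg [D gD]]; split; first exact: measurable_funM.
by exists (C * D) => x; rewrite normrM ler_pM.
Qed.

Lemma bounded_measurable_cst c : bounded_measurable (fun=> c).
Proof. by split; [exact: measurable_cst|exists `|c|]. Qed.

Lemma bounded_measurable_cos f : measurable_fun setT f ->
  bounded_measurable (fun x => cos (f x)).
Proof.
move=> mf; split; last by exists 1 => x; exact: cos_max.
apply: (measurableT_comp _ mf).
by apply: continuous_measurable_fun; exact: continuous_cos.
Qed.

Lemma bounded_measurable_sin f : measurable_fun setT f ->
  bounded_measurable (fun x => sin (f x)).
Proof.
move=> mf; split; last by exists 1 => x; exact: sin_max.
apply: (measurableT_comp _ mf).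
by apply: continuous_measurable_fun; exact: continuous_sin.
Qed.

Lemma bounded_measurable_indic A : measurable A -> bounded_measurable \1_A.
Proof.
move=> mA; split; first exact: measurable_indic.
by exists 1 => x; rewrite indicE; case: (_ \in _); rewrite ?normr0 ?normr1.
Qed.

Lemma bounded_measurable_integrable (P : probability T R) f :
  bounded_measurable f -> P.-integrable setT (EFin \o f).
Proof.
move=> [mf [C fC]]; apply: measurable_bounded_integrable => //.
  by rewrite (le_lt_trans (probability_le1 P measurableT))// ltry.
exists C; split; first exact: num_real.
by move=> M CM x _; exact: le_trans (fC x) (ltW CM).
Qed.

Lemma Rintegral_probability_cst (P : probability T R) (c : R) :
  \int[P]_x c = c.
Proof. by rewrite Rintegral_cst//= [P setT]probability_setT mulr1. Qed.

Lemma bounded_RintegralD (P : probability T R) f g :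
  bounded_measurable f -> bounded_measurable g ->
  \int[P]_x (f x + g x) = \int[P]_x f x + \int[P]_x g x.
Proof.
by move=> bf bg; rewrite RintegralD//; exact: bounded_measurable_integrable.
Qed.

Lemma bounded_RintegralB (P : probability T R) f g :
  bounded_measurable f -> bounded_measurable g ->
  \int[P]_x (f x - g x) = \int[P]_x f x - \int[P]_x g x.
Proof.
by move=> bf bg; rewrite RintegralB//; exact: bounded_measurable_integrable.
Qed.

Lemma bounded_RintegralZ (P : probability T R) f c : bounded_measurable f ->
  \int[P]_x (c * f x) = c * \int[P]_x f x.
Proof.
by move=> bf; rewrite RintegralZl//; exact: bounded_measurable_integrable.
Qed.

Lemma bounded_Rintegral_fineK (P : probability T R) f : bounded_measurable f ->
  ((\int[P]_x f x)%:E = \int[P]_x (f x)%:E)%E.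
Proof.
move=> bf; rewrite /Rintegral fineK//.
by apply: integrable_fin_num => //; exact: bounded_measurable_integrable.
Qed.

Lemma Rintegral_indic (P : probability T R) A : measurable A ->
  ((\int[P]_x (\1_A x : R))%:E = P A)%E.
Proof.
move=> mA; rewrite bounded_Rintegral_fineK; last exact: bounded_measurable_indic.
by rewrite integral_indic// setIT.
Qed.

Lemma bounded_cvg_Rintegral (P : probability T R) (f : nat -> T -> R) g C :
  (forall n, measurable_fun setT (f n)) -> (forall n x, `|f n x| <= C) ->
  (forall x, f n x @[n --> \oo] --> g x) -> bounded_measurable g ->
  \int[P]_x f n x @[n --> \oo] --> \int[P]_x g x.
Proof.
move=> mf fC fg bg.
have bf n : bounded_measurable (f n) by split => //; exists C => x; exact: fC.
apply: fine_cvg; rewrite bounded_Rintegral_fineK//.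
apply: (@dominated_cvg _ _ _ P setT measurableT (fun n x => (f n x)%:E)
  (fun x => (g x)%:E) (cst C%:E)).
- by move=> n; exact/measurable_EFinP.
- by move=> x _; apply/cvg_EFin; [exact: nearW|exact: fg].
- by [].
- by apply: (@bounded_measurable_integrable P (cst C)); exact: bounded_measurable_cst.
- by move=> n x _ /=; rewrite lee_fin.
Qed.

End bounded_measurable.

Section complex_measurable.
Context {R : realType} d {T : measurableType d}.

(** Measurability is tested on real functionals, so that no sigma-algebra on [R[i]] has to be
    chosen. *)
Definition complex_measurable (f : T -> R[i]) :=
  forall t, measurable_fun setT (fun w => dot t (f w)).

Lemma complex_measurableD f g : complex_measurable f -> complex_measurable g ->
  complex_measurable (fun w => f w + g w).
Proof.
move=> mf mg t; under eq_fun do rewrite dotDr.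
exact: measurable_funD.
Qed.

Lemma complex_measurableM c f : complex_measurable f ->
  complex_measurable (fun w => c * f w).
Proof. by move=> mf t; under eq_fun do rewrite dotMr; exact: mf. Qed.

Lemma complex_measurable_comp d' (T' : measurableType d') (h : T' -> T) f :
  measurable_fun setT h -> complex_measurable f ->
  forall t, measurable_fun setT (fun w => dot t (f (h w))).
Proof. by move=> mh mf t; apply: (measurableT_comp (mf t)). Qed.

Lemma measurable_sum_dot (I : Type) (Y : I -> T -> R[i])
    (l : seq (I * R[i])) (b : R) : (forall i, complex_measurable (Y i)) ->
  measurable_fun setT (fun w => \sum_(p <- l) dot p.2 (Y p.1 w) + b).
Proof.
move=> mY; apply: measurable_funD => //.
by apply: measurable_sum => p; exact: mY.
Qed.

End complex_measurable.

(** Cosines with a phase are enough: the phase -pi/2 gives the sines. A list may repeat an index, so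
    that the product formula for two cosines is encoded by concatenating their lists. *)
Inductive trig_poly (R : realType) (I : Type) : ((I -> R[i]) -> R) -> Prop :=
| trig_cos l b : trig_poly (fun x => cos (\sum_(p <- l) dot p.2 (x p.1) + b))
| trig_add f g : trig_poly f -> trig_poly g -> trig_poly (fun x => f x + g x)
| trig_scale c f : trig_poly f -> trig_poly (fun x => c * f x).

Section trig_poly.
Context {R : realType} {I : Type}.
Implicit Types f g : (I -> R[i]) -> R.

Lemma trig_cst c : @trig_poly R I (fun=> c).
Proof.
rewrite (_ : (fun=> c) =
    fun x : I -> R[i] => c * cos (\sum_(p <- [::]) dot p.2 (x p.1) + 0)).
  exact/trig_scale/trig_cos.
by apply/funext => x; rewrite big_nil addr0 cos0 mulr1.
Qed.

Lemma trig_cosM (l : seq (I * R[i])) b g : trig_poly g ->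
  trig_poly (fun x => cos (\sum_(p <- l) dot p.2 (x p.1) + b) * g x).
Proof.
elim=> {g} [l' b'|f g _ IHf _ IHg|c g _ IHg].
- rewrite (_ : (fun _ => _) = fun x =>
    2^-1 * cos (\sum_(p <- l ++ l') dot p.2 (x p.1) + (b + b')) +
    2^-1 * cos (\sum_(p <- l ++ [seq (p.1, - p.2) | p <- l']) dot p.2 (x p.1)
                + (b - b'))).
    by apply: trig_add; exact/trig_scale/trig_cos.
  apply/funext => x; rewrite !big_cat/= big_map/=.
  under [X in _ + _ * cos (_ + X + _)]eq_bigr do rewrite dotNl.
  rewrite sumrN; set u := \sum_(_ <- l) _; set v := \sum_(_ <- l') _.
  rewrite (_ : u + v + _ = (u + b) + (v + b')); last by ring.
  rewrite (_ : u - v + _ = (u + b) - (v + b')); last by ring.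
  by rewrite (cosD (u + b) (v + b')) (cosB (u + b) (v + b')); field.
- rewrite (_ : (fun _ => _) = fun x =>
    cos (\sum_(p <- l) dot p.2 (x p.1) + b) * f x +
    cos (\sum_(p <- l) dot p.2 (x p.1) + b) * g x); first exact: trig_add.
  by apply/funext => x; rewrite mulrDr.
- rewrite (_ : (fun _ => _) = fun x =>
    c * (cos (\sum_(p <- l) dot p.2 (x p.1) + b) * g x)); first exact: trig_scale.
  by apply/funext => x; rewrite mulrCA.
Qed.

Lemma trig_mul f g : trig_poly f -> trig_poly g ->
  trig_poly (fun x => f x * g x).
Proof.
move=> tf tg; elim: tf => {f} [l b|f1 f2 _ IHf1 _ IHf2|c f _ IHf].
- exact: trig_cosM.
- by under eq_fun do rewrite mulrDl; exact: trig_add.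
- by under eq_fun do rewrite -mulrA; exact: trig_scale.
Qed.

Lemma trig_exp f n : trig_poly f -> trig_poly (fun x => f x ^+ n).
Proof.
move=> tf; elim: n => [|n IH]; first exact: trig_cst.
by under eq_fun do rewrite exprS; exact: trig_mul.
Qed.

Lemma trig_smooth_step (i : I) (t : R[i]) a j :
  trig_poly (fun x => smooth_step a j (dot t (x i))).
Proof.
rewrite /smooth_step.
have tE f n : trig_poly f -> trig_poly (fun x => 1 - f x ^+ n).
  move=> tf; under eq_fun do rewrite -mulN1r.
  by apply: trig_add; [exact: trig_cst|exact/trig_scale/trig_exp].
apply/(tE (fun x => _))/(tE (fun x => sin_level a j (dot t (x i)))).
rewrite /sin_level; apply: trig_mul (trig_cst _).
apply: trig_add; first exact: trig_cst.
set m := j.+1%:R^-1.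
rewrite (_ : (fun _ => _) = fun x => cos (\sum_(p <- [:: (i, m%:C%C * t)])
   dot p.2 (x p.1) + (- (m * (a + m)) - pi / 2))); first exact: trig_cos.
by apply/funext => x; rewrite big_seq1/= dotZl addrA cosBpihalf.
Qed.

Lemma trig_prod (J : Type) (s : seq J) (f : J -> (I -> R[i]) -> R) :
  (forall j, trig_poly (f j)) -> trig_poly (fun x => \prod_(j <- s) f j x).
Proof.
move=> tf; elim: s => [|j s IH].
  by under eq_fun do rewrite big_nil; exact: trig_cst.
by under eq_fun do rewrite big_cons; exact: trig_mul.
Qed.

End trig_poly.

(** Dynkin's pi-lambda argument. The target [T] is a bare type and measurability of the preimages is
    proved along with the equality, so that the lemma serves cylinder sets, Borel sets and products
    alike. *)
Lemma law_unique (R : realType) (T : Type) d1 (T1 : measurableType d1)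
    (P1 : probability T1 R) d2 (T2 : measurableType d2)
    (P2 : probability T2 R) (f1 : T1 -> T) (f2 : T2 -> T) (G : set (set T)) :
  setI_closed G ->
  (forall A, G A -> [/\ measurable (f1 @^-1` A), measurable (f2 @^-1` A) &
                        P1 (f1 @^-1` A) = P2 (f2 @^-1` A)]) ->
  forall A, <<s G >> A -> [/\ measurable (f1 @^-1` A), measurable (f2 @^-1` A) &
                        P1 (f1 @^-1` A) = P2 (f2 @^-1` A)].
Proof.
move=> GI Gf; rewrite -(setI_closed_g_dynkin_g_sigma_algebra GI).
apply: smallest_sub Gf; split=> [|A [mA1 mA2 AE]|F tF GF].
- split; [exact: measurableT|exact: measurableT|].
  exact: etrans (probability_setT P1) (esym (probability_setT P2)).
- split; [exact: measurableC|exact: measurableC|].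
  rewrite -[f1 @^-1` _]/(~` (f1 @^-1` A)) -[f2 @^-1` _]/(~` (f2 @^-1` A)).
  by rewrite !probability_setC// AE.
- have tE S (f : S -> T) : trivIset setT (fun k => f @^-1` F k).
    by move=> i j _ _ [w [Fi Fj]]; apply: tF => //; exists (f w).
  have mF1 k : measurable (f1 @^-1` F k) by case: (GF k).
  have mF2 k : measurable (f2 @^-1` F k) by case: (GF k).
  rewrite !preimage_bigcup; split; [exact: bigcupT_measurable..|].
  rewrite !measure_bigcup//; try exact: tE.
  by apply: eq_eseriesr => k _; case: (GF k).
Qed.

(** * Equality of joint laws from equality of cosine integrals *)

Section trig_uniqueness.
Context {R : realType} {I : Type}.
Context d1 (T1 : measurableType d1) (P1 : probability T1 R).
Context d2 (T2 : measurableType d2) (P2 : probability T2 R).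
Variables (Y : I -> T1 -> R[i]) (Z : I -> T2 -> R[i]).

Definition half_spaces (l : seq (I * R[i] * R)) : set (I -> R[i]) :=
  [set x | all (fun p => p.2 < dot p.1.2 (x p.1.1)) l].

Lemma half_spaces_indic l x : \1_(half_spaces l) x =
  \prod_(p <- l) (p.2 < dot p.1.2 (x p.1.1))%R%:R :> R.
Proof.
rewrite indicE; elim: l => [|p l IH]; first by rewrite big_nil mem_set.
rewrite big_cons -IH; have [pl|pl] := boolP (p.2 < dot p.1.2 (x p.1.1)).
  rewrite mul1r; congr (nat_of_bool _)%:R.
  by apply/idP/idP; rewrite !inE /half_spaces/= pl.
by rewrite mul0r memNset// /half_spaces/= (negPf pl).
Qed.

Hypothesis mY : forall i, complex_measurable (Y i).
Hypothesis mZ : forall i, complex_measurable (Z i).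
Hypothesis YZ : forall (l : seq (I * R[i])) b,
  \int[P1]_w cos (\sum_(p <- l) dot p.2 (Y p.1 w) + b) =
  \int[P2]_w cos (\sum_(p <- l) dot p.2 (Z p.1 w) + b).

Lemma trig_poly_Rintegral f : trig_poly f ->
  [/\ bounded_measurable (fun w => f (Y ^~ w)),
      bounded_measurable (fun w => f (Z ^~ w)) &
      \int[P1]_w f (Y ^~ w) = \int[P2]_w f (Z ^~ w)].
Proof.
elim=> {f} [l b|f g _ [mf1 mf2 fE] _ [mg1 mg2 gE]|c f _ [mf1 mf2 fE]].
- by split; [apply: bounded_measurable_cos; exact: measurable_sum_dot..|exact: YZ].
- by split; rewrite ?bounded_RintegralD ?fE ?gE//; exact: bounded_measurableD.
- by split; rewrite ?bounded_RintegralZ ?fE//;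
    apply: bounded_measurableM => //; exact: bounded_measurable_cst.
Qed.

Lemma measurable_half_spaces d (T : measurableType d) (W : I -> T -> R[i]) l :
  (forall i, complex_measurable (W i)) ->
  measurable [set w | half_spaces l (W ^~ w)].
Proof.
move=> mW; elim: l => [|p l IH].
  rewrite (_ : [set _ | _] = setT)//; exact/seteqP.
rewrite (_ : [set _ | _] = (fun w => dot p.1.2 (W p.1.1 w)) @^-1` `]p.2, +oo[ `&`
    [set w | half_spaces l (W ^~ w)]).
  apply: measurableI => //; rewrite -[X in measurable X]setTI.
  exact: mW.
apply/seteqP; split=> w; rewrite /half_spaces/= in_itv/= andbT.
  by move=> /andP[].
by move=> [-> ->].
Qed.

(** A product of smooth steps is a trigonometric polynomial, hence has the same integral on both
    sides; it is bounded by 1 and tends pointwise to the indicator of the intersection of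
    half-spaces. *)
Lemma half_spaces_law l :
  P1 [set w | half_spaces l (Y ^~ w)] = P2 [set w | half_spaces l (Z ^~ w)].
Proof.
pose f j (x : I -> R[i]) := \prod_(p <- l) smooth_step p.2 j (dot p.1.2 (x p.1.1)).
have tf j : trig_poly (f j) by apply: trig_prod => p; exact: trig_smooth_step.
have fcvg x : f j x @[j --> \oo] --> (\1_(half_spaces l) x : R).
  rewrite half_spaces_indic /f; elim: l {f tf} => [|p s IH].
    by under eq_fun do rewrite big_nil; rewrite big_nil; exact: cvg_cst.
  under eq_fun do rewrite big_cons; rewrite big_cons.
  by apply: cvgM => //; exact: smooth_step_cvg.
have f1 j x : `|f j x| <= 1.
  rewrite /f normr_prod; elim: l {f tf fcvg} => [|p s IH].
    by rewrite big_nil.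
  rewrite big_cons mulr_ile1// ?prodr_ge0// ger0_norm ?smooth_step_ge0//.
  exact: smooth_step_le1.
have H d (T : measurableType d) (P : probability T R) (W : I -> T -> R[i]) :
    (forall i, complex_measurable (W i)) ->
    (forall j, measurable_fun setT (fun w => f j (W ^~ w))) ->
    \int[P]_w f j (W ^~ w) @[j --> \oo] --> fine (P [set w | half_spaces l (W ^~ w)]).
  move=> mW mfW; have mh := measurable_half_spaces l mW.
  rewrite -[X in fine X]Rintegral_indic//=.
  apply: (@bounded_cvg_Rintegral _ _ _ _ _ _ 1) => //.
  exact: bounded_measurable_indic.
have {}tf := fun j => trig_poly_Rintegral (tf j).
have H1 := H _ _ P1 Y mY (fun j => (let: And3 a _ _ := tf j in a).1).
have H2 := H _ _ P2 Z mZ (fun j => (let: And3 _ a _ := tf j in a).1).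
have H12 : (fun j => \int[P1]_w f j (Y ^~ w)) = fun j => \int[P2]_w f j (Z ^~ w).
  by apply/funext => j; case: (tf j).
rewrite H12 in H1.
rewrite -[LHS]fineK; last by apply: fin_num_measure; exact: measurable_half_spaces.
rewrite -[RHS]fineK; last by apply: fin_num_measure; exact: measurable_half_spaces.
by congr (_%:E); exact: (cvg_unique _ H1 H2).
Qed.

Definition cylinder : set (set (I -> R[i])) := range half_spaces.

Lemma cylinder_law A : <<s cylinder>> A ->
  [/\ measurable [set w | A (Y ^~ w)], measurable [set w | A (Z ^~ w)] &
  P1 [set w | A (Y ^~ w)] = P2 [set w | A (Z ^~ w)]].
Proof.
apply: (@law_unique _ _ _ _ P1 _ _ P2 (fun w => Y ^~ w) (fun w => Z ^~ w)).
  move=> _ _ [l1 _ <-] [l2 _ <-]; exists (l1 ++ l2) => //.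
  apply/seteqP; split=> x; rewrite /half_spaces/= all_cat.
    by move/andP.
  by move=> [-> ->].
move=> _ [l _ <-]; split; last exact: half_spaces_law.
- exact: measurable_half_spaces.
- exact: measurable_half_spaces.
Qed.

End trig_uniqueness.

(** * Norm and Borel sets of a separable Banach space *)

Lemma ltr_invS_exists (R : realType) (r : R) : 0 < r ->
  exists m, m.+1%:R^-1 < r.
Proof.
move=> r0; have [m _ mr] := near_infty_natSinv_lt (PosNum r0).
by exists m; exact: mr (leqnn m).
Qed.

Lemma Re_norm_real (R : realType) (k : R) : complex.Re `|k%:C%C| = `|k|.
Proof. by rewrite normc_def/= expr0n addr0 sqrtr_sqr. Qed.

Section real_norm.
Context {R : realType} {E : normedModType R[i]}.
Implicit Types x y : E.

Lemma normE x : `|x| = (rnorm x)%:C%C.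
Proof. by rewrite /rnorm RRe_real// normr_real. Qed.

Lemma rnorm_ge0 x : 0 <= rnorm x.
Proof. by have := normr_ge0 x; rewrite normE lecE => /andP[]. Qed.

Lemma ler_rnormD x y : rnorm (x + y) <= rnorm x + rnorm y.
Proof. by have := ler_normD x y; rewrite !normE lecE => /andP[]. Qed.

Lemma rnormN x : rnorm (- x) = rnorm x.
Proof. by rewrite /rnorm normrN. Qed.

Lemma rnorm_distC x y : rnorm (x - y) = rnorm (y - x).
Proof. by rewrite -rnormN opprB. Qed.

Lemma rnorm0 : rnorm (0 : E) = 0.
Proof. by rewrite /rnorm normr0. Qed.

Lemma rnorm_eq0 x : (rnorm x == 0) = (x == 0).
Proof.
rewrite -(normr_eq0 x) normE; apply/eqP/eqP => [->//|].
by move/eqP; rewrite eq_complex/= => /andP[/eqP].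
Qed.

Lemma rnorm_gt0 x : (0 < rnorm x) = (x != 0).
Proof. by rewrite lt_def rnorm_ge0 andbT rnorm_eq0. Qed.

Lemma rnormZ (c : R[i]) x : rnorm (c *: x) = complex.Re `|c| * rnorm x.
Proof.
rewrite /rnorm normrZ normE -[X in complex.Re (X * _)]RRe_real ?normr_real//.
by rewrite -rmorphM.
Qed.

Lemma rnorm_sum (I : Type) (s : seq I) (Q : pred I) (f : I -> E) :
  rnorm (\sum_(i <- s | Q i) f i) <= \sum_(i <- s | Q i) rnorm (f i).
Proof.
elim/big_ind2: _ => [|a b c e ab ce|//]; first by rewrite rnorm0.
by rewrite (le_trans (ler_rnormD _ _))// lerD.
Qed.

Lemma ler_rnorm_dist (z x y : E) : rnorm (x - y) <= rnorm (x - z) + rnorm (z - y).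
Proof. by rewrite (le_trans _ (ler_rnormD _ _))// addrA subrK. Qed.

Lemma nbhs_rnormP x (A : set E) :
  nbhs x A <-> exists2 r, 0 < r & forall y, rnorm (y - x) < r -> A y.
Proof.
rewrite -nbhs_ballE; split=> [[e /= e0 eA]|[r r0 rA]].
  have eE : (complex.Re e)%:C%C = e by rewrite RRe_real// gtr0_real.
  exists (complex.Re e) => [|y xy]; first by move: e0; rewrite ltcE => /andP[].
  by apply: eA; rewrite -ball_normE/= distrC normE -eE ltcR.
exists r%:C%C => /=; first by rewrite ltcR.
by move=> y; rewrite -ball_normE/= distrC normE ltcR; exact: rA.
Qed.

Lemma cvg_rnormP (T : Type) (F : set_system T) (FF : Filter F) (f : T -> E) (l : E) :
  (f @ F --> l) <-> forall e, 0 < e -> \forall t \near F, rnorm (f t - l) < e.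
Proof.
split=> [fl e e0|fl A /nbhs_rnormP[r r0 rA]].
  by apply: (fl [set y | rnorm (y - l) < e]); apply/nbhs_rnormP; exists e.
by apply: filterS (fl _ r0) => t; exact: rA.
Qed.

Lemma cvg_rnorm (T : Type) (F : set_system T) (FF : Filter F) (f : T -> E) (l : E) :
  f @ F --> l -> rnorm (f t) @[t --> F] --> rnorm l.
Proof.
move=> /cvg_rnormP fl; apply/cvgrPdist_lt => e e0.
apply: filterS (fl _ e0) => t; apply: le_lt_trans.
have := ler_rnormD (f t) (l - f t); have := ler_rnormD l (f t - l).
rewrite (addrC l (f t - l)) (addrC (f t) (l - f t)) !subrK (rnorm_distC l (f t)) => h1 h2.
by rewrite ler_norml; apply/andP; split; lra.
Qed.

Lemma open_rnorm_ball x r : open [set y : E | rnorm (y - x) < r].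
Proof.
rewrite openE => y /= yr; apply/nbhs_rnormP.
exists (r - rnorm (y - x)); first by rewrite subr_gt0.
by move=> z zy /=; rewrite (le_lt_trans (ler_rnorm_dist y _ _))// -ltrBrDr.
Qed.

Definition shrink (U : set E) (m : nat) : set E :=
  [set y | forall z, rnorm (z - y) < m.+1%:R^-1 -> U z].

Lemma closed_shrink U m : closed (shrink U m).
Proof.
rewrite -openC (_ : ~` _ = \bigcup_(z in ~` U) [set y | rnorm (y - z) < m.+1%:R^-1]).
  by apply: bigcup_open => z _; exact: open_rnorm_ball.
apply/seteqP; split=> y /=.
  by move=> /existsNP[z /not_implyP[zy nUz]]; exists z => //=; rewrite rnorm_distC.
by move=> [z nUz /= yz] /(_ z); rewrite rnorm_distC => /(_ yz).
Qed.

(** Membership of the limit in U becomes a countable condition on the sequence alone. One fixed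
    margin 1/(m + 1) must hold eventually, since lying eventually in U would only place the limit in
    the closure. *)
Lemma cvg_shrink U (s : nat -> E) y : open U -> s @ \oo --> y ->
  U y <-> exists m N, forall k, (N <= k)%N -> shrink U m (s k).
Proof.
move=> oU /cvg_rnormP sy; split.
  move=> Uy; have /nbhs_rnormP[r r0 rU] : nbhs y U by exact: open_nbhs_nbhs.
  have /(sy _)[N _ sN] : 0 < r / 2 by rewrite divr_gt0.
  have [m2 m2r] : exists m, m.+1%:R^-1 < r / 2 by apply: ltr_invS_exists; rewrite divr_gt0.
  exists m2, N => k Nk z zs; apply: rU.
  rewrite (le_lt_trans (ler_rnorm_dist (s k) _ _))//.
  have := sN k Nk; have := lt_trans zs m2r; rewrite /=; lra.
move=> [m [N sN]].
have /(sy _)[N' _ sN'] : 0 < m.+1%:R^-1 :> R by rewrite invr_gt0.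
apply: (sN (maxn N N')) => //; first exact: leq_maxl.
by rewrite rnorm_distC; apply: sN' => /=; exact: leq_maxr.
Qed.

End real_norm.

(** * Borel measurability of sums, norms and limits *)

Section borel_measurability.
Context {R : realType} {E : completeNormedModType R[i]}.
Hypothesis sepE : separable E.
Context d {T : measurableType d}.

Lemma open_measurable_fun (S : ptopologicalType) (f : T -> S) :
  (forall U, open U -> measurable (f @^-1` U)) ->
  measurable_fun [set: T] (f : T -> borel S).
Proof.
move=> mf; apply: (@measurability _ _ _ (borel S) _ _ open) => // _ [U oU <-].
by rewrite setTI; exact: mf.
Qed.

Lemma borel_open (S : ptopologicalType) (U : set S) : open U ->
  measurable (U : set (borel S)).
Proof. by move=> oU; exact: sub_sigma_algebra. Qed.

Lemma borel_closed (S : ptopologicalType) (U : set S) : closed U ->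
  measurable (U : set (borel S)).
Proof.
move=> cU; rewrite -[U]setCK; apply: measurableC.
by apply: borel_open; exact: closed_openC.
Qed.

Lemma borel_preimage (S : ptopologicalType) (f : T -> S) U :
  measurable_fun [set: T] (f : T -> borel S) -> measurable (U : set (borel S)) ->
  measurable (f @^-1` U).
Proof. by move=> mf mU; rewrite -[_ @^-1` _]setTI; exact: mf. Qed.

Lemma borel_continuous (S S' : ptopologicalType) (g : S -> S') (f : T -> S) :
  continuous g -> measurable_fun [set: T] (f : T -> borel S) ->
  measurable_fun [set: T] (g \o f : T -> borel S').
Proof.
move=> cg mf; apply: open_measurable_fun => U oU; rewrite comp_preimage.
by apply: borel_preimage => //; apply: borel_open; exact: open_comp.
Qed.

Lemma dense_seq : exists q : nat -> E,
  forall x r, 0 < r -> exists n, rnorm (x - q n) < r.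
Proof.
have [D cD dD] := sepE.
have D0 : D !=set0.
  by have [x [_ Dx]] := dD setT (ex_intro _ 0 I) openT; exists x.
have /countable_injP[f finj] := cD; have [x0 Dx0] := D0.
exists (fun n => xget x0 [set x | D x /\ f x = n]) => x r r0.
have [|y [/= yx Dy]] := dD [set y : E | rnorm (y - x) < r] _ (@open_rnorm_ball _ E _ _).
  by exists x => /=; rewrite subrr rnorm0.
exists (f y); case: xgetP => [z _ [Dz fzy]|/(_ y)[]//].
by rewrite (finj z y) ?inE// rnorm_distC.
Qed.

(** Separability replaces a Borel structure on E x E: the preimage of U is a countable union of
    rectangles of balls centred on a dense sequence, over those rectangles whose sums stay in U. *)
Lemma borel_measurableD (f g : T -> E) :
  measurable_fun [set: T] (f : T -> borel E) ->
  measurable_fun [set: T] (g : T -> borel E) ->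
  measurable_fun [set: T] (fun w => f w + g w : borel E).
Proof.
move=> mf mg; apply: open_measurable_fun => U oU.
have [q qE] := dense_seq.
pose B x (m : nat) := [set y : E | rnorm (y - x) < m.+1%:R^-1].
rewrite (_ : _ @^-1` U = \bigcup_i \bigcup_j \bigcup_(m in [set m |
   forall x y, B (q i) m x -> B (q j) m y -> U (x + y)])
   (f @^-1` B (q i) m `&` g @^-1` B (q j) m)).
  have mB h i m : measurable_fun [set: T] (h : T -> borel E) ->
      measurable (h @^-1` B (q i) m).
    by move=> mh; apply: borel_preimage => //; apply: borel_open; exact: open_rnorm_ball.
  do 3![apply: bigcup_measurable => ? _].
  by apply: measurableI; exact: mB.
apply/seteqP; split=> [w /= Uw|w [i _ [j _ [m /= h [? ?]]]]]; last exact: h.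
have /nbhs_rnormP[r r0 rU] : nbhs (f w + g w) U by exact: open_nbhs_nbhs.
(* Four errors below 1/(m + 1) add up: from x and from f w to q i, from y and from g w to q j. *)
have /ltr_invS_exists[m mr] : 0 < r / 4 by rewrite divr_gt0.
have m0 : 0 < m.+1%:R^-1 :> R by rewrite invr_gt0.
have [i fi] := qE (f w) _ m0; have [j gj] := qE (g w) _ m0.
exists i => //; exists j => //; exists m => //= x y xi yj.
apply: rU; rewrite /B/= in xi yj.
have -> : x + y - (f w + g w) = (x - q i) + (q i - f w) + ((y - q j) + (q j - g w)).
  rewrite [X in _ = X + _]addrA subrK [X in _ = _ + X]addrA subrK.
  by rewrite opprD addrACA.
have := ler_rnormD ((x - q i) + (q i - f w)) ((y - q j) + (q j - g w)).
have := ler_rnormD (x - q i) (q i - f w).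
have := ler_rnormD (y - q j) (q j - g w).
rewrite (rnorm_distC (q i)) (rnorm_distC (q j)).
move: (m.+1%:R^-1) mr fi gj xi yj => a; lra.
Qed.

Lemma borel_measurable_scale (c : T -> R) (e : E) : measurable_fun setT c ->
  measurable_fun [set: T] (fun w => (c w)%:C%C *: e : borel E).
Proof.
move=> mc; apply: open_measurable_fun => U oU.
rewrite (_ : _ @^-1` U = c @^-1` [set r | U (r%:C%C *: e)])//.
rewrite -[X in measurable X]setTI; apply: mc => //.
apply: open_measurable; rewrite openE => r Ur.
have /nbhs_rnormP[e0 e00 eU] : nbhs (r%:C%C *: e) U by exact: open_nbhs_nbhs.
rewrite /interior -nbhs_ballE.
exists (e0 / (rnorm e + 1)) => /=; first by rewrite divr_gt0 ?ltr_wpDl ?rnorm_ge0.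
move=> s; rewrite /ball/= distrC => rs; apply: eU.
rewrite -scalerBl rnormZ -rmorphB Re_norm_real; move: rs; rewrite ltr_pdivlMr ?ltr_wpDl ?rnorm_ge0//.
by apply: le_lt_trans; rewrite ler_wpM2l ?lerDl.
Qed.

Lemma borel_measurable_cscale (f : T -> R[i]) (e : E) : complex_measurable f ->
  measurable_fun [set: T] (fun w => f w *: e : borel E).
Proof.
move=> mf; rewrite (_ : (fun _ => _) = fun w =>
   (dot 1 (f w))%:C%C *: e + (dot 'i%C (f w))%:C%C *: ('i%C *: e)).
  by apply: borel_measurableD; apply: borel_measurable_scale; exact: mf.
apply/funext => w; rewrite scalerA -scalerDl; congr (_ *: _).
case: (f w) => a b; apply/eqP; rewrite eq_complex/= /dot/=.
by apply/andP; split; apply/eqP; ring.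
Qed.

Lemma borel_measurable_sum (I : Type) (s : seq I) (f : I -> T -> E) :
  (forall i, measurable_fun [set: T] (f i : T -> borel E)) ->
  measurable_fun [set: T] (fun w => \sum_(i <- s) f i w : borel E).
Proof.
move=> mf; elim: s => [|i s IH].
  by under eq_fun do rewrite big_nil; exact: measurable_cst.
by under eq_fun do rewrite big_cons; exact: borel_measurableD.
Qed.

Lemma measurable_rnorm (f : T -> E) :
  measurable_fun [set: T] (f : T -> borel E) ->
  measurable_fun [set: T] (fun w => rnorm (f w)).
Proof.
move=> mf; apply: (measurability _ (RGenOInfty.measurableE R)) => _ [_ [a ->] <-].
rewrite setTI (_ : _ @^-1` _ = f @^-1` [set x | a < rnorm x]); last first.
  by apply/seteqP; split=> w /=; rewrite in_itv/= andbT.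
apply: borel_preimage => //; apply: borel_open; rewrite openE => x /= ax.
apply/nbhs_rnormP; exists (rnorm x - a); first by rewrite subr_gt0.
move=> y yx /=; have := ler_rnormD y (x - y); rewrite addrC subrK rnorm_distC; lra.
Qed.

Lemma borel_measurable_cvg (f : nat -> T -> E) (g : T -> E) :
  (forall k, measurable_fun [set: T] (f k : T -> borel E)) ->
  (forall w, f k w @[k --> \oo] --> g w) ->
  measurable_fun [set: T] (g : T -> borel E).
Proof.
move=> mf fg; apply: open_measurable_fun => U oU.
rewrite (_ : g @^-1` U = \bigcup_m \bigcup_N
    \bigcap_(k in [set k | (N <= k)%N]) f k @^-1` shrink U m).
  apply: bigcupT_measurable => m; apply: bigcupT_measurable => N.
  apply: bigcap_measurable => [|k _]; first by exists N => /=.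
  by apply: borel_preimage => //; apply: borel_closed; exact: closed_shrink.
apply/seteqP; split=> w /=.
  by move=> /(cvg_shrink oU (fg w))[m [N h]]; exists m => //; exists N.
by move=> [m _ [N _ h]]; apply/(cvg_shrink oU (fg w)); exists m, N => k; exact: h.
Qed.

End borel_measurability.

(** * Laws of random series *)

Section almost_sure.
Context {R : realType} d {T : measurableType d} (P : probability T R).

Lemma ae_measure_eq (A B : set T) : measurable A -> measurable B ->
  {ae P, forall w, A w <-> B w} -> P A = P B.
Proof.
move=> mA mB AB.
suff H C D : measurable C -> measurable D -> {ae P, forall w, C w <-> D w} ->
    (P C <= P D)%E.
  apply/le_anti; rewrite !H//.
  by apply: filterS AB => w [].
move=> mC mD [N [mN N0 CD]].
apply: (@le_trans _ _ (P (D `|` N))).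
  apply: le_measure; rewrite ?inE//; first exact: measurableU.
  move=> w Cw; have [Dw|nDw] := pselect (D w); [by left|right].
  by apply: CD => /= -[/(_ Cw)].
apply: le_trans (measureU2 _ _ _) _ => //.
have D0 (x y : \bar R) : y = 0%E -> (x + y <= x)%E by move=> ->; rewrite adde0.
exact: D0 N0.
Qed.

Lemma measure_bigcup_gt0 (A : nat -> set T) : (forall n, measurable (A n)) ->
  (0 < P (\bigcup_n A n))%E -> exists n, (0 < P (A n))%E.
Proof.
move=> mA; apply: contraPP => /forallNP nA; apply/negP; rewrite -leNgt.
have A0 n : P (A n) = 0%E by apply/eqP; rewrite -measure_le0 leNgt; apply/negP/nA.
rewrite measure_le0; apply/eqP/negligibleP; first exact: bigcupT_measurable.
by apply: negligible_bigcup => n; exact: (proj2 (negligibleP P (mA n)) (A0 n)).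
Qed.

End almost_sure.

(** * Product probabilities and laws of pairs *)

Section product_probability.
Context {R : realType} d1 d2 {T1 : measurableType d1} {T2 : measurableType d2}.
Variables (P1 : probability T1 R) (P2 : probability T2 R).

Definition product_probability : set (T1 * T2) -> \bar R := (P1 \x P2)%E.

HB.instance Definition _ := Measure.on product_probability.

Let product_setT : product_probability setT = 1%E.
Proof.
rewrite /product_probability -setXTT product_measure1E//.
have M1 (x y : \bar R) : x = 1%E -> y = 1%E -> (x * y = 1)%E.
  by move=> -> ->; rewrite mule1.
exact: M1 (probability_setT P1) (probability_setT P2).
Qed.

HB.instance Definition _ :=
  Measure_isProbability.Build _ _ _ product_probability product_setT.

Lemma product_probabilityE A B : measurable A -> measurable B ->
  product_probability (A `*` B) = (P1 A * P2 B)%E.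
Proof. exact: product_measure1E. Qed.

Lemma ae_product_fst (Q : T1 -> Prop) : {ae P1, forall w, Q w} ->
  {ae product_probability, forall w, Q w.1}.
Proof.
move=> [N [mN N0 QN]]; exists (N `*` setT); split.
- exact: measurableX.
- by rewrite product_probabilityE// N0 mul0e.
- by move=> w /QN.
Qed.

Lemma ae_product_snd (Q : T2 -> Prop) : {ae P2, forall w, Q w} ->
  {ae product_probability, forall w, Q w.2}.
Proof.
move=> [N [mN N0 QN]]; exists (setT `*` N); split.
- exact: measurableX.
- by rewrite product_probabilityE// N0 mule0.
- by move=> w /QN.
Qed.

Lemma Rintegral_product (f : T1 -> R) (g : T2 -> R) :
  bounded_measurable f -> bounded_measurable g ->
  \int[product_probability]_w (f w.1 * g w.2) =
  \int[P1]_w f w * \int[P2]_w g w.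
Proof.
move=> bf bg.
have bf1 : bounded_measurable (fun w : T1 * T2 => f w.1).
  case: bf => mf [C fC]; split; last by exists C.
  by apply: measurableT_comp mf _.
have bg2 : bounded_measurable (fun w : T1 * T2 => g w.2).
  case: bg => mg [C gC]; split; last by exists C.
  by apply: measurableT_comp mg _.
apply: EFin_inj; rewrite bounded_Rintegral_fineK; last exact: bounded_measurableM.
rewrite -(@integral12_prod_meas1 _ _ _ _ _ P1 P2 (fun w => (f w.1 * g w.2)%:E)); last first.
  exact: (@bounded_measurable_integrable _ _ _ product_probability _
    (bounded_measurableM bf1 bg2)).
rewrite /fubini_F/=.
transitivity (\int[P1]_w (f w * \int[P2]_w' g w')%:E)%E.
  apply: eq_integral => w _; rewrite EFinM bounded_Rintegral_fineK//.
  rewrite -integralZl//; last exact: bounded_measurable_integrable.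
rewrite -bounded_Rintegral_fineK; last first.
  by apply: bounded_measurableM => //; exact: bounded_measurable_cst.
congr (_%:E); under eq_Rintegral do rewrite mulrC.
by rewrite bounded_RintegralZ// mulrC.
Qed.

End product_probability.

(** Rectangles form a pi-system that generates the product sigma-algebra. This replaces arbitrary
    independent copies by the two coordinates of a product space. *)
Lemma pair_law (R : realType) d (S : measurableType d)
    d1 (T1 : measurableType d1) (P1 : probability T1 R) (f1 g1 : T1 -> S)
    d2 (T2 : measurableType d2) (P2 : probability T2 R) (f2 g2 : T2 -> S) :
  measurable_fun setT f1 -> measurable_fun setT g1 ->
  measurable_fun setT f2 -> measurable_fun setT g2 ->
  (forall A B, measurable A -> measurable B ->
    P1 (f1 @^-1` A `&` g1 @^-1` B) = P2 (f2 @^-1` A `&` g2 @^-1` B)) ->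
  forall G : set (S * S), measurable G ->
  P1 [set w | G (f1 w, g1 w)] = P2 [set w | G (f2 w, g2 w)].
Proof.
move=> mf1 mg1 mf2 mg2 H G mG.
have mpre d' (T' : measurableType d') (f : T' -> S) A :
    measurable_fun setT f -> measurable A -> measurable (f @^-1` A).
  by move=> mf mA; rewrite -[_ @^-1` _]setTI; exact: mf.
have [] // := @law_unique R (S * S)%type _ _ P1 _ _ P2 (fun w => (f1 w, g1 w))
  (fun w => (f2 w, g2 w)) [set A `*` B | A in measurable & B in measurable] _ _ G.
- move=> _ _ [A mA [B mB <-]] [C mC [D mD <-]].
  exists (A `&` C); first exact: measurableI.
  exists (B `&` D); first exact: measurableI.
  by apply/seteqP; split=> x /= [[? ?] [? ?]].
- move=> _ [A mA [B mB <-]]; split; last exact: H.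
  + by apply: measurableI; exact: mpre.
  + by apply: measurableI; exact: mpre.
- by rewrite -measurable_prod_measurableType.
Qed.

Section series_law.
Context {R : realType} {E : completeNormedModType R[i]}.
Hypothesis sepE : separable E.
Context d1 {T1 : measurableType d1} (P1 : probability T1 R).
Context d2 {T2 : measurableType d2} (P2 : probability T2 R).

Lemma borel_law (S : ptopologicalType) (f : T1 -> S) (g : T2 -> S) :
  measurable_fun [set: T1] (f : T1 -> borel S) ->
  measurable_fun [set: T2] (g : T2 -> borel S) ->
  (forall U, open U -> P1 (f @^-1` U) = P2 (g @^-1` U)) ->
  eq_law P1 (f : T1 -> borel S) P2 (g : T2 -> borel S).
Proof.
move=> mf mg fg A mA.
have [] // := @law_unique R S _ _ P1 _ _ P2 f g open _ _ A mA.
- exact: openI.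
- move=> U oU; split; last exact: fg.
  + by apply: borel_preimage => //; exact: borel_open.
  + by apply: borel_preimage => //; exact: borel_open.
Qed.

Context {I : Type}.
Variables (Y : I -> T1 -> R[i]) (Z : I -> T2 -> R[i]).
Hypothesis mY : forall i, complex_measurable (Y i).
Hypothesis mZ : forall i, complex_measurable (Z i).
Hypothesis YZ : forall (l : seq (I * R[i])) b,
  \int[P1]_w cos (\sum_(p <- l) dot p.2 (Y p.1 w) + b) =
  \int[P2]_w cos (\sum_(p <- l) dot p.2 (Z p.1 w) + b).

Lemma coordinate_measurable (i : I) :
  @complex_measurable R _ (@g_sigma_algebraType (I -> R[i]^o) (@cylinder R I)) (fun x => x i).
Proof.
move=> t; apply: (measurability _ (RGenOInfty.measurableE R)) => _ [_ [a ->] <-].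
rewrite setTI; apply: sub_sigma_algebra; exists [:: (i, t, a)] => //.
Qed.

(* The sum of the series is almost surely in the open set U iff the family of
   coefficients lies in a set that is measurable for the cylinder sigma-algebra
   and does not depend on the probability space. *)
Lemma series_law (s : nat -> seq I) (e : I -> E) (v1 : T1 -> E) (v2 : T2 -> E) :
  measurable_fun [set: T1] (v1 : T1 -> borel E) ->
  measurable_fun [set: T2] (v2 : T2 -> borel E) ->
  {ae P1, forall w, \sum_(i <- s k) Y i w *: e i @[k --> \oo] --> v1 w} ->
  {ae P2, forall w, \sum_(i <- s k) Z i w *: e i @[k --> \oo] --> v2 w} ->
  eq_law P1 (v1 : T1 -> borel E) P2 (v2 : T2 -> borel E).
Proof.
move=> mv1 mv2 Yv1 Zv2; apply: borel_law => // U oU.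
pose S k (x : I -> R[i]) := \sum_(i <- s k) x i *: e i.
pose A := \bigcup_m \bigcup_N
    \bigcap_(k in [set k | (N <= k)%N]) S k @^-1` shrink U m.
have mA : <<s @cylinder R I>> A.
  suff : measurable (A : set (@g_sigma_algebraType (I -> R[i]^o) (@cylinder R I))) by [].
  apply: bigcupT_measurable => m; apply: bigcupT_measurable => N.
  apply: bigcap_measurable => [|k _]; first by exists N => /=.
  apply: (@borel_preimage _ (@g_sigma_algebraType (I -> R[i]^o) (@cylinder R I)) E (S k)).
    apply: (borel_measurable_sum sepE) => i.
    by apply: (borel_measurable_cscale sepE); exact: coordinate_measurable.
  by apply: borel_closed; exact: closed_shrink.
have AE d (T : measurableType d) (P : probability T R) (W : I -> T -> R[i]) v :
    measurable_fun [set: T] (v : T -> borel E) ->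
    {ae P, forall w, \sum_(i <- s k) W i w *: e i @[k --> \oo] --> v w} ->
    measurable [set w | A (W ^~ w)] ->
    P (v @^-1` U) = P [set w | A (W ^~ w)].
  move=> mv Wv mW; apply: ae_measure_eq => //.
    by apply: borel_preimage => //; exact: borel_open.
  apply: filterS Wv => w Wv /=; rewrite (cvg_shrink oU Wv); split.
    by move=> [m [N h]]; exists m => //; exists N.
  by move=> [m _ [N _ h]]; exists m, N => k; exact: h.
have [mA1 mA2 P12] := cylinder_law mY mZ YZ mA.
by rewrite (AE _ _ P1 Y)// (AE _ _ P2 Z).
Qed.

End series_law.

(** * Characteristic functions of independent families *)

Section layer_cake.
Context {R : realType}.

(** The sum counts the integers from 1 to N that do not exceed y, so it is the integer part of y. *)
Lemma sum_threshold (N : nat) (y : R) : 0 <= y <= N%:R ->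
  0 <= y - \sum_(k < N) (k.+1%:R <= y)%R%:R <= 1.
Proof.
elim: N y => [|N IH] y /andP[y0 yN].
  by rewrite big_ord0 subr0 y0 (le_trans yN).
rewrite big_ord_recr/=; have [yN1|yN1] := leP y N%:R.
  rewrite [(N.+1%:R <= y)%R]leNgt (le_lt_trans yN1) ?ltr_nat//= addr0.
  by apply: IH; rewrite y0.
rewrite (eq_bigr (fun=> 1)) => [|k _]; last first.
  by rewrite (le_trans _ (ltW yN1))// ler_nat.
rewrite sumr_const card_ord -[_ *+ _]/(N%:R).
have [h|h] := leP N.+1%:R y.
  have -> : y = N.+1%:R by apply/le_anti; rewrite yN.
  by rewrite -natr1 subrr lexx ler01.
rewrite addr0; move: yN yN1; rewrite -natr1; move: (N%:R) => n h1 h2.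
by apply/andP; split; lra.
Qed.

Context d {S : measurableType d}.

(* Bounded measurable functions are uniform limits of combinations of
   indicators. *)
Lemma bounded_measurable_ind (H : (S -> R) -> Prop) :
  (forall c, H (fun=> c)) ->
  (forall A, measurable A -> H \1_A) ->
  (forall f g, H f -> H g -> H (fun x => f x + g x)) ->
  (forall c f, H f -> H (fun x => c * f x)) ->
  (forall f (g : nat -> S -> R), bounded_measurable f -> (forall n, H (g n)) ->
    (forall n x, `|f x - g n x| <= n.+1%:R^-1) -> H f) ->
  forall f, bounded_measurable f -> H f.
Proof.
move=> Hc HI HD HZ Hl f bf; have [mf [C fC]] := bf.
have [K CK] : exists K : nat, C <= K%:R.
  by exists (Num.truncn `|C|).+1; rewrite (le_trans (ler_norm _))// ltW// truncnS_gt.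
pose A n k := [set x | k.+1%:R <= n.+1%:R * (f x + K%:R)].
(* K shifts f into [0, 2K]. The sum counts the thresholds reached by (n + 1)(f + K), hence is its
   integer part, and the error is at most 1/(n + 1). *)
pose g n x : R := - K%:R + n.+1%:R^-1 * \sum_(k < (n.+1 * (2 * K))%N) \1_(A n k) x.
have mA n k : measurable (A n k).
  rewrite (_ : A n k = f @^-1` `[k.+1%:R / n.+1%:R - K%:R, +oo[).
    by rewrite -[X in measurable X]setTI; exact: mf.
  by apply/seteqP; split=> x; rewrite /A/= in_itv/= andbT lerBlDr ler_pdivrMr// mulrC.
apply: (Hl f g) => // [n|n x].
  apply: (HD _ _ (Hc _)); apply: HZ; elim: (n.+1 * _)%N => [|m IH].
    by under eq_fun do rewrite big_ord0; exact: Hc.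
  by under eq_fun do rewrite big_ord_recr; exact: (HD _ _ IH (HI _ _)).
have n0 : 0 < n.+1%:R :> R by rewrite ltr0Sn.
have fx0 : 0 <= f x + K%:R.
  by have := fC x; rewrite ler_norml => /andP[h _]; rewrite -lerBlDr sub0r (le_trans _ h)// lerN2.
have fxK : f x + K%:R <= 2 * K%:R.
  by have := fC x; rewrite ler_norml => /andP[_ h]; rewrite mulrDl mul1r lerD2r (le_trans h).
have /(_ _)/andP[|h1 h2] := @sum_threshold (n.+1 * (2 * K))%N (n.+1%:R * (f x + K%:R)).
  by rewrite mulr_ge0// natrM natrM ler_wpM2l// ltW.
have gE : \sum_(k < (n.+1 * (2 * K))%N) \1_(A n k) x =
    \sum_(k < (n.+1 * (2 * K))%N) (k.+1%:R <= n.+1%:R * (f x + K%:R))%R%:R :> R.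
  by apply: eq_bigr => k _; rewrite indicE; congr (nat_of_bool _)%:R; apply/idP/idP; rewrite inE.
rewrite /g gE; set s := \sum_(_ < _) _ in h1 h2 *.
have -> : f x - (- K%:R + n.+1%:R^-1 * s) = n.+1%:R^-1 * (n.+1%:R * (f x + K%:R) - s).
  by field; rewrite gt_eqF.
rewrite normrM (ger0_norm h1) gtr0_norm ?invr_gt0//.
by rewrite -[leRHS]mulr1 ler_wpM2l// invr_ge0 ltW.
Qed.

End layer_cake.

Section independence.
Context {R : realType} d {T : measurableType d} (P : probability T R).

Lemma bounded_Rintegral_le (f : T -> R) C : bounded_measurable f ->
  (forall w, `|f w| <= C) -> `|\int[P]_w f w| <= C.
Proof.
move=> bf fC.
apply: le_trans (le_normr_Rintegral _ _) _ => //.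
  exact: bounded_measurable_integrable.
rewrite -[leRHS](@Rintegral_probability_cst _ _ _ P); apply: le_Rintegral => //.
- apply: (@bounded_measurable_integrable _ _ _ P (fun w => `|f w|)).
  case: bf => mf _; split; first exact: measurableT_comp.
  by exists C => w; rewrite normr_id.
- by apply: (@bounded_measurable_integrable _ _ _ P (cst C)); exact: bounded_measurable_cst.
Qed.

Lemma bounded_measurable_comp d' (S : measurableType d') (X : T -> S) (f : S -> R) :
  measurable_fun setT X -> bounded_measurable f -> bounded_measurable (f \o X).
Proof.
move=> mX [mf [C fC]]; split; first exact: measurableT_comp.
by exists C => w; exact: fC.
Qed.

(** The functions f that satisfy the product formula contain the indicators and are closed under the
    operations of [bounded_measurable_ind]. [W] stays an arbitrary bounded factor, so that
    independent coordinates can be split off one at a time. *)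
Lemma indep_Rintegral d' (S : measurableType d') (X : T -> S) (W : T -> R) :
  measurable_fun setT X -> bounded_measurable W ->
  (forall B, measurable B ->
    \int[P]_w (\1_B (X w) * W w) = fine (P (X @^-1` B)) * \int[P]_w W w) ->
  forall f, bounded_measurable f ->
  \int[P]_w (f (X w) * W w) = \int[P]_w f (X w) * \int[P]_w W w.
Proof.
move=> mX bW XW f bf.
have bX (g : S -> R) : bounded_measurable g ->
    bounded_measurable (fun w => g (X w)).
  exact: bounded_measurable_comp.
pose H (g : S -> R) := bounded_measurable g /\
  \int[P]_w (g (X w) * W w) = \int[P]_w g (X w) * \int[P]_w W w.
suff : H f by case.
apply: bounded_measurable_ind bf => [c|A mA|g h [bg gE] [bh hE]|c g [bg gE]|].
- split; first exact: bounded_measurable_cst.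
  by rewrite bounded_RintegralZ// Rintegral_probability_cst.
- split; first exact: bounded_measurable_indic.
  rewrite XW//; congr (_ * _); apply: EFin_inj.
  have mXA : measurable (X @^-1` A) by rewrite -[_ @^-1` _]setTI; exact: mX.
  rewrite fineK ?fin_num_measure// -[LHS](Rintegral_indic P mXA).
  by [].
- split; first exact: bounded_measurableD.
  under eq_Rintegral do rewrite mulrDl.
  rewrite !bounded_RintegralD ?gE ?hE ?mulrDl//; try exact: bX.
  + by apply: bounded_measurableM => //; exact: bX.
  + by apply: bounded_measurableM => //; exact: bX.
- split; first by apply: bounded_measurableM => //; exact: bounded_measurable_cst.
  under eq_Rintegral do rewrite -mulrA.
  rewrite !bounded_RintegralZ ?gE ?mulrA//; first exact: bX.
  by apply: bounded_measurableM => //; exact: bX.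
- move=> {}f g bf Hg fg; split => //; apply/eqP; rewrite -subr_eq0 -normr_le0.
  have [mW [C WC]] := bW.
  have C0 : 0 <= C by exact: le_trans (normr_ge0 _) (WC point).
  apply/ler_addgt0Pl => e e0; rewrite addr0.
  (* Each side moves by at most C/(n + 1) when f is replaced by [g n]; dividing by 2C + 1 instead of
     2C stays legitimate when C = 0. *)
  have [n ne] := ltr_invS_exists (divr_gt0 e0 (ltr_wpDl (mulr_ge0 (ler0n R 2) C0) ltr01)).
  have bfg : bounded_measurable (fun w => f (X w) - g n (X w)).
    under eq_fun do rewrite -mulN1r; apply: bounded_measurableD; first exact: bX.
    apply: bounded_measurableM; first exact: bounded_measurable_cst.
    by apply: bX; case: (Hg n).
  have fE k : bounded_measurable k -> \int[P]_w (f (X w) * k w) =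
      \int[P]_w ((f (X w) - g n (X w)) * k w) + \int[P]_w (g n (X w) * k w).
    move=> bk; rewrite -bounded_RintegralD.
    + by apply: eq_Rintegral => w _; rewrite mulrBl subrK.
    + exact: bounded_measurableM.
    + by apply: bounded_measurableM => //; apply: bX; case: (Hg n).
  have fE1 : \int[P]_w f (X w) =
      \int[P]_w (f (X w) - g n (X w)) + \int[P]_w g n (X w).
    have := fE _ (bounded_measurable_cst 1).
    have M1 (h : T -> R) : \int[P]_w (h w * 1) = \int[P]_w h w.
      by apply: eq_Rintegral => w _; rewrite mulr1.
    by rewrite !M1.
  have [_ gE] := Hg n.
  rewrite fE// fE1 gE mulrDl opprD addrACA subrr addr0.
  have n0 : 0 <= n.+1%:R^-1 :> R by rewrite invr_ge0.
  have h1 : `|\int[P]_w ((f (X w) - g n (X w)) * W w)| <= n.+1%:R^-1 * C.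
    apply: bounded_Rintegral_le; first exact: bounded_measurableM.
    by move=> w; rewrite normrM ler_pM.
  have h2 : `|\int[P]_w (f (X w) - g n (X w))| <= n.+1%:R^-1.
    by apply: bounded_Rintegral_le.
  have h3 : `|\int[P]_w W w| <= C by exact: bounded_Rintegral_le.
  apply: le_trans (ler_normB _ _) _; rewrite normrM.
  apply: (@le_trans _ _ (n.+1%:R^-1 * C + n.+1%:R^-1 * C)).
    by rewrite lerD// ler_pM.
  have -> : n.+1%:R^-1 * C + n.+1%:R^-1 * C = n.+1%:R^-1 * (2 * C) by ring.
  apply: (@le_trans _ _ (n.+1%:R^-1 * (2 * C + 1))).
    by rewrite ler_wpM2l// lerDl.
  by rewrite -ler_pdivlMr ?ltW// ltr_wpDl// mulr_ge0.
Qed.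

End independence.

Lemma normc_ge_Re (R : realType) (z : R[i]) : `|complex.Re z| <= complex.Re `|z|.
Proof.
rewrite normc_def/= -sqrtr_sqr ler_sqrt ?lerDl ?sqr_ge0//.
by rewrite addr_ge0 ?sqr_ge0.
Qed.

Lemma normc_ge_Im (R : realType) (z : R[i]) : `|complex.Im z| <= complex.Re `|z|.
Proof.
rewrite normc_def/= -sqrtr_sqr ler_sqrt ?lerDr ?sqr_ge0//.
by rewrite addr_ge0 ?sqr_ge0.
Qed.

Lemma Re_normc_ge0 (R : realType) (z : R[i]) : 0 <= complex.Re `|z|.
Proof. by rewrite normc_def sqrtr_ge0. Qed.

Lemma dot_le (R : realType) (t z : R[i]) :
  `|dot t z| <= (`|complex.Re t| + `|complex.Im t|) * complex.Re `|z|.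
Proof.
rewrite /dot (le_trans (ler_normD _ _))// !normrM mulrDl.
by rewrite lerD// ler_wpM2l// ?normc_ge_Re ?normc_ge_Im.
Qed.

Lemma complex_measurable_borel (R : realType) :
  complex_measurable (fun z : borel R[i]^o => z : R[i]).
Proof.
move=> t; apply: (measurability _ (RGenOInfty.measurableE R)) => _ [_ [a ->] <-].
rewrite setTI (_ : _ @^-1` _ = [set z | a < dot t z]); last first.
  by apply/seteqP; split=> w /=; rewrite in_itv/= andbT.
apply: borel_open; rewrite openE => z /= az; apply/nbhs_rnormP.
set K := `|complex.Re t| + `|complex.Im t| + 1.
have K0 : 0 < K by rewrite ltr_wpDl// addr_ge0.
exists ((dot t z - a) / K); first by rewrite divr_gt0// subr_gt0.
move=> y; rewrite ltr_pdivlMr// => yz /=.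
have h : `|dot t (y - z)| < dot t z - a.
  apply: le_lt_trans yz; apply: le_trans (dot_le _ _) _.
  rewrite mulrC ler_wpM2l//; first exact: Re_normc_ge0.
  by rewrite lerDl.
have -> : dot t y = dot t z + dot t (y - z) by rewrite -dotDr addrC subrK.
move: h; rewrite ltr_norml => /andP[]; lra.
Qed.

Section transform.
Context {R : realType} d {T : measurableType d} (P : probability T R).
Context {I : eqType}.
Implicit Types (Y : I -> T -> R[i]) (phi : I -> R[i] -> R).

(* The joint characteristic function of the family is the product over i of the
   phi i, which take real values: this pins down the laws of the phases. *)
Definition has_transform Y phi := forall (l : seq (I * R[i])) (b : R),
  \int[P]_w cos (\sum_(p <- l) dot p.2 (Y p.1 w) + b) =
  cos b * \prod_(i <- undup (map fst l)) phi i (\sum_(p <- l | p.1 == i) p.2).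

Lemma big_fiber (V : nmodType) (l : seq (I * R[i])) (F : I * R[i] -> V) :
  \sum_(p <- l) F p =
  \sum_(i <- undup (map fst l)) \sum_(p <- l | p.1 == i) F p.
Proof.
under [RHS]eq_bigr do rewrite big_mkcond.
rewrite exchange_big/=; apply: eq_big_seq => p pl.
rewrite (bigD1_seq p.1)/= ?undup_uniq ?mem_undup ?map_f//.
by rewrite eqxx big1 ?addr0// => i /negPf; rewrite eq_sym => ->.
Qed.

Lemma has_transformM (c : I -> R[i]) Y phi : has_transform Y phi ->
  has_transform (fun i w => c i * Y i w) (fun i t => phi i ((c i)^*%C * t)).
Proof.
move=> HY l b; pose l' := [seq (p.1, (c p.1)^*%C * p.2) : I * R[i] | p <- l].
have l'E : map fst l' = map fst l by rewrite /l' -map_comp; exact: eq_map.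
transitivity (\int[P]_w cos (\sum_(p <- l') dot p.2 (Y p.1 w) + b)).
  apply: eq_Rintegral => w _; rewrite big_map.
  by congr (cos (_ + _)); apply: eq_bigr => p _; rewrite dotMr.
rewrite HY l'E; congr (_ * _); apply: eq_bigr => i _; congr (phi i _).
by rewrite big_map/= big_distrr/=; apply: eq_bigr => p /eqP ->.
Qed.

Lemma eq_has_transform Y phi phi' : (forall i t, phi i t = phi' i t) ->
  has_transform Y phi -> has_transform Y phi'.
Proof. by move=> pE HY l b; rewrite HY; under eq_bigr do rewrite pE. Qed.

Context {dS : measure_display} {S : measurableType dS} (c : S -> R[i]).
Hypothesis mc : complex_measurable c.
Variables (D : set I) (X : I -> T -> S) (phi : I -> R[i] -> R).
Hypothesis mX : forall i, measurable_fun setT (X i).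
Hypothesis indepX : forall (s : seq I) (B : I -> set S), uniq s ->
  (forall i, i \in s -> D i) -> (forall i, measurable (B i)) ->
  P (\bigcap_(i in [set` s]) (X i @^-1` B i)) = (\prod_(i <- s) P (X i @^-1` B i))%E.
Hypothesis phi_cos : forall i t, D i -> \int[P]_w cos (dot t (c (X i w))) = phi i t.
Hypothesis phi_sin : forall i t, D i -> \int[P]_w sin (dot t (c (X i w))) = 0.

Let mXB i B : measurable B -> measurable (X i @^-1` B).
Proof. by move=> mB; rewrite -[_ @^-1` _]setTI; exact: mX. Qed.

Let mdot i t : measurable_fun setT (fun w => dot t (c (X i w))).
Proof. exact: (complex_measurable_comp (mX i) mc). Qed.

Lemma prod_indic (r : seq I) (B : I -> set S) w :
  \prod_(i <- r) \1_(B i) (X i w) =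
  \1_(\bigcap_(i in [set` r]) (X i @^-1` B i)) w :> R.
Proof.
elim: r => [|i r IH].
  by rewrite big_nil indicE mem_set// => i.
rewrite big_cons IH !indicE -natrM mulnb; congr (nat_of_bool _)%:R.
apply/andP/idP => [[]|]; rewrite !inE.
  by move=> Bi Br j; rewrite /= inE => /orP[/eqP -> //|jr]; exact: Br.
move=> Bir; split; first by apply: Bir => /=; rewrite mem_head.
by move=> j jr; apply: Bir => /=; rewrite inE (jr : j \in r) orbT.
Qed.

(** Cosines on l and indicators on r are mixed for the sake of the induction on l: applied with i
    moved to r, the induction hypothesis says that X i is independent of the remaining product, and
    only then is the indicator at i exchanged for a cosine. *)
Lemma indep_transform (l r : seq I) (t : I -> R[i]) (B : I -> set S) b :
  uniq (l ++ r) -> (forall i, i \in l ++ r -> D i) -> (forall i, measurable (B i)) ->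
  \int[P]_w (cos (\sum_(i <- l) dot (t i) (c (X i w)) + b) *
             \prod_(i <- r) \1_(B i) (X i w)) =
  cos b * \prod_(i <- l) phi i (t i) * \prod_(i <- r) fine (P (X i @^-1` B i)).
Proof.
elim: l r B b => [|i l IH] r B b ulr Dlr mB.
  under eq_Rintegral do rewrite big_nil add0r.
  rewrite big_nil mulr1 bounded_RintegralZ; last first.
    under eq_fun do rewrite prod_indic; apply: bounded_measurable_indic.
    by apply: fin_bigcap_measurable => [|j _]; [exact: finite_seq|exact: mXB].
  congr (_ * _); under eq_Rintegral do rewrite prod_indic.
  apply: EFin_inj; rewrite Rintegral_indic; last first.
    by apply: fin_bigcap_measurable => [|j _]; [exact: finite_seq|exact: mXB].
  rewrite indepX// -prodEFin; apply: eq_bigr => j _.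
  by rewrite fineK// fin_num_measure//; exact: mXB.
have [il ul] : (i \notin l ++ r) /\ uniq (l ++ r) by move: ulr => /= /andP[].
pose W b' w := cos (\sum_(i <- l) dot (t i) (c (X i w)) + b') *
   \prod_(i <- r) \1_(B i) (X i w) : R.
have bW b' : bounded_measurable (W b').
  apply: bounded_measurableM.
    apply: bounded_measurable_cos; apply: measurable_funD => //.
    by apply: measurable_sum => j; exact: mdot.
  under eq_fun do rewrite prod_indic; apply: bounded_measurable_indic.
  by apply: fin_bigcap_measurable => [|j _]; [exact: finite_seq|exact: mXB].
have WE b' : \int[P]_w W b' w =
    cos b' * \prod_(i <- l) phi i (t i) * \prod_(i <- r) fine (P (X i @^-1` B i)).
  by apply: IH => // j jlr; apply: Dlr; rewrite inE jlr orbT.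
have indep b' f : bounded_measurable f ->
    \int[P]_w (f (X i w) * W b' w) = \int[P]_w f (X i w) * \int[P]_w W b' w.
  apply: indep_Rintegral => // A mA.
  (* Since i does not occur in r, changing the set at i leaves the other indicators as they are. *)
  pose B' j := if j == i then A else B j.
  have lir : perm_eq (l ++ i :: r) (i :: l ++ r).
    by rewrite (perm_catCA l [:: i] r).
  have B'i : B' i = A by rewrite /B' eqxx.
  have B'r : {in r, forall j, B' j = B j}.
    move=> j jr; rewrite /B'; case: eqP => // ji.
    by move: il; rewrite mem_cat -ji jr orbT.
  transitivity (\int[P]_w (cos (\sum_(i <- l) dot (t i) (c (X i w)) + b') *
             \prod_(i <- i :: r) \1_(B' i) (X i w))).
    apply: eq_Rintegral => w _; rewrite big_cons mulrCA B'i; congr (_ * (_ * _)).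
    by apply: eq_big_seq => j /B'r ->.
  rewrite IH.
  - rewrite WE big_cons B'i mulrCA; congr (_ * (_ * _)).
    by apply: eq_big_seq => j /B'r ->.
  - by rewrite (perm_uniq lir).
  - by move=> j; rewrite (perm_mem lir); exact: Dlr.
  - by move=> j; rewrite /B'; case: ifP.
(* The sine of the remaining sum is a cosine with phase b - pi/2, so [W] covers both terms of the
   addition formula; the second one vanishes because the sine integral of X i is 0. *)
transitivity (\int[P]_w (cos (dot (t i) (c (X i w))) * W b w -
    sin (dot (t i) (c (X i w))) * W (b - pi / 2) w)).
  apply: eq_Rintegral => w _; rewrite big_cons /W.
  set u := dot _ _; set U := \sum_(_ <- l) _.
  by rewrite (addrA U b) cosBpihalf -(addrA u U) cosD; ring.
have bcos : bounded_measurable (fun x => cos (dot (t i) (c x))).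
  by apply: bounded_measurable_cos; exact: mc.
have bsin : bounded_measurable (fun x => sin (dot (t i) (c x))).
  by apply: bounded_measurable_sin; exact: mc.
have Di : D i by apply: Dlr; rewrite mem_head.
rewrite bounded_RintegralB.
- rewrite (indep b (fun x => cos (dot (t i) (c x))))//.
  rewrite (indep _ (fun x => sin (dot (t i) (c x))))//.
  by rewrite phi_cos// phi_sin// mul0r subr0 WE big_cons; ring.
- apply: bounded_measurableM => //.
  exact: (bounded_measurable_comp (mX i) bcos).
- apply: bounded_measurableM => //.
  exact: (bounded_measurable_comp (mX i) bsin).
Qed.

(** Coordinates outside D are set to 0 and have transform 1, which lets the family be indexed by all
    of I. *)
Lemma indep_has_transform :
  has_transform (fun i w => if i \in D then c (X i w) else 0)
                (fun i t => if i \in D then phi i t else 1).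
Proof.
move=> l b; set s := undup (map fst l).
pose t i := \sum_(p <- l | p.1 == i) p.2.
transitivity (\int[P]_w (cos (\sum_(i <- [seq i <- s | i \in D]) dot (t i) (c (X i w)) + b) *
             \prod_(i <- [::]) \1_(@setT S) (X i w))).
  apply: eq_Rintegral => w _; rewrite big_nil mulr1; congr (cos (_ + _)).
  rewrite big_fiber -/s [RHS]big_filter [RHS]big_mkcond/=; apply: eq_bigr => i _.
  rewrite /t dot_suml; case: ifPn => iD.
    by apply: eq_bigr => p /eqP ->; rewrite iD.
  by rewrite big1// => p /eqP ->; rewrite (negPf iD) dot0r.
rewrite (@indep_transform _ _ t (fun=> setT)) ?cats0 ?filter_uniq ?undup_uniq//.
  by rewrite big_nil mulr1 big_filter big_mkcond.
by move=> i; rewrite mem_filter => /andP[/set_mem].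
Qed.

End transform.

Section transform_product.
Context {R : realType} {I : eqType}.
Context d1 {T1 : measurableType d1} (P1 : probability T1 R).
Context d2 {T2 : measurableType d2} (P2 : probability T2 R).
Variables (Y : I -> T1 -> R[i]) (Z : I -> T2 -> R[i]).
Variables (phi psi : I -> R[i] -> R).
Hypothesis mY : forall i, complex_measurable (Y i).
Hypothesis mZ : forall i, complex_measurable (Z i).
Hypothesis HY : has_transform P1 Y phi.
Hypothesis HZ : has_transform P2 Z psi.

Lemma has_transform_add :
  has_transform (product_probability P1 P2) (fun i w => Y i w.1 + Z i w.2)
    (fun i t => phi i t * psi i t).
Proof.
move=> l b.
pose U w := \sum_(p <- l) dot p.2 (Y p.1 w).
pose V w := \sum_(p <- l) dot p.2 (Z p.1 w) + b.
have mU : measurable_fun setT U.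
  have := measurable_sum_dot l 0 mY; under eq_fun do rewrite addr0; exact.
have mV : measurable_fun setT V by exact: measurable_sum_dot.
transitivity (\int[product_probability P1 P2]_w
    (cos (U w.1) * cos (V w.2) - sin (U w.1) * sin (V w.2))).
  apply: eq_Rintegral => w _; rewrite -cosD /U /V addrA -big_split/=.
  by under eq_bigr do rewrite dotDr.
have bc1 := bounded_measurable_cos mU; have bs1 := bounded_measurable_sin mU.
have bc2 := bounded_measurable_cos mV; have bs2 := bounded_measurable_sin mV.
rewrite bounded_RintegralB; last 2 first.
- apply: bounded_measurableM.
  + exact: (bounded_measurable_comp measurable_fst bc1).
  + exact: (bounded_measurable_comp measurable_snd bc2).
- apply: bounded_measurableM.
  + exact: (bounded_measurable_comp measurable_fst bs1).
  + exact: (bounded_measurable_comp measurable_snd bs2).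
rewrite (Rintegral_product P1 P2 bc1 bc2) (Rintegral_product P1 P2 bs1 bs2).
(* The transform at phase -pi/2 carries the factor cos(-pi/2) = 0, so the sine terms of the addition
   formula disappear. *)
have -> : \int[P1]_w sin (U w) = 0.
  under eq_Rintegral do rewrite -cosBpihalf.
  by rewrite HY -[- _]add0r cosBpihalf sin0 mul0r.
have -> : \int[P1]_w cos (U w) = \prod_(i <- undup (map fst l)) phi i (\sum_(p <- l | p.1 == i) p.2).
  under eq_Rintegral do rewrite -[U _]addr0.
  by rewrite HY cos0 mul1r.
by rewrite mul0r subr0 HZ mulrCA -big_split.
Qed.

End transform_product.

(** * The exponent of isotropic stable laws *)

Definition translation (R : realType) (c : R) (x : measurableTypeR R) :
  measurableTypeR R := x + c.

Lemma measurable_translation (R : realType) (c : R) :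
  measurable_fun setT (translation c).
Proof. by apply: measurable_funD. Qed.

HB.instance Definition _ (R : realType) (c : R) :=
  isMeasurableFun.Build _ _ (measurableTypeR R) (measurableTypeR R)
    (translation c) (measurable_translation c).

(** * Translation invariance of Lebesgue measure and integrals over a period *)

Section shift_invariance.
Context {R : realType}.
Notation mu := (@lebesgue_measure R).
Local Open Scope ereal_scope.

Lemma lebesgue_measure_shift (c : R) (A : set R) : measurable A ->
  pushforward mu (translation c) A = mu A.
Proof.
move=> mA; apply/esym/lebesgue_measure_unique => //= _ [[a b]] _ <-.
rewrite /pushforward (_ : _ @^-1` _ = `](a - c)%R, (b - c)%R]%classic).
  by rewrite /= !lebesgue_measure_itv/= !lte_fin ltrD2r -!EFinB opprB addrA subrK.
by apply/seteqP; split=> x /=; rewrite !in_itv/= ltrBlDr lerBrDr.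
Qed.

Lemma ge0_integral_shift (c : R) (D : set R) (f : R -> \bar R) :
  measurable D -> measurable_fun setT f -> (forall x, 0 <= f x) ->
  \int[mu]_(x in D) f x = \int[mu]_(x in (fun x => x + c)%R @^-1` D) f (x + c)%R.
Proof.
move=> mD mf f0.
transitivity (\int[pushforward mu (translation c)]_(x in D) f x).
  apply: eq_measure_integral => A mA AS.
  exact/esym/lebesgue_measure_shift.
apply: (ge0_integral_pushforward (measurable_translation c)) => //.
exact: measurable_funS mf.
Qed.

(** After the shift the domain is [-a, T - a); its part below 0 is moved by one period onto [T - a,
    T). *)
Lemma ge0_integral_period (T : R) (f : R -> \bar R) (a : R) :
  (0 <= a <= T)%R -> measurable_fun setT f -> (forall x, 0 <= f x) ->
  (forall x, f (x + T)%R = f x) ->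
  \int[mu]_(x in `[0%R, T[) f (x - a)%R = \int[mu]_(x in `[0%R, T[) f x.
Proof.
move=> /andP[a0 aT] mf f0 fT.
have T0 : (0 <= T)%R by exact: le_trans aT.
rewrite (@ge0_integral_shift a `[0%R, T[%classic (fun x => f (x - a)%R))//; last first.
  apply: (measurableT_comp (f := f)) => //.
  by apply: measurable_funB.
under eq_integral do rewrite addrK.
rewrite (_ : _ @^-1` _ = `[(- a)%R, 0%R[%classic `|` `[0%R, (T - a)%R[%classic); last first.
  apply/seteqP; split=> x /=; rewrite !in_itv/=.
    move=> /andP[h1 h2]; case: (ltP x 0%R) => x0; [left|right].
      by rewrite andbT -lerBlDr sub0r in h1 *; lra.
    by lra.
  by move=> [|] /andP[h1 h2]; lra.
rewrite ge0_integral_setU//; last 2 first.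
- exact: measurable_funS mf.
- apply/disj_set2P; rewrite -subset0 => x [] /=; rewrite !in_itv/=; lra.
rewrite (_ : \int[mu]_(x in `[(- a)%R, 0%R[) f x = \int[mu]_(x in `[(T - a)%R, T[) f x); last first.
  rewrite [RHS](@ge0_integral_shift T)//.
  under [RHS]eq_integral do rewrite fT.
  congr (integral _ _ _); apply/seteqP; split=> x /=; rewrite !in_itv/=; lra.
rewrite addeC -ge0_integral_setU//.
- congr (integral _ _ _); apply/seteqP; split=> x /=; rewrite !in_itv/=.
    by move=> [|] /andP[h1 h2]; lra.
  by move=> /andP[h1 h2]; case: (ltP x (T - a)%R) => xT; [left|right]; lra.
- exact: measurable_funS mf.
- apply/disj_set2P; rewrite -subset0 => x [] /=; rewrite !in_itv/=; lra.
Qed.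

End shift_invariance.

Section isotropic_exponent.
Context {R : realType} (alpha : R).
Hypothesis alpha_gt0 : 0 < alpha.
Notation mu := (@lebesgue_measure R).

Definition stable_exponent (a b : R) : R :=
  \int[uniform_circle R]_(s in @unit_circle R) (`|a * s.1 + b * s.2| `^ alpha).

Lemma measurable_abs_powR d (T : measurableType d) (f : T -> R) :
  measurable_fun setT f -> measurable_fun setT (fun x => `|f x| `^ alpha).
Proof.
move=> mf; apply: (measurableT_comp (measurable_powR alpha)).
exact: measurableT_comp.
Qed.

Lemma measurable_unit_circle : measurable (@unit_circle R).
Proof.
pose f (s : R * R) := s.1 ^+ 2 + s.2 ^+ 2.
have mf : measurable_fun setT f.
  by apply: measurable_funD; apply: measurable_funX.
rewrite (_ : @unit_circle R = f @^-1` [set 1])//.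
by rewrite -[X in measurable X]setTI; exact: mf.
Qed.

Lemma measurable_circle_powR a b : measurable_fun setT
  (fun x : R => (`|a * cos x + b * sin x| `^ alpha)%:E).
Proof.
apply/measurable_EFinP; apply: measurable_abs_powR.
by apply: measurable_funD; apply: measurable_funM => //;
  apply: continuous_measurable_fun; [exact: continuous_cos|exact: continuous_sin].
Qed.

Lemma integral_circle_fin_num a b :
  (\int[mu]_(x in `[0%R, (2 * pi)%R[) (`|a * cos x + b * sin x| `^ alpha)%:E
    \is a fin_num)%E.
Proof.
apply/fin_numPlt; rewrite (lt_le_trans (ltNyr 0))/=; last first.
  by apply: integral_ge0 => x _; rewrite lee_fin powR_ge0.
apply: le_lt_trans (_ : \int[mu]_(x in `[0%R, (2 * pi)%R[) ((`|a| + `|b|) `^ alpha)%:E < +oo)%E.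
  apply: ge0_le_integral => //.
  - exact: measurable_funS (measurable_circle_powR a b).
  - move=> x _; rewrite lee_fin ge0_ler_powR ?nnegrE ?addr_ge0 ?(ltW alpha_gt0)//.
    rewrite (le_trans (ler_normD _ _))// !normrM lerD// ler_piMr//.
      exact: cos_max.
    exact: sin_max.
rewrite integral_cst//= lebesgue_measure_itv/=; case: ifP => _.
  by rewrite -EFinD -EFinM ltry.
by rewrite mule0 ltry.
Qed.

Lemma stable_exponentE a b : stable_exponent a b =
  (2 * pi)^-1 * fine (\int[mu]_(x in `[0%R, (2 * pi)%R[) (`|a * cos x + b * sin x| `^ alpha)%:E)%E.
Proof.
pose f (s : R * R) := `|a * s.1 + b * s.2| `^ alpha.
have mf : measurable_fun setT f.
  by apply: measurable_abs_powR; apply: measurable_funD; apply: measurable_funM.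
rewrite /stable_exponent Rintegral_mkcond /Rintegral /uniform_circle.
rewrite ge0_integral_distribution; last 2 first.
- apply/measurable_EFinP; apply: (iffLR (measurable_restrictT f measurable_unit_circle)).
  exact: measurable_funS mf.
- by move=> y; rewrite lee_fin patchE; case: ifP => // _; exact: powR_ge0.
rewrite (_ : _ \o _ = fun x => (`|a * cos x + b * sin x| `^ alpha)%:E); last first.
  apply/funext => x /=; rewrite patchE ifT//=.
  by rewrite inE /unit_circle/= cos2Dsin2.
rewrite integral_uniform; last 2 first.
- exact: measurable_circle_powR.
- by move=> x; rewrite lee_fin powR_ge0.
rewrite subr0 -integral_itv_bndo_bndc; last first.
  exact: measurable_funS (measurable_circle_powR a b).
by rewrite fineM// integral_circle_fin_num.
Qed.

Lemma polar (z : R[i]) : exists2 x : R, 0 <= x <= 2 * pi &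
  z = (complex.Re `|z|)%:C%C * expi x.
Proof.
have pi0 := @pi_gt0 R; have [->|z0] := eqVneq z 0.
  exists 0; first by rewrite lexx mulr_ge0// ltW.
  by rewrite normr0 mul0r.
set r := complex.Re _.
have r0 : 0 < r.
  by have := z0; rewrite -normr_gt0 ltcE => /andP[].
have r2 : r ^+ 2 = complex.Re z ^+ 2 + complex.Im z ^+ 2.
  by rewrite /r normc_def/= sqr_sqrtr// addr_ge0 ?sqr_ge0.
case: z z0 @r r0 r2 => a b z0 r r0 /= r2.
have ar : -1 <= a / r <= 1.
  by rewrite -ler_norml normrM normfV (gtr0_norm r0) ler_pdivrMr// mul1r (normc_ge_Re (a +i* b)%C).
have sinE : sin (acos (a / r)) = `|b| / r.
  rewrite sin_acos//; have -> : 1 - (a / r) ^+ 2 = (b / r) ^+ 2.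
    have b2 : b ^+ 2 = r ^+ 2 - a ^+ 2 by rewrite r2 addrAC subrr add0r.
    by rewrite !expr_div_n b2; field; rewrite gt_eqF.
  by rewrite sqrtr_sqr normrM normfV (gtr0_norm r0).
have c0 := acos_ge0 ar; have cpi := acos_lepi ar.
have [b0|b0] := leP 0 b.
  exists (acos (a / r)); first lra.
  rewrite /expi sinE acosK ?in_itv//= ger0_norm//.
  by apply/eqP; rewrite eq_complex/=; apply/andP; split; apply/eqP; field; rewrite gt_eqF.
exists (2 * pi - acos (a / r)); first lra.
rewrite /expi.
have -> : 2 * pi - acos (a / r) = - acos (a / r) + pi *+ 2 :> R.
  by rewrite mulr2n; lra.
rewrite cosD2pi sinD2pi cosN sinN sinE acosK ?in_itv//= ltr0_norm// mulNr opprK.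
by apply/eqP; rewrite eq_complex/=; apply/andP; split; apply/eqP; field; rewrite gt_eqF.
Qed.

Lemma measurable_cos_powR : measurable_fun setT (fun x : R => (`|cos x| `^ alpha)%:E).
Proof.
apply/measurable_EFinP; apply: measurable_abs_powR.
by apply: continuous_measurable_fun; exact: continuous_cos.
Qed.

(** In polar form a cos y + b sin y = r cos(y - x). The factor r^alpha leaves the integral, and the
    angle x disappears by integration over a full period. *)
Lemma stable_exponent_isotropic a b :
  stable_exponent a b = complex.Re `|a +i* b|%C `^ alpha * stable_exponent 1 0.
Proof.
have [x x2pi] := polar (a +i* b)%C; set r := complex.Re _.
have r0 : 0 <= r by exact: Re_normc_ge0.
move=> /eqP; rewrite eq_complex/= !mul0r subr0 addr0 => /andP[/eqP aE /eqP bE].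
rewrite !stable_exponentE mulrCA; congr (_ * _).
have intE : (\int[mu]_(x in `[0%R, (2 * pi)%R[) (`|1 * cos x + 0 * sin x| `^ alpha)%:E =
    \int[mu]_(x in `[0%R, (2 * pi)%R[) (`|cos x| `^ alpha)%:E)%E.
  by apply: eq_integral => y _; rewrite mul1r mul0r addr0.
have fineMl k (y : \bar R) : y \is a fin_num -> k * fine y = fine (k%:E * y).
  by move=> ?; rewrite fineM.
rewrite intE fineMl; last by rewrite -intE integral_circle_fin_num.
have cos_period y : (`|cos (y + 2 * pi)| `^ alpha)%:E = (`|cos y| `^ alpha)%:E :> \bar R.
  by rewrite mulr_natl cosD2pi.
have cos_ge0 y : (0 <= (`|cos y| `^ alpha)%:E :> \bar R)%E by rewrite lee_fin powR_ge0.
rewrite -(ge0_integral_period x2pi measurable_cos_powR cos_ge0 cos_period).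
rewrite -ge0_integralZl; last 4 first.
- exact: measurable_itv.
- apply: measurable_funTS; apply: (measurableT_comp measurable_cos_powR).
  by apply: measurable_funB.
- by move=> y _; exact: cos_ge0.
- by rewrite lee_fin powR_ge0.
congr fine; apply: eq_integral => y _.
rewrite -EFinM -powRM//; congr ((_ `^ _)%:E).
have -> : a * cos y + b * sin y = r * cos (y - x) by rewrite cosB aE bE; ring.
by rewrite normrM (ger0_norm r0).
Qed.

(** On [0, 1], part of the period, the cosine stays above cos 1 > 0. *)
Lemma stable_exponent_gt0 : 0 < stable_exponent 1 0.
Proof.
have c1 : 0 <= cos 1 :> R by rewrite ltW// cos1_gt0.
rewrite stable_exponentE mulr_gt0// ?invr_gt0 ?mulr_gt0 ?pi_gt0//.
apply: fine_gt0; apply/andP; split; last first.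
  by rewrite ltey_eq integral_circle_fin_num.
apply: (@lt_le_trans _ _ (\int[mu]_(x in `[0%R, 1%R]) (cos 1 `^ alpha)%:E)%E).
  rewrite integral_cst//= lebesgue_measure_itv/= lte_fin ltr01 -EFinD -EFinM lte_fin.
  by rewrite subr0 mulr1 powR_gt0// cos1_gt0.
apply: (@le_trans _ _ (\int[mu]_(x in `[0%R, 1%R]) (`|1 * cos x + 0 * sin x| `^ alpha)%:E)%E).
  apply: ge0_le_integral => //.
  - by move=> x _; rewrite lee_fin powR_ge0.
  - exact: measurable_funS (measurable_circle_powR 1 0).
  - move=> x /=; rewrite in_itv/= => /andP[x0 x1].
    rewrite lee_fin mul1r mul0r addr0 ge0_ler_powR ?nnegrE ?(ltW alpha_gt0) ?c1//.
    rewrite (le_trans _ (ler_norm _))//; have pi2 := @pi_ge2 R.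
    have [->//|xn1] := eqVneq x 1.
    by rewrite ltW// ltr_cos ?in_itv/=; lra.
apply: ge0_subset_integral => //.
- exact: measurable_funS (measurable_circle_powR 1 0).
- by move=> x; rewrite /= !in_itv/=; have := @pi_ge2 R; lra.
Qed.

End isotropic_exponent.

(** * Series with stable coefficients *)

Section complex_modulus.
Context {R : realType}.
Implicit Types a b z : R[i].

Lemma Re_normcM a b : complex.Re `|a * b| = complex.Re `|a| * complex.Re `|b|.
Proof. by have := @rnormZ R R[i]^o a b. Qed.

Lemma Re_normc_conj z : complex.Re `|z^*%C| = complex.Re `|z|.
Proof. by case: z => x y; rewrite !normc_def/= sqrrN. Qed.

Lemma Re_normc_eq0 z : (complex.Re `|z| == 0) = (z == 0).
Proof. exact: (@rnorm_eq0 R R[i]^o). Qed.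

Lemma Re_normc1 z : `|z| = 1 -> complex.Re `|z| = 1.
Proof. by move=> ->. Qed.

End complex_modulus.

Section stable_family.
Context {R : realType} (alpha : R).
Hypothesis alpha_gt0 : 0 < alpha.
Context d {Omega : measurableType d} (P : probability Omega R).
Variables (J : set int) (M : set int -> {RV P >-> borel R[i]^o}).
Hypothesis isoM :
  isotropic_stable_random_measure alpha [set A | A `<=` J] (@counting int R) M.

(* The variable X_n of the theorem. *)
Definition coord (n : int) (w : Omega) : R[i] := if n \in J then M [set n] w else 0.

(* The characteristic function, at t, of c X_n for |c|^alpha = r. *)
Definition stable_char (r : int -> R) (n : int) (t : R[i]) : R :=
  if n \in J then expR (- (stable_exponent alpha 1 0 * (r n * complex.Re `|t| `^ alpha)))
  else 1.

Lemma singleton_finite_measure n : J n ->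
  finite_measure_sets [set A | A `<=` J] (@counting int R) [set n].
Proof.
move=> Jn; split; first by move=> _ ->.
by rewrite /counting asboolT ?ltry//; exact: finite_set1.
Qed.

Lemma counting1 (n : int) : fine (@counting int R [set n]) = 1.
Proof.
by rewrite /counting asboolT; [rewrite fset_set1 finmap.cardfs1|exact: finite_set1].
Qed.

Lemma coord_indep (s : seq int) (B : int -> set (borel R[i]^o)) : uniq s ->
  (forall i, i \in s -> J i) -> (forall i, measurable (B i)) ->
  P (\bigcap_(i in [set` s]) (M [set i] @^-1` B i)) =
  (\prod_(i <- s) P (M [set i] @^-1` B i))%E.
Proof.
move=> us sJ mB; have [[indM _] _] := isoM.
pose A (i : 'I_(size s)) := [set tnth (in_tuple s) i].
have {indM} : independent (fun i => M (A i)).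
  apply: indM.
    by move=> i; apply: singleton_finite_measure; apply: sJ; exact: mem_tnth.
  move=> i j _ _ [n []]; rewrite /A/= => -> ij; apply/val_inj/eqP.
  by rewrite -(nth_uniq 0 _ _ us) ?ltn_ord//; move: ij; rewrite !(tnth_nth 0)/= => ->.
move=> /(_ (enum 'I_(size s)) (fun i => B (tnth (in_tuple s) i))).
rewrite enum_uniq => /(_ isT (fun=> mB _)) H.
have sE : s = [seq tnth (in_tuple s) i | i <- enum 'I_(size s)].
  by have := map_tnth_enum (in_tuple s); rewrite -[X in _ = X]/s => ->.
rewrite [in RHS]sE big_map -H; congr (P _).
apply/seteqP; split=> w Hw.
  by move=> i _; apply: Hw => /=; exact: mem_tnth.
move=> n /=; rewrite {1}sE => /mapP[i _ ->].
by apply: (Hw i) => /=; rewrite mem_enum.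
Qed.

Lemma coord_char (n : int) (t : R[i]) : J n ->
  \int[P]_w cos (dot t (M [set n] w : R[i])) = stable_char (fun=> 1) n t /\
  \int[P]_w sin (dot t (M [set n] w : R[i])) = 0.
Proof.
move=> Jn; have [_ /(_ _ (singleton_finite_measure Jn))] := isoM.
move=> /(_ (complex.Re t) (complex.Im t)).
rewrite counting1 mul1r -/(stable_exponent alpha _ _) stable_exponent_isotropic//.
rewrite /Cexpectation => /eqP; rewrite eq_complex/= => /andP[/eqP cE /eqP sE].
split; last by rewrite -[RHS]sE.
rewrite /stable_char mem_set// mul1r mulrC.
by case: t cE sE => a b /= cE _; rewrite -[RHS]cE.
Qed.

Lemma complex_measurable_coord n : complex_measurable (coord n).
Proof.
move=> t; rewrite /coord; case: (n \in J).
  apply: (complex_measurable_comp _ (@complex_measurable_borel R)).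
  exact: measurable_funP.
by under eq_fun do rewrite dot0r; exact: measurable_cst.
Qed.

Lemma coord_transform (c : int -> R[i]) :
  has_transform P (fun n w => c n * coord n w)
                  (stable_char (fun n => complex.Re `|c n| `^ alpha)).
Proof.
have H0 : has_transform P coord (stable_char (fun=> 1)).
  have := @indep_has_transform R _ _ P _ _ (borel R[i]^o) (fun z => z)
    (@complex_measurable_borel R) J (fun n => M [set n])
    (stable_char (fun=> 1)) _ coord_indep.
  move=> H; apply: eq_has_transform (H _ _ _).
  - by move=> n t; rewrite /stable_char; case: (n \in J).
  - by move=> n; exact: measurable_funP.
  - by move=> n t Jn; have [] := coord_char t Jn.
  - by move=> n t Jn; have [_] := coord_char t Jn.
apply: eq_has_transform (has_transformM c H0) => n t.
rewrite /stable_char; case: (n \in J); last by reflexivity.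
by rewrite mul1r Re_normcM Re_normc_conj powRM ?Re_normc_ge0.
Qed.

Lemma coord_transform_add (a b : int -> R[i]) :
  has_transform (product_probability P P)
    (fun n w => a n * coord n w.1 + b n * coord n w.2)
    (stable_char (fun n => complex.Re `|a n| `^ alpha + complex.Re `|b n| `^ alpha)).
Proof.
have mc (c : int -> R[i]) n : complex_measurable (fun w => c n * coord n w).
  by apply: complex_measurableM; exact: complex_measurable_coord.
apply: eq_has_transform (has_transform_add (mc a) (mc b)
  (coord_transform a) (coord_transform b)) => n t.
rewrite /stable_char; case: (n \in J); last by rewrite mulr1.
by rewrite -expRD; congr expR; ring.
Qed.

Lemma coord_phase_eq (a b : int -> R[i]) :
  (forall n, J n -> complex.Re `|a n| = complex.Re `|b n|) ->
  forall (l : seq (int * R[i])) x,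
  \int[P]_w cos (\sum_(p <- l) dot p.2 (a p.1 * coord p.1 w) + x) =
  \int[P]_w cos (\sum_(p <- l) dot p.2 (b p.1 * coord p.1 w) + x).
Proof.
move=> ab l x; rewrite (coord_transform a l x) (coord_transform b l x).
congr (_ * _); apply: eq_bigr => n _; rewrite /stable_char.
by case: ifPn => [/set_mem/ab ->|_]; reflexivity.
Qed.

Lemma coord_phase_add_eq (a b c : int -> R[i]) :
  (forall n, J n -> complex.Re `|a n| `^ alpha + complex.Re `|b n| `^ alpha =
                    complex.Re `|c n| `^ alpha) ->
  forall (l : seq (int * R[i])) x,
  \int[product_probability P P]_w
    cos (\sum_(p <- l) dot p.2 (a p.1 * coord p.1 w.1 + b p.1 * coord p.1 w.2) + x) =
  \int[P]_w cos (\sum_(p <- l) dot p.2 (c p.1 * coord p.1 w) + x).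
Proof.
move=> abc l x; rewrite (coord_transform_add a b l x) (coord_transform c l x).
congr (_ * _); apply: eq_bigr => n _; rewrite /stable_char.
by case: ifPn => [/set_mem/abc ->|_]; reflexivity.
Qed.

Lemma complex_measurable_coordM (c : int -> R[i]) n :
  complex_measurable (fun w => c n * coord n w).
Proof. by apply: complex_measurableM; exact: complex_measurable_coord. Qed.

Lemma complex_measurable_coord_add (a b : int -> R[i]) n :
  complex_measurable (fun w : Omega * Omega => a n * coord n w.1 + b n * coord n w.2).
Proof.
apply: complex_measurableD.
  exact: complex_measurableM (complex_measurable_comp measurable_fst (complex_measurable_coord n)).
exact: complex_measurableM (complex_measurable_comp measurable_snd (complex_measurable_coord n)).
Qed.

Context {E : completeNormedModType R[i]}.
Hypothesis sepE : separable E.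

Section law_of_sums.
Variables (s : nat -> seq int) (u : int -> E).

Lemma coord_series_law (a b : int -> R[i]) (v1 v2 : Omega -> E) :
  (forall n, J n -> complex.Re `|a n| = complex.Re `|b n|) ->
  measurable_fun [set: Omega] (v1 : Omega -> borel E) ->
  measurable_fun [set: Omega] (v2 : Omega -> borel E) ->
  {ae P, forall w, \sum_(n <- s k) (a n * coord n w) *: u n @[k --> \oo] --> v1 w} ->
  {ae P, forall w, \sum_(n <- s k) (b n * coord n w) *: u n @[k --> \oo] --> v2 w} ->
  eq_law P (v1 : Omega -> borel E) P (v2 : Omega -> borel E).
Proof.
move=> ab mv1 mv2 av bv.
exact: (series_law sepE (complex_measurable_coordM a) (complex_measurable_coordM b)
  (coord_phase_eq ab) mv1 mv2 av bv).
Qed.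

Lemma coord_series_law_add (a b c : int -> R[i]) (v1 : Omega * Omega -> E) (v2 : Omega -> E) :
  (forall n, J n -> complex.Re `|a n| `^ alpha + complex.Re `|b n| `^ alpha =
                    complex.Re `|c n| `^ alpha) ->
  measurable_fun [set: Omega * Omega] (v1 : Omega * Omega -> borel E) ->
  measurable_fun [set: Omega] (v2 : Omega -> borel E) ->
  {ae product_probability P P, forall w,
    \sum_(n <- s k) (a n * coord n w.1 + b n * coord n w.2) *: u n @[k --> \oo] --> v1 w} ->
  {ae P, forall w, \sum_(n <- s k) (c n * coord n w) *: u n @[k --> \oo] --> v2 w} ->
  eq_law (product_probability P P) (v1 : Omega * Omega -> borel E)
         P (v2 : Omega -> borel E).
Proof.
move=> abc mv1 mv2 abv cv.
exact: (series_law sepE (complex_measurable_coord_add a b) (complex_measurable_coordM c)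
  (coord_phase_add_eq abc) mv1 mv2 abv cv).
Qed.

End law_of_sums.

End stable_family.

(** * Exhaustions and existence of the sum *)

Section exhaustions.
Context {I : choiceType} (J : set I).
Implicit Types F G : nat -> set I.

Lemma fsum_seq (V : nmodType) (A : set I) (r : seq I) (f : I -> V) : uniq r ->
  [set` r] = A -> \sum_(n \in A) f n = \sum_(n <- r) f n.
Proof.
move=> ur rA; rewrite (fsbigE r)//; last 2 first.
- by rewrite rA.
- by move=> i Ai; rewrite -rA in Ai; rewrite /= in Ai; rewrite Ai.
by rewrite -rA big_seq_cond [RHS]big_seq_cond; apply: eq_bigl => i;
  case: (boolP (i \in r)) => //= ir; rewrite mem_set.
Qed.

Lemma exhaustion_absorb F (B : set I) : finite_exhaustion J F ->
  finite_set B -> B `<=` J -> exists k, B `<=` F k.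
Proof.
move=> [_ Fmono FJ] /finite_seqP[s ->]; elim: s => [|x s IH] sJ.
  by exists 0%N => y.
have [y ys|k sk] := IH; first by apply: sJ => /=; rewrite inE (ys : y \in s) orbT.
have : J x by apply: sJ; rewrite /= mem_head.
rewrite -FJ => -[l _ Fx]; exists (maxn k l) => y; rewrite /= inE => /orP[/eqP ->|/sk].
  exact: Fmono (leq_maxr _ _) _ Fx.
exact: Fmono (leq_maxl _ _) _.
Qed.

(** All the sets of the exhaustion become initial segments of one enumeration of J. Convergence
    along F is thereby a subsequence of the convergence of an ordinary series, the form in which
    stable type is stated. *)
Lemma exhaustion_enumeration F : finite_exhaustion J F -> ~ finite_set J ->
  exists (e : nat -> I) (m : nat -> nat), [/\ injective e, forall i, J (e i),
    forall N, exists k0, forall k, (k0 <= k)%N -> (N <= m k)%N &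
    forall k, uniq (map e (iota 0 (m k))) /\ [set` map e (iota 0 (m k))] = F k].
Proof.
move=> exF infJ; have [finF Fmono FJ] := exF.
have [x0 _] : J !=set0 by apply: infinite_setN0.
have /choice[en enP] k : exists s : seq I, uniq s /\ forall n, n \in s <-> F k n.
  have /finite_seqP[s ->] := finF k.
  by exists (undup s); split=> [|n]; rewrite ?undup_uniq ?mem_undup.
(* Each stage appends only the new elements, so earlier lists are prefixes of later ones and the
   entry at a given position never changes. *)
pose L := fix L k : seq I := if k is k'.+1
  then L k' ++ [seq n <- en k | n \notin L k'] else en 0%N.
have memL k n : n \in L k <-> F k n.
  elim: k => [|k IH] /=; first by case: (enP 0%N).
  rewrite mem_cat mem_filter; split.
    move=> /orP[/IH|/andP[_ /(enP k.+1).2//]]; exact: Fmono.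
  by move=> /(enP k.+1).2 nk; case: (boolP (n \in L k)).
have uL k : uniq (L k).
  elim: k => [|k IH] /=; first by case: (enP 0%N).
  rewrite cat_uniq IH filter_uniq ?(enP k.+1).1// andbT /=.
  by apply/hasPn => n; rewrite mem_filter => /andP[].
have preL k j : exists r, L (k + j)%N = L k ++ r.
  elim: j => [|j [r rE]]; first by exists [::]; rewrite addn0 cats0.
  by rewrite addnS /= rE -catA; eexists.
have bigL N : exists k, (N < size (L k))%N.
  suff [k kN] : exists k, (N.+1 <= size (L k))%N by exists k.
  elim: N.+1 => {N} [|N [k kN]]; first by exists 0%N.
  have [x [Jx nFx]] : exists x, J x /\ ~ F k x.
    apply: contrapT => /forallNP h; apply: infJ.
    apply: (sub_finite_set _ (finF k)) => x Jx; apply: contrapT => nFx.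
    exact: (h x).
  have [l _ Fx] : (\bigcup_k F k) x by rewrite FJ.
  exists (maxn k l); apply: leq_ltn_trans kN _.
  apply: (@uniq_leq_size _ (x :: L k)) => [|y].
    by rewrite /= uL andbT; apply/negP => /memL.
  rewrite inE => /orP[/eqP ->|/memL Fy]; apply/memL.
    exact: Fmono (leq_maxr _ _) _ Fx.
  exact: Fmono (leq_maxl _ _) _ Fy.
pose kk i := projT1 (cid (bigL i)).
have kkP i : (i < size (L (kk i)))%N by rewrite /kk; case: cid.
pose e i := nth x0 (L (kk i)) i.
have eE k i : (i < size (L k))%N -> e i = nth x0 (L k) i.
  move=> ik; rewrite /e; have [h|h] := leqP (kk i) k.
    by have [r] := preL (kk i) (k - kk i)%N; rewrite subnKC// => ->; rewrite nth_cat kkP.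
  by have [r] := preL k (kk i - k)%N; rewrite subnKC ?(ltnW h)// => ->; rewrite nth_cat ik.
have LE k : map e (iota 0 (size (L k))) = L k.
  apply: (@eq_from_nth _ x0) => [|i]; first by rewrite size_map size_iota.
  by rewrite size_map size_iota => ik; rewrite (nth_map 0%N) ?size_iota// nth_iota// add0n (eE k).
exists e, (fun k => size (L k)); split.
- move=> i j; have [k kij] := bigL (maxn i j).
  have ik := leq_ltn_trans (leq_maxl i j) kij.
  have jk := leq_ltn_trans (leq_maxr i j) kij.
  by rewrite (eE k i ik) (eE k j jk) => /eqP; rewrite nth_uniq// => /eqP.
- move=> i; rewrite -FJ; exists (kk i) => //; apply/memL.
  by rewrite (eE _ _ (kkP i)) mem_nth.
- move=> N; have [k0 k0N] := bigL N; exists k0 => k k0k.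
  have [r] := preL k0 (k - k0)%N; rewrite subnKC// => ->.
  by rewrite size_cat (leq_trans (ltnW k0N))// leq_addr.
- by move=> k; rewrite LE; split => //; apply/seteqP; split=> n /memL.
Qed.

(** A third exhaustion takes its sets alternately from F and from G, at indices that tend to
    infinity. Almost sure convergence along it forces the limits along F and G to agree. *)
Lemma exhaustion_interleave F G : finite_exhaustion J F -> finite_exhaustion J G ->
  exists (H : nat -> set I) (c : nat -> nat), [/\ finite_exhaustion J H,
    forall i, (i <= c i)%N &
    forall i, H i = if odd i then G (c i) else F (c i)].
Proof.
move=> exF exG; have [finF Fmono FJ] := exF; have [finG Gmono GJ] := exG.
have step A B k : finite_exhaustion J A -> finite_exhaustion J B ->
    exists l, (k < l)%N /\ A k `<=` B l.
  move=> exA exB; have [finA _ AJ] := exA; have [_ Bmono _] := exB.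
  have [l Al] : exists l, A k `<=` B l.
    by apply: (exhaustion_absorb exB) => // x Ax; rewrite -AJ; exists k.
  exists (maxn k.+1 l); split; first exact: leq_maxl.
  by move=> x /Al; apply: Bmono; exact: leq_maxr.
pose p k := projT1 (cid (step F G k exF exG)).
pose q k := projT1 (cid (step G F k exG exF)).
have pP k : (k < p k)%N /\ F k `<=` G (p k) by rewrite /p; case: cid.
have qP k : (k < q k)%N /\ G k `<=` F (q k) by rewrite /q; case: cid.
pose c := fix c i := if i is i'.+1 then if odd i' then q (c i') else p (c i') else 0%N.
pose H i := if odd i then G (c i) else F (c i).
have cS i : (c i < c i.+1)%N.
  by rewrite /=; case: ifP => _; [case: (qP (c i))|case: (pP (c i))].
have ci i : (i <= c i)%N by elim: i => [//|i IH]; exact: leq_ltn_trans IH (cS i).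
have HS i : H i `<=` H i.+1.
  rewrite /H /=; case: (odd i) => /=; first by case: (qP (c i)).
  by case: (pP (c i)).
exists H, c; split => //; split.
- by move=> i; rewrite /H; case: ifP.
- move=> i j /subnKC <-; elim: (j - i)%N => [|l IH]; first by rewrite addn0.
  by rewrite addnS; apply: subset_trans IH (HS _).
- apply/seteqP; split=> x.
    move=> [i _]; rewrite /H; case: ifP => _ h; first by rewrite -GJ; exists (c i).
    by rewrite -FJ; exists (c i).
  rewrite -FJ => -[k _ Fx]; exists k.*2 => //; rewrite /H odd_double.
  (* The stage 2k is even, so it is a set of F, of index at least 2k and hence at least k. *)
  by apply: Fmono Fx; rewrite (leq_trans _ (ci _))// -addnn leq_addr.
Qed.

End exhaustions.

Definition mfun_of d d' (T : measurableType d) (S : measurableType d')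
  (f : T -> S) (mf : measurable_fun setT f) : {mfun T >-> S} := mfun_Sub (mem_set mf).

Lemma mfun_ofE d d' (T : measurableType d) (S : measurableType d')
  (f : T -> S) (mf : measurable_fun setT f) : mfun_of mf = f :> (T -> S).
Proof. exact: mfun_valP. Qed.

Lemma dot_decomposition (R : realType) (z : R[i]) :
  z = (dot 1 z)%:C%C + 'i%C * (dot 'i%C z)%:C%C.
Proof.
case: z => a b; apply/eqP; rewrite eq_complex/= /dot/=.
by apply/andP; split; apply/eqP; ring.
Qed.

(** * Almost sure convergence of the series from stable type *)

Section existence.
Context {R : realType} (alpha : R).
Hypothesis alpha_gt0 : 0 < alpha.
Context d {Omega : measurableType d} (P : probability Omega R).
Variables (J : set int) (M : set int -> {RV P >-> borel R[i]^o}).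
Hypothesis isoM :
  isotropic_stable_random_measure alpha [set A | A `<=` J] (@counting int R) M.
Context {E : completeNormedModType R[i]}.
Hypothesis sepE : separable E.
Hypothesis typeE : stable_type E alpha.
Variable u : int -> E.
Hypothesis sum_u : (\esum_(n in J) ((rnorm (u n)) `^ alpha)%:E < +oo)%E.

Local Notation X := (coord J M).

Lemma enumeration_sum (e : nat -> int) : injective e -> (forall i, J (e i)) ->
  (\sum_(0 <= n <oo) ((rnorm (u (e n))) `^ alpha)%:E < +oo)%E.
Proof.
move=> inje Je; rewrite nneseries_esumT; last by move=> n; rewrite lee_fin powR_ge0.
rewrite -(@esum_image _ _ _ setT e (fun n => ((rnorm (u n)) `^ alpha)%:E)); last first.
  by move=> i j _ _; exact: inje.
apply: le_lt_trans sum_u.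
rewrite [leLHS]esum_mkcond [leRHS]esum_mkcond; apply: le_esum => n _.
case: (boolP (n \in e @` setT)) => [/set_mem[i _ <-]|_]; first by rewrite mem_set.
by case: ifP => // _; rewrite lee_fin powR_ge0.
Qed.

(** For |t| = 1 the variables [dot t] X_n are i.i.d. real symmetric stable with exponent kappa
    |x|^alpha, so stable type applies after a normalisation. The cases t = 1 and t = i give the real
    and the imaginary parts. *)
Lemma half_series_cvg (e : nat -> int) (t : R[i]) : injective e ->
  (forall i, J (e i)) -> `|t| = 1 ->
  {ae P, forall w, cvgn (series (fun k => (dot t (X (e k) w))%:C%C *: u (e k)))}.
Proof.
move=> inje Je t1.
(* Dividing by kappa^(1/alpha) turns the exponent kappa |x|^alpha into |x|^alpha. *)
pose K : R := stable_exponent alpha 1 0 `^ alpha^-1.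
have K0 : 0 < K by rewrite powR_gt0// stable_exponent_gt0.
have KE : K `^ alpha = stable_exponent alpha 1 0.
  by rewrite -powRrM mulVf ?gt_eqF// powRr1// ltW// stable_exponent_gt0.
pose f (z : borel R[i]^o) : R := K^-1 * dot t (z : R[i]).
have mf : measurable_fun setT f.
  by apply: measurable_funM => //; exact: complex_measurable_borel.
have mth k : measurable_fun setT (f \o M [set e k]) by exact: measurableT_comp.
pose theta k : {RV P >-> R} := mfun_of (mth k).
have thE k w : theta k w = K^-1 * dot t (M [set e k] w : R[i]).
  by rewrite /theta mfun_ofE.
have := typeE (enumeration_sum inje Je) (theta := theta).
move=> /(_ _ _)/wrap[].
- move=> s B us mB.
  (* Independence is known for indices in J; [B'] transports the sets from the positions k to the
     indices e k. The default 0 is read only outside [map e s]. *)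
  pose B' n := f @^-1` B (nth 0%N s (index n (map e s))).
  have B'E k : k \in s -> B' (e k) = f @^-1` B k.
    by move=> ks; rewrite /B' index_map// nth_index.
  have := @coord_indep _ _ _ _ _ _ _ isoM (map e s) B'.
  rewrite map_inj_uniq// => /(_ us).
  have H1 : forall i, i \in map e s -> J i by move=> _ /mapP[k _ ->].
  have H2 : forall i, measurable (B' i).
    by move=> i; rewrite /B' -[X in measurable X]setTI; exact: mf.
  move=> /(_ H1 H2).
  rewrite big_map [in X in _ = X -> _]big_seq => H.
  have thB k : k \in s -> theta k @^-1` B k = M [set e k] @^-1` B' (e k).
    by move=> ks; rewrite B'E//; apply/seteqP; split=> w; rewrite /preimage/= thE.
  rewrite big_seq; under eq_bigr => k ks do rewrite thB//.
  rewrite -H; congr (P _); apply/seteqP; split=> w Hw.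
    by move=> _ /= /mapP[k ks ->]; have := Hw k ks; rewrite thB.
  move=> k ks; rewrite -[_ w]/((theta k @^-1` B k) w) thB//.
  by apply: Hw => /=; exact: map_f.
- move=> k x; rewrite /Cexpectation /expi/=.
  have dE w : x * theta k w = dot ((x / K)%:C%C * t) (M [set e k] w : R[i]).
    by rewrite thE dotZl mulrA.
  under eq_Rintegral do rewrite dE.
  under [X in (_ +i* X)%C]eq_Rintegral do rewrite dE.
  have [-> ->] := coord_char alpha_gt0 isoM ((x / K)%:C%C * t) (Je k).
  rewrite /stable_char mem_set// mul1r Re_normcM Re_norm_real Re_normc1// mulr1.
  rewrite normrM normfV (gtr0_norm K0) powRM ?invr_ge0 ?(ltW K0)//.
  by rewrite -KE mulrCA -powRM ?invr_ge0 ?(ltW K0)// divff ?gt_eqF// powR1 mulr1.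
apply: filterS => w /cvg_ex[l Sl]; apply/cvg_ex; exists (K%:C%C *: l).
rewrite (_ : series _ = fun m => K%:C%C *:
   series (fun n => (theta n w)%:C%C *: u (e n)) m).
  exact: (cvgZ (cvg_cst _) Sl).
apply/funext => m; rewrite /series scaler_sumr; apply: eq_bigr => k _.
by rewrite scalerA thE -rmorphM mulVKf ?gt_eqF// /coord mem_set.
Qed.

Lemma enumeration_cvg (e : nat -> int) : injective e -> (forall i, J (e i)) ->
  {ae P, forall w, cvgn (fun m => \sum_(n <- map e (iota 0 m)) X n w *: u n)}.
Proof.
move=> inje Je.
have i1 : `|'i%C : R[i]| = 1.
  by apply/eqP; rewrite eq_complex normc_def/= expr0n/= add0r expr1n sqrtr1 !eqxx.
have H1 := half_series_cvg inje Je (normr1 _).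
have H2 := half_series_cvg inje Je i1.
apply: filterS2 H1 H2 => w /cvg_ex[l1 S1] /cvg_ex[l2 S2].
apply/cvg_ex; exists (l1 + 'i%C *: l2).
rewrite (_ : (fun _ => _) = fun m =>
  series (fun k => (dot 1 (X (e k) w))%:C%C *: u (e k)) m + 'i%C *:
  series (fun k => (dot 'i%C (X (e k) w))%:C%C *: u (e k)) m).
  by apply: cvgD => //; exact: (cvgZ (cvg_cst _) S2).
apply/funext => m; rewrite /series/= scaler_sumr -big_split/= big_map /index_iota subn0.
by apply: eq_bigr => k _; rewrite scalerA -scalerDl -dot_decomposition.
Qed.

Lemma exhaustion_cvg F : finite_exhaustion J F ->
  {ae P, forall w, cvgn (fun k => \sum_(n \in F k) X n w *: u n)}.
Proof.
move=> exF; have [finJ|infJ] := pselect (finite_set J).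
  have [K FK] := exhaustion_absorb exF finJ (@subset_refl _ J).
  have [_ Fmono FJ] := exF.
  apply: aeW => w; apply/cvg_ex; exists (\sum_(n \in J) X n w *: u n).
  apply: cvg_near_cst; exists K => // k /= Kk; have -> // : F k = J.
  apply/seteqP; split; first by move=> x Fx; rewrite -FJ; exists k.
  by apply: subset_trans FK _; exact: Fmono.
have [e [m [inje Je mN Fm]]] := exhaustion_enumeration exF infJ.
apply: filterS (enumeration_cvg inje Je) => w /cvg_ex[l Sl].
apply/cvg_ex; exists l.
have -> : (fun k => \sum_(n \in F k) X n w *: u n) =
    (fun N => \sum_(n <- map e (iota 0 N)) X n w *: u n) \o m.
  by apply/funext => k /=; have [um <-] := Fm k; exact: fsum_seq.
apply: cvg_comp Sl => A [N _ NA]; have [k0 k0N] := mN N.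
by exists k0 => // k /= k0k; apply: NA => /=; exact: k0N.
Qed.

Definition balls (k : nat) : set int := J `&` [set n | (`|n| <= k)%N].

Lemma exhaustion_balls : finite_exhaustion J balls.
Proof.
split=> [k|k l kl n [Jn nk]|].
- apply: sub_finite_set (_ : _ `<=` (Posz @` `I_k.+1) `|` ((fun m => - Posz m) @` `I_k.+1)) _.
    move=> n [_ /= nk]; case: (leP 0 n) => n0.
      by left; exists `|n|%N; rewrite //= gez0_abs.
    by right; exists `|n|%N; rewrite //= ltz0_abs// opprK.
  by rewrite finite_setU; split; apply: finite_image; exact: finite_II.
- by split => //=; exact: leq_trans kl.
- by apply/seteqP; split=> [n [k _ []]//|n Jn]; exists `|n|%N => //; split => /=.
Qed.

(** The balls and F are interleaved; the almost sure limit along the common exhaustion is reached by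
    both of its subsequences, so the limit along F is also v. *)
Lemma cvg_sum_unique F (v : Omega -> E) :
  {ae P, forall w, \sum_(n \in balls k) X n w *: u n @[k --> \oo] --> v w} ->
  finite_exhaustion J F ->
  {ae P, forall w, \sum_(n \in F k) X n w *: u n @[k --> \oo] --> v w}.
Proof.
move=> bv exF.
have [H [c [exH ci HE]]] := exhaustion_interleave exhaustion_balls exF.
have cH := exhaustion_cvg exH; have cF := exhaustion_cvg exF.
apply: filterS3 bv cF cH => w bw /cvg_ex[l Fl] /cvg_ex[h Hh].
suff -> : v w = l by [].
have sub (G : nat -> set int) (g : E) (a : nat -> nat) :
    \sum_(n \in G k) X n w *: u n @[k --> \oo] --> g ->
    (forall i, (i <= a i)%N) -> (forall i, H (a i) = G (c (a i))) -> g = h.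
  move=> Gg ai HG.
  have a_oo (b : nat -> nat) : (forall i, (i <= b i)%N) -> b i @[i --> \oo] --> \oo.
    by move=> bi A [N _ NA]; exists N => // i /= Ni; apply: NA => /=; exact: leq_trans (bi i).
  have ca i : (i <= c (a i))%N by exact: leq_trans (ai i) (ci _).
  have h1 := cvg_comp _ _ (a_oo _ ca) Gg.
  have h2 := cvg_comp _ _ (a_oo _ ai) Hh.
  apply: (cvg_unique _ _ h2) => //.
  suff -> : (fun k => \sum_(n \in H k) X n w *: u n) \o a =
    (fun k => \sum_(n \in G k) X n w *: u n) \o (fun i => c (a i)) by [].
  by apply/funext => i /=; rewrite HG.
(* Even stages of the interleaved exhaustion are balls, odd stages are sets of F. *)
rewrite (sub balls (v w) double bw) ?(sub F l (fun i => i.*2.+1) Fl)//.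
- by move=> i; rewrite -addnn -addnS leq_addr.
- by move=> i; rewrite HE /= odd_double.
- by move=> i; rewrite -addnn leq_addr.
- by move=> i; rewrite HE odd_double.
Qed.

Lemma measurable_partial_sum (s : seq int) :
  measurable_fun [set: Omega] (fun w => \sum_(n <- s) X n w *: u n : borel E).
Proof.
apply: (borel_measurable_sum sepE) => n; apply: (borel_measurable_cscale sepE).
exact: complex_measurable_coord.
Qed.

Lemma exists_sum : exists v : {RV P >-> borel E},
  {ae P, forall w, \sum_(n \in balls k) X n w *: u n @[k --> \oo] --> (v w : E)}.
Proof.
have [N [mN N0 NS]] := exhaustion_cvg exhaustion_balls.
have [finb _ _] := exhaustion_balls.
have /choice[s sP] k : exists s : seq int, uniq s /\ [set` s] = balls k.
  have /finite_seqP[s ->] := finb k.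
  exists (undup s); rewrite undup_uniq; split => //.
  by apply/seteqP; split=> n /=; rewrite mem_undup.
(* The coefficients are cancelled on the null set, so that the partial sums converge everywhere and
   their limit is measurable. *)
pose Y n w : R[i] := (\1_(~` N) w)%:C%C * X n w.
have mY n : complex_measurable (Y n).
  move=> t; rewrite /Y (_ : (fun _ => _) = fun w => \1_(~` N) w * dot t (X n w)).
    apply: measurable_funM; last exact: complex_measurable_coord.
    by apply: measurable_indic; exact: measurableC.
  apply/funext => w; rewrite dotMr; case: t => a b; case: (X n w) => x y.
  by rewrite /dot/=; ring.
pose S k w := \sum_(n <- s k) Y n w *: u n.
have mS k : measurable_fun [set: Omega] (S k : Omega -> borel E).
  by apply: (borel_measurable_sum sepE) => n; exact: (borel_measurable_cscale sepE).
have SE w : ~ N w -> S ^~ w = fun k => \sum_(n \in balls k) X n w *: u n.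
  move=> nNw; apply/funext => k; have [us sE] := sP k.
  rewrite (fsum_seq _ us sE).
  by apply: eq_bigr => n _; rewrite /Y indicE mem_set// mul1r.
have Sw w : cvgn (S ^~ w).
  have [Nw|nNw] := pselect (N w).
    apply/cvg_ex; exists 0; apply: cvg_near_cst; apply: nearW => k.
    by rewrite /S big1// => n _; rewrite /Y indicE memNset ?mul0r ?scale0r// => /(_ Nw).
  rewrite SE//; apply: contrapT => h; apply: nNw; exact: NS.
have mv : measurable_fun [set: Omega] ((fun w => limn (S ^~ w)) : Omega -> borel E).
  exact: (borel_measurable_cvg mS Sw).
exists (mfun_of mv); exists N; split => // w /= h; apply: contrapT => nNw.
by apply: h; rewrite -SE//; exact: Sw.
Qed.

End existence.

(** * Support of the coordinates *)

(** Write b = p e^(ix) with 0 <= p <= 1. The points p + iq and p - iq with q = sqrt(1 - p^2) lie on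
    the unit circle and have mean p. *)
Lemma half_sum_unit (R : realType) (b : R[i]) : complex.Re `|b| <= 1 ->
  exists k k' : R[i], [/\ complex.Re `|k| = 1, complex.Re `|k'| = 1 &
    b = 2^-1%:C%C * (k + k')].
Proof.
move=> b1; have [x _ bx] := polar b; set p := complex.Re _ in bx b1.
have p0 : 0 <= p := Re_normc_ge0 b.
pose q := Num.sqrt (1 - p ^+ 2).
have q2 : q ^+ 2 = 1 - p ^+ 2 by rewrite sqr_sqrtr// subr_ge0 expr_le1.
have expi1 : complex.Re `|expi x| = 1 by rewrite normc_def/= cos2Dsin2 sqrtr1.
have unit (s : R) : s ^+ 2 = q ^+ 2 -> complex.Re `|expi x * (p +i* s)%C| = 1.
  by move=> sq; rewrite Re_normcM expi1 mul1r normc_def/= sq q2 addrCA subrr addr0 sqrtr1.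
exists (expi x * (p +i* q)%C), (expi x * (p +i* (- q))%C); split.
- exact: unit.
- by apply: unit; rewrite sqrrN.
rewrite [LHS]bx; case: (expi x) => c s.
by apply/eqP; rewrite eq_complex/=; apply/andP; split; apply/eqP; field.
Qed.

Section positive_probability.
Context {R : realType} (alpha : R).
Hypothesis alpha_gt0 : 0 < alpha.
Hypothesis alpha_le2 : alpha <= 2.
Context d {Omega : measurableType d} (P : probability Omega R).
Variables (J : set int) (M : set int -> {RV P >-> borel R[i]^o}).
Hypothesis isoM :
  isotropic_stable_random_measure alpha [set A | A `<=` J] (@counting int R) M.

Local Notation X := (coord J M).
Local Notation kappa := (stable_exponent alpha 1 0).

Lemma coord_cos n (t : R) : J n ->
  \int[P]_w cos (t * dot 1 (X n w)) = expR (- (kappa * `|t| `^ alpha)).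
Proof.
move=> Jn; have [cE _] := coord_char alpha_gt0 isoM (t%:C%C * 1) Jn.
transitivity (\int[P]_w cos (dot (t%:C%C * 1) (M [set n] w : R[i]))).
  by apply: eq_Rintegral => w _; rewrite dotZl /coord mem_set.
by rewrite cE /stable_char mem_set// mul1r mulr1 Re_norm_real.
Qed.

Definition coord_gt (n : int) (t : R[i]) (m : R) : set Omega :=
  [set w | m < dot t (X n w)].

Lemma measurable_coord_gt n t m : measurable (coord_gt n t m).
Proof.
rewrite (_ : coord_gt n t m = (fun w => dot t (X n w)) @^-1` `]m, +oo[).
  by rewrite -[X in measurable X]setTI; apply: complex_measurable_coord.
by apply/seteqP; split=> w /=; rewrite in_itv/= andbT.
Qed.

(* The left-hand side of the conclusion is E (1 - cos (t Re X_n)). *)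
Lemma coord_cos_bound n (t r C : R) : J n ->
  P (coord_gt n 1%R r) = 0%E -> P (coord_gt n (-1)%R r) = 0%E ->
  0 <= C -> (forall y, `|y| <= r -> 1 - cos (t * y) <= C) ->
  1 - expR (- (kappa * `|t| `^ alpha)) <= C.
Proof.
move=> Jn P1 P2 C0 tC; rewrite -(coord_cos _ Jn).
pose A (s : R[i]) := coord_gt n s r.
have mA s : measurable (A s) := measurable_coord_gt n s r.
have bI s : bounded_measurable (\1_(A s) : Omega -> R).
  exact: bounded_measurable_indic.
have I0 s : P (A s) = 0%E -> \int[P]_w (\1_(A s) w : R) = 0.
  by move=> PA; apply: EFin_inj; rewrite Rintegral_indic.
have bcos : bounded_measurable (fun w => cos (t * dot 1 (X n w))).
  apply: bounded_measurable_cos; apply: measurable_funM => //.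
  exact: complex_measurable_coord.
have b2 : bounded_measurable (fun w => 2 * (\1_(A 1) w + \1_(A (-1)) w) : R).
  by apply: bounded_measurableM; [exact: bounded_measurable_cst|exact: bounded_measurableD].
(* C covers the event |Re X_n| <= r; elsewhere 1 - cos is at most 2, and the two indicators
   integrate to 0. *)
have : \int[P]_w (1 - cos (t * dot 1 (X n w))) <=
       \int[P]_w (C + 2 * (\1_(A 1) w + \1_(A (-1)) w)).
  apply: le_Rintegral => //.
  - apply: bounded_measurable_integrable.
    under eq_fun do rewrite -mulN1r; apply: bounded_measurableD.
      exact: bounded_measurable_cst.
    by apply: bounded_measurableM => //; exact: bounded_measurable_cst.
  - apply: bounded_measurable_integrable; apply: bounded_measurableD => //.
    exact: bounded_measurable_cst.
  move=> w _; have ind0 (B : set Omega) : 0 <= \1_B w :> R by rewrite indicE.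
  have cosN1 := cos_geN1 (t * dot 1 (X n w)).
  have [h1|h1] := ltP r (dot 1 (X n w)).
    have -> : \1_(A 1) w = 1 :> R by rewrite indicE mem_set.
    by have := ind0 (A (-1)); lra.
  have [h2|h2] := ltP r (dot (-1) (X n w)).
    have -> : \1_(A (-1)) w = 1 :> R by rewrite indicE mem_set.
    by have := ind0 (A 1); lra.
  have := tC (dot 1 (X n w)); rewrite ler_norml h1 andbT lerNl -dotNl h2 => /(_ isT).
  by have := ind0 (A 1); have := ind0 (A (-1)); lra.
rewrite bounded_RintegralB//; last exact: bounded_measurable_cst.
rewrite bounded_RintegralD//; last exact: bounded_measurable_cst.
rewrite bounded_RintegralZ; last exact: bounded_measurableD.
rewrite bounded_RintegralD// !Rintegral_probability_cst !I0//.
by rewrite addr0 mulr0 addr0.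
Qed.

Lemma coord_gt_sym n m : P (coord_gt n (-1)%R m) = P (coord_gt n 1%R m).
Proof.
pose a : int -> R[i] := fun=> -1; pose b : int -> R[i] := fun=> 1.
have ab k : J k -> complex.Re `|a k| = complex.Re `|b k| by rewrite /a normrN.
have := half_spaces_law (complex_measurable_coordM J M a)
  (complex_measurable_coordM J M b) (coord_phase_eq alpha_gt0 isoM ab) [:: (n, 1, m)].
rewrite /half_spaces/=.
have -> : [set w | (m < dot 1 (-1 * X n w)) && true] = coord_gt n (-1)%R m.
  rewrite /coord_gt; apply/seteqP; split=> w /=; rewrite andbT mulN1r;
    by rewrite (_ : dot 1 (- X n w) = dot (-1) (X n w))//; case: (X n w) => x y; rewrite /dot/=; ring.
have -> : [set w | (m < dot 1 (1 * X n w)) && true] = coord_gt n 1%R m.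
  by apply/seteqP; split=> w /=; rewrite andbT mul1r.
by [].
Qed.

(** Two independent copies add up in law to 2^(1/alpha) times one, and both exceeding m forces the
    sum above 2m. The threshold is thus multiplied by 2^(1 - 1/alpha). *)
Lemma coord_gt_double n m :
  (P (coord_gt n 1%R m) * P (coord_gt n 1%R m) <=
   P (coord_gt n 1%R ((2 * m) / 2 `^ alpha^-1)%R))%E.
Proof.
have q0 : 0 < 2 `^ alpha^-1 :> R by rewrite powR_gt0.
pose a : int -> R[i] := fun=> 1.
pose c : int -> R[i] := fun=> (2 `^ alpha^-1)%:C%C.
have aac k : J k -> complex.Re `|a k| `^ alpha + complex.Re `|a k| `^ alpha =
    complex.Re `|c k| `^ alpha.
  move=> _; rewrite /c Re_norm_real /a normr1/= powR1.
  by rewrite (gtr0_norm q0) -powRrM mulVf ?gt_eqF// powRr1.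
have mX2 := complex_measurable_coord_add J M a a.
have := half_spaces_law mX2 (complex_measurable_coordM J M c)
  (coord_phase_add_eq alpha_gt0 isoM aac) [:: (n, 1, 2 * m)].
rewrite /half_spaces/=.
have -> : [set w | (2 * m < dot 1 ((2 `^ alpha^-1)%:C%C * X n w)) && true] =
    coord_gt n 1%R ((2 * m) / 2 `^ alpha^-1).
  have dotq z : dot 1 ((2 `^ alpha^-1)%:C%C * z) = dot 1 z * 2 `^ alpha^-1.
    by case: z => x y; rewrite /dot/=; ring.
  by apply/seteqP; split=> w; rewrite /coord_gt/= andbT ltr_pdivrMr// dotq.
move=> <-.
rewrite -product_probabilityE; try exact: measurable_coord_gt.
apply: le_measure; rewrite ?inE.
- by apply: measurableX; exact: measurable_coord_gt.
- have := measurable_half_spaces [:: (n, 1, 2 * m)] mX2.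
  by rewrite /half_spaces.
- by move=> w []; rewrite /coord_gt/= => h1 h2; rewrite /a andbT dotDr !mul1r; lra.
Qed.

(** For alpha < 2, 1 - exp(-kappa t^alpha) has order t^alpha at 0, whereas a variable bounded by r
    only allows order t^2. For alpha = 2 the orders agree, but a charged threshold can be multiplied
    by sqrt 2 repeatedly; that growth fails for alpha <= 1, so neither argument covers the whole
    range. *)
Lemma coord_unbounded n r : J n -> (0 < P (coord_gt n 1%R r))%E.
Proof.
move=> Jn.
have kappa0 := stable_exponent_gt0 alpha_gt0.
suff H : exists2 m, r <= m & (0 < P (coord_gt n 1%R m))%E.
  have [m rm /lt_le_trans] := H; apply; apply: le_measure; rewrite ?inE;
    try exact: measurable_coord_gt.
  by move=> w /=; exact: le_lt_trans.
wlog r1 : r / 1 <= r.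
  move=> H; have r1 : 1 <= Num.max r 1 by rewrite le_max lexx orbT.
  have [m rm Pm] := H _ r1.
  by exists m => //; rewrite (le_trans _ rm)// le_max lexx.
have P0 m : ~ (0 < P (coord_gt n 1%R m))%E ->
    P (coord_gt n 1%R m) = 0%E.
  by move=> /negP; rewrite -leNgt measure_le0 => /eqP.
move: alpha_le2; rewrite le_eqVlt => /orP[/eqP a2|a2].
  pose q : R := 2 / 2 `^ alpha^-1.
  have q2 : q ^+ 2 = 2.
    have h : (2 `^ alpha^-1) ^+ 2 = 2 :> R.
      by rewrite -powR_mulrn ?powR_ge0// -powRrM a2 mulVf// powRr1.
    by rewrite expr_div_n h expr2 mulfK.
  have q1 : 1 < q.
    rewrite -(@ltr_pXn2r _ 2)// ?nnegrE ?divr_ge0 ?powR_ge0//.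
    by rewrite expr1n q2; lra.
  have [m m0 Pm] : exists2 m, 0 < m & (0 < P (coord_gt n 1%R m))%E.
    apply: contrapT => h.
    have h0 m : 0 < m -> P (coord_gt n 1%R m) = 0%E.
      by move=> m0; apply: P0 => Pm; apply: h; exists m.
    (* e is the mean of 1 - cos(Re X_n). If no positive threshold is charged, the bound at t = 1 and
       r = e reads e <= e^2/2, impossible for 0 < e < 1. *)
    pose e : R := 1 - expR (- kappa).
    have e0 : 0 < e by rewrite subr_gt0 expR_lt1// oppr_lt0.
    have e1 : e < 1 by rewrite gtrBl expR_gt0.
    have := @coord_cos_bound n 1 e (e ^+ 2 / 2) Jn.
    rewrite coord_gt_sym h0// => /(_ erefl erefl).
    rewrite normr1 powR1 mulr1 -/e => /(_ _ _)/wrap[].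
    - by rewrite divr_ge0 ?sqr_ge0.
    - move=> y ye; rewrite mul1r (le_trans (subr1_cos_le y))// ler_pM2r//.
      by rewrite -(real_normK (num_real y)) lerXn2r ?nnegrE// ltW.
    - by apply/negP; rewrite -ltNge; nra.
  have grow k : (0 < P (coord_gt n 1%R (m * q ^+ k)%R))%E.
    elim: k => [|k IH]; first by rewrite expr0 mulr1.
    have := @coord_gt_double n (m * q ^+ k).
    have -> : 2 * (m * q ^+ k) / 2 `^ alpha^-1 = m * q ^+ k.+1.
      by rewrite exprS /q; ring.
    by apply: lt_le_trans; rewrite mule_gt0.
  (* By Bernoulli q^k >= 1 + k(q - 1), so this k brings m q^k above r. *)
  have [k kr] : exists k : nat, r / m <= k%:R * (q - 1).
    exists (Num.truncn (`|r / m| / (q - 1))).+1.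
    rewrite -ler_pdivrMr ?subr_gt0// ltW// (le_lt_trans _ (truncnS_gt _))//.
    by rewrite ler_pM2r ?invr_gt0 ?subr_gt0// ler_norm.
  exists (m * q ^+ k) => //.
  rewrite mulrC -ler_pdivrMr// (le_trans kr)//.
  have := @bernoulli_ineq _ (q - 1) k; rewrite addrCA subrr addr0.
  move=> h; apply: le_trans (h _); last by lra.
  by rewrite lerDr.
exists r => //; apply: contrapT => /P0 h.
have bound t : 0 < t -> 1 - expR (- (kappa * t `^ alpha)) <= t ^+ 2 * r ^+ 2 / 2.
  move=> t0; have := @coord_cos_bound n t r (t ^+ 2 * r ^+ 2 / 2) Jn.
  rewrite coord_gt_sym h (gtr0_norm t0); apply => //.
    by rewrite divr_ge0// mulr_ge0 ?sqr_ge0.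
  move=> y yr; rewrite (le_trans (subr1_cos_le _))// exprMn ler_pM2r//.
  rewrite ler_pM2l ?exprn_gt0// -(real_normK (num_real y)).
  by rewrite lerXn2r ?nnegrE// (le_trans ler01).
(* D is the constant for which the bound turns into 1 <= D t^(2 - alpha); t is then chosen with t^(2
   - alpha) = 1/(2D + 1), which contradicts it. *)
pose D := r ^+ 2 * (1 + kappa) / (2 * kappa).
have D0 : 0 <= D.
  by apply: divr_ge0; apply: mulr_ge0; rewrite ?sqr_ge0// ?addr_ge0// ltW.
have a20 : 0 < 2 - alpha by rewrite subr_gt0.
pose t := (2 * D + 1)^-1 `^ (2 - alpha)^-1.
have D1 : 0 < 2 * D + 1 by rewrite ltr_wpDl// mulr_ge0.
have t0 : 0 < t by rewrite powR_gt0// invr_gt0.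
have pow1 (x : R) : 1 = 1 `^ x by rewrite powR1.
have t1 : t <= 1.
  rewrite [leRHS](pow1 (2 - alpha)^-1) ge0_ler_powR ?nnegrE ?invr_ge0 ?(ltW a20) ?(ltW D1)//.
  by rewrite invf_le1// lerDr mulr_ge0.
have tE : t `^ (2 - alpha) = (2 * D + 1)^-1.
  by rewrite -powRrM mulVf ?gt_eqF// powRr1// invr_ge0 ltW.
have ta0 : 0 < t `^ alpha by rewrite powR_gt0.
have ta1 : t `^ alpha <= 1.
  by rewrite [leRHS](pow1 alpha) ge0_ler_powR ?nnegrE ?(ltW alpha_gt0) ?(ltW t0).
have t2 : t ^+ 2 = t `^ alpha * t `^ (2 - alpha).
  rewrite -powRD; last by rewrite (gt_eqF t0) implybT.
  by rewrite (_ : alpha + _ = 2%:R) ?powR_mulrn ?(ltW t0)//; ring.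
have := bound t t0; set y := kappa * _.
have y0 : 0 < y by rewrite mulr_gt0.
have : expR (- y) * (1 + y) <= 1.
  by rewrite -[leRHS](expRxMexpNx_1 y) mulrC ler_pM2r ?expR_gt0// expR_ge1Dx.
have yk : y <= kappa by rewrite -[leRHS]mulr1 ler_pM2l.
move=> h1 h2.
(* The inequality exp(y) >= 1 + y gives y <= (1 + y)(1 - exp(-y)), and t <= 1 gives y <= kappa. *)
have h3 : y <= (1 + kappa) * (t ^+ 2 * r ^+ 2 / 2).
  apply: (@le_trans _ _ ((1 + y) * (1 - expR (- y)))); first nra.
  apply: ler_pM => //; first lra.
    by rewrite subr_ge0 -expR0 ler_expR lerNl oppr0 ltW.
  lra.
have : 1 <= D * (2 * D + 1)^-1.
  rewrite -tE -(ler_pM2l ta0) mulr1 mulrCA -t2.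
  rewrite -(ler_pM2l kappa0) -/y (le_trans h3)//.
  rewrite le_eqVlt; apply/orP; left; apply/eqP; rewrite /D; field.
  by rewrite gt_eqF.
by rewrite ler_pdivlMr// mul1r; lra.
Qed.

Context {E : completeNormedModType R[i]}.
Hypothesis sepE : separable E.

Lemma borel_ball dT (S : measurableType dT) (f : S -> E) (x : E) (r : R) :
  measurable_fun [set: S] (f : S -> borel E) ->
  measurable [set w | rnorm (f w - x) < r].
Proof.
move=> mf; rewrite (_ : [set _ | _] = f @^-1` [set y | rnorm (y - x) < r])//.
by apply: borel_preimage => //; apply: borel_open; exact: open_rnorm_ball.
Qed.

(* Rotations and the stability relation k X_1 + k' X_2 ~ 2^(1/alpha) X for
   |k| = |k'| = 1 show that the support of X_n contains a disc whose radius is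
   a fixed multiple of the modulus of any of its points. *)
Lemma coord_near n (e : E) (c : R[i]) (r : R) : J n -> 0 < r ->
  (0 < P [set w | (rnorm (X n w *: e - c *: e) < r)%R])%E.
Proof.
move=> Jn r0.
have mXe (a : R[i]) : measurable_fun [set: Omega] (fun w => (a * X n w) *: e : borel E).
  apply: (borel_measurable_cscale sepE).
  exact: (complex_measurable_coordM J M (fun=> a)).
have mXe1 : measurable_fun [set: Omega] (fun w => X n w *: e : borel E).
  by have := mXe 1; under eq_fun do rewrite mul1r.
pose Q : R := 2 `^ alpha^-1.
have Q0 : 0 < Q by rewrite powR_gt0.
have Qa : Q `^ alpha = 2 by rewrite -powRrM mulVf ?gt_eqF// powRr1.
(* Each of the two copies contributes an error below 2h, and their sum is compared with Q X_n, which
   allows an error of Q r. *)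
pose h := Q * r / 4.
have h0 : 0 < h by rewrite !divr_gt0 ?mulr_gt0.
have [q qE] := dense_seq sepE.
(* A value s of modulus above Q |c| puts Q c/(2s) in the unit disc, so that Q c = (k + k') s for two
   rotations k and k'. *)
pose K := Q * complex.Re `|c|.
(* One ball around a dense sequence is charged together with the large values; the value s at any
   sample point there has a charged neighbourhood of radius 2h. *)
pose B i := coord_gt n 1 K `&` [set w | rnorm (X n w *: e - q i) < h].
have mB i : measurable (B i).
  by apply: measurableI; [exact: measurable_coord_gt|exact: borel_ball mXe1].
have [i Bi] : exists i, (0 < P (B i))%E.
  apply: measure_bigcup_gt0 => //.
  apply: lt_le_trans (coord_unbounded K Jn) _; apply: le_measure; rewrite ?inE.
  - exact: measurable_coord_gt.
  - exact: bigcupT_measurable.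
  - by move=> w Kw; have [i iw] := qE (X n w *: e) h h0; exists i.
have [w0 [Kw0 /= iw0]] : B i !=set0.
  by apply/set0P/eqP => B0; move: Bi; rewrite B0 measure0 ltxx.
set s := X n w0 in Kw0 iw0.
have Ks : K < complex.Re `|s|.
  apply: lt_le_trans Kw0 _; apply: le_trans (ler_norm _) _.
  by apply: le_trans (dot_le _ _) _; rewrite /= normr1 normr0 addr0 mul1r.
have s0 : s != 0.
  by rewrite -Re_normc_eq0 gt_eqF// (le_lt_trans _ Ks)// mulr_ge0 ?Re_normc_ge0 ?ltW.
have sn0 : 0 < complex.Re `|s| by rewrite lt_def Re_normc_ge0 Re_normc_eq0 s0.
pose A := [set w | rnorm (X n w *: e - s *: e) < 2 * h].
have mA : measurable A by exact: borel_ball mXe1.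
have A0 : (0 < P A)%E.
  apply: lt_le_trans Bi _; apply: le_measure; rewrite ?inE// => w [_ /= iw].
  rewrite /A/= (le_lt_trans (ler_rnorm_dist (q i) _ _))//.
  rewrite (rnorm_distC (q i)); rewrite /h in iw iw0 *; lra.
have [k [k' [k1 k'1 kE]]] : exists k k' : R[i], [/\ complex.Re `|k| = 1,
    complex.Re `|k'| = 1 & (k + k') * s = Q%:C%C * c].
  have [|k [k' [k1 k'1 kE]]] := @half_sum_unit R (Q%:C%C * c / (2%:C%C * s)).
    have -> : Q%:C%C * c / (2%:C%C * s) = ((Q / 2)%:C%C * c) / s.
      by rewrite rmorphM fmorphV invfM; ring.
    rewrite Re_normcM normfV; have -> : complex.Re `|s|^-1 = (complex.Re `|s|)^-1.
      by rewrite -{1}(@RRe_real _ `|s|) ?normr_real// -fmorphV.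
    rewrite ler_pdivrMr// mul1r Re_normcM Re_norm_real gtr0_norm ?divr_gt0//.
    rewrite (le_trans _ (ltW Ks))// /K ler_wpM2r ?Re_normc_ge0//.
    by rewrite ler_pdivrMr// ler_peMr ?(ltW Q0)// ler1n.
  exists k, k'; split => //.
  have two0 : (2%:C%C : R[i]) != 0 by rewrite eq_complex/= pnatr_eq0.
  have -> : k + k' = 2%:C%C * (2^-1%:C%C * (k + k')).
    by rewrite mulrA fmorphV divff// mul1r.
  by rewrite -kE; field.
pose a1 : int -> R[i] := fun=> k; pose a2 : int -> R[i] := fun=> k'.
pose a3 : int -> R[i] := fun=> Q%:C%C.
have aE m : J m -> complex.Re `|a1 m| `^ alpha + complex.Re `|a2 m| `^ alpha =
    complex.Re `|a3 m| `^ alpha.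
  by move=> _; rewrite /a3 Re_norm_real (gtr0_norm Q0) Qa k1 k'1 powR1.
have mV : measurable_fun [set: Omega * Omega]
    (fun w => (k * X n w.1 + k' * X n w.2) *: e : borel E).
  apply: (borel_measurable_cscale sepE).
  exact: (complex_measurable_coord_add J M a1 a2).
have law := @coord_series_law_add _ _ alpha_gt0 _ _ P J M isoM E sepE
  (fun=> [:: n]) (fun=> e) a1 a2 a3 _ _ aE mV (mXe Q%:C%C).
have {}law : eq_law (product_probability P P)
    ((fun w => (k * X n w.1 + k' * X n w.2) *: e) : _ -> borel E)
    P ((fun w => (Q%:C%C * X n w) *: e) : _ -> borel E).
  apply: law; apply: aeW => w; under eq_fun do rewrite big_seq1; exact: cvg_cst.
pose U := [set y : E | rnorm (y - (Q%:C%C * c) *: e) < Q * r].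
have := law U; rewrite /preimage => /(_ _)/wrap[].
  by apply: borel_open; exact: open_rnorm_ball.
have -> : [set w | U ((Q%:C%C * X n w) *: e)] = [set w | rnorm (X n w *: e - c *: e) < r].
  apply/seteqP; split=> w; rewrite /U/= -!scalerA -scalerBr rnormZ Re_norm_real (gtr0_norm Q0) ltr_pM2l//.
move=> <-; apply: (@lt_le_trans _ _ (P A * P A)%E); first exact: mule_gt0.
rewrite -product_probabilityE//; apply: le_measure; rewrite ?inE.
- exact: measurableX.
- by apply: borel_ball mV.
move=> w [/= A1 A2]; rewrite /U/= -kE.
have -> : (k * X n w.1 + k' * X n w.2) *: e - ((k + k') * s) *: e =
    k *: (X n w.1 *: e - s *: e) + k' *: (X n w.2 *: e - s *: e).
  by rewrite !scalerBr !scalerA [RHS]addrACA -opprD -[in RHS]scalerDl -[in RHS]scalerDl -[in RHS]mulrDl.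
apply: le_lt_trans (ler_rnormD _ _) _; rewrite !rnormZ k1 k'1 !mul1r.
by rewrite /A/= /h in A1 A2; lra.
Qed.

End positive_probability.

(** * Contraction and support of the sums *)

Section random_series.
Context {R : realType} (alpha : R).
Hypothesis alpha_gt0 : 0 < alpha.
Context d {Omega : measurableType d} (P : probability Omega R).
Variables (J : set int) (M : set int -> {RV P >-> borel R[i]^o}).
Hypothesis isoM :
  isotropic_stable_random_measure alpha [set A | A `<=` J] (@counting int R) M.
Context {E : completeNormedModType R[i]}.
Hypothesis sepE : separable E.

Local Notation X := (coord J M).

(** [Negz i] stands for -(i + 1), so k negative terms match the k + 1 terms from 0 to k. *)
Definition ball_seq (k : nat) : seq int :=
  [seq n <- map Posz (iota 0 k.+1) ++ map Negz (iota 0 k) | n \in J].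

Lemma mem_ball_seq k n : (n \in ball_seq k) = (n \in J) && (`|n| <= k)%N.
Proof.
rewrite mem_filter mem_cat; congr (_ && _); case: n => m.
  rewrite mem_map; last by move=> i j [].
  rewrite mem_iota add0n ltnS /=; case: (m <= k)%N => //=.
  by apply/negP => /mapP[].
rewrite [X in _ || X]mem_map; last by move=> i j [].
rewrite mem_iota add0n /=; have -> : Negz m \in [seq Posz i | i <- iota 0 k.+1] = false.
  by apply/negP => /mapP[].
by [].
Qed.

Lemma ball_seq_uniq k : uniq (ball_seq k).
Proof.
rewrite filter_uniq// cat_uniq !map_inj_uniq ?iota_uniq//=; last 2 first.
- by move=> i j [].
- by move=> i j [].
by rewrite andbT; apply/hasPn => _ /mapP[i _ ->]; apply/negP => /mapP[].
Qed.

Lemma ball_seqE k : [set` ball_seq k] = balls J k.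
Proof.
apply/seteqP; split=> n /=; rewrite mem_ball_seq.
  by move=> /andP[/set_mem Jn nk].
by move=> [Jn nk]; rewrite mem_set.
Qed.

Definition converges (u : int -> E) (v : Omega -> E) :=
  {ae P, forall w, \sum_(n <- ball_seq k) X n w *: u n @[k --> \oo] --> v w}.

Lemma converges_balls u v : converges u v <->
  {ae P, forall w, \sum_(n \in balls J k) X n w *: u n @[k --> \oo] --> v w}.
Proof.
by split; apply: filterS => w H; apply: cvg_trans H; apply: near_eq_cvg;
  apply: nearW => k; rewrite (fsum_seq _ (ball_seq_uniq k) (ball_seqE k)).
Qed.

Lemma convergesD u v u' v' : converges u v -> converges u' v' ->
  converges (fun n => u n + u' n) (fun w => v w + v' w).
Proof.
apply: filterS2 => w H H'.
under eq_fun do (under eq_bigr do rewrite scalerDr; rewrite big_split/=).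
exact: cvgD.
Qed.

Lemma convergesZ c u v : converges u v ->
  converges (fun n => c *: u n) (fun w => c *: v w).
Proof.
apply: filterS => w H.
rewrite (_ : (fun _ => _) = fun k => c *: \sum_(n <- ball_seq k) X n w *: u n).
  exact: (cvgZ (cvg_cst _) H).
by apply/funext => k; rewrite scaler_sumr; apply: eq_bigr => n _; rewrite !scalerA mulrC.
Qed.

Lemma converges_unique u v v' : converges u v -> converges u v' ->
  {ae P, forall w, v w = v' w}.
Proof. by apply: filterS2 => w; exact: cvg_unique. Qed.

Lemma converges_law (a b : int -> R[i]) u v1 v2 :
  (forall n, J n -> complex.Re `|a n| = complex.Re `|b n|) ->
  measurable_fun [set: Omega] (v1 : Omega -> borel E) ->
  measurable_fun [set: Omega] (v2 : Omega -> borel E) ->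
  converges (fun n => a n *: u n) v1 -> converges (fun n => b n *: u n) v2 ->
  eq_law P (v1 : Omega -> borel E) P (v2 : Omega -> borel E).
Proof.
move=> ab mv1 mv2 cv1 cv2.
apply: (coord_series_law alpha_gt0 isoM sepE (s := ball_seq) (u := u) ab mv1 mv2).
  by apply: filterS cv1 => w; under eq_fun do
    under eq_bigr do rewrite scalerA mulrC.
by apply: filterS cv2 => w; under eq_fun do
  under eq_bigr do rewrite scalerA mulrC.
Qed.

Lemma converges_head u K : converges (fun n => if n \in ball_seq K then u n else 0)
  (fun w => \sum_(n <- ball_seq K) X n w *: u n).
Proof.
apply: aeW => w; apply: cvg_near_cst; exists K => // k /= Kk.
under eq_bigr do rewrite (fun_if (GRing.scale _)) scaler0.
rewrite -big_mkcond/= -[LHS]big_filter; apply: perm_big; apply: uniq_perm.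
- by rewrite filter_uniq// ball_seq_uniq.
- exact: ball_seq_uniq.
move=> n; rewrite mem_filter !mem_ball_seq; case: (n \in J) => //=.
by case: (leqP `|n| K) => //= nK; rewrite (leq_trans nK).
Qed.

Lemma converges_tail u v K : converges u v ->
  converges (fun n => if n \in ball_seq K then 0 else u n)
    (fun w => v w - \sum_(n <- ball_seq K) X n w *: u n).
Proof.
move=> uv; have := convergesD uv (convergesZ (-1) (converges_head u K)).
rewrite (_ : (fun n => u n + _) = fun n => if n \in ball_seq K then 0 else u n).
  move=> H; apply: filterS H => w.
  by rewrite scaleN1r.
by apply/funext => n; case: ifP => _; rewrite scaleN1r ?subrr// oppr0 addr0.
Qed.

(** Dominated convergence for the indicators of the deviations, cut off on the null set so that they
    tend to 0 everywhere. *)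
Lemma ae_cvg_probability (Y : nat -> Omega -> E) (eps : R) :
  (forall k, measurable_fun [set: Omega] (Y k : Omega -> borel E)) ->
  {ae P, forall w, Y k w @[k --> \oo] --> (0 : E)} -> 0 < eps ->
  P [set w | eps <= rnorm (Y k w)] @[k --> \oo] --> 0%E.
Proof.
move=> mY [N [mN N0 NY]] e0.
pose A k := [set w | eps <= rnorm (Y k w)].
have mA k : measurable (A k).
  rewrite (_ : A k = (fun w => rnorm (Y k w)) @^-1` `[eps, +oo[).
    by rewrite -[X in measurable X]setTI; apply: measurable_rnorm.
  by apply/seteqP; split=> w /=; rewrite in_itv/= andbT.
pose f k w : R := \1_(A k `\` N) w.
have mAN k : measurable (A k `\` N) by exact: measurableD.
have : \int[P]_w f k w @[k --> \oo] --> \int[P]_w (0 : R).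
  apply: (bounded_cvg_Rintegral (C := 1)).
  - by move=> k; exact: measurable_indic.
  - by move=> k w; rewrite /f indicE ger0_norm// lern1 leq_b1.
  - move=> w; apply: cvg_near_cst.
    have [Nw|nNw] := pselect (N w).
      by apply: nearW => k; rewrite /f indicE memNset// => -[].
    have Yw : Y k w @[k --> \oo] --> (0 : E) by apply: contrapT => h; apply: nNw; exact: NY.
    have /cvg_rnormP/(_ _ e0) := Yw; apply: filterS => k.
    by rewrite subr0 ltNge => /negP h; rewrite /f indicE memNset// => -[].
  - exact: bounded_measurable_cst.
rewrite Rintegral_probability_cst => H.
have PE k : P (A k) = (\int[P]_w f k w)%:E.
  rewrite Rintegral_indic//; apply: ae_measure_eq => //.
  by exists N; split => // w /= h; apply: contrapT => nNw; apply: h; split => [?|[]//]; split.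
by under eq_fun do rewrite -/(A _) PE; apply: cvg_EFin => //; exact: nearW.
Qed.

End random_series.

Lemma probability_cvg0P d (T : measurableType d) (R : realType)
    (P : probability T R) (A : nat -> set T) :
  P (A n) @[n --> \oo] --> 0%E <->
  forall e : R, 0 < e -> \forall n \near \oo, (P (A n) < e%:E)%E.
Proof.
split=> [f_0 e e0|H].
  have : nbhs (0%E : \bar R) [set x | (x < e%:E)%E].
    by apply: open_nbhs_nbhs; split; [exact: open_ereal_lt_ereal|rewrite /= lte_fin].
  by move=> /f_0.
have fin n e : (P (A n) < e%:E)%E -> P (A n) \is a fin_num.
  by move=> h; rewrite ge0_fin_numE ?measure_ge0// (lt_trans h)// ltry.
apply/fine_cvgP; split; first by apply: filterS (H 1 ltr01) => n /fin.
apply/cvgr0Pnorm_lt => e e0; apply: filterS (H e e0) => n fn /=.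
by rewrite ger0_norm ?fine_ge0// -lte_fin fineK// (fin _ _ fn).
Qed.

Lemma measurable_rnorm_ge (R : realType) (E : completeNormedModType R[i]) d
    (T : measurableType d) (f : T -> E) (eps : R) :
  measurable_fun [set: T] (f : T -> borel E) ->
  measurable [set w | eps <= rnorm (f w)].
Proof.
move=> mf; rewrite (_ : [set _ | _] = (fun w => rnorm (f w)) @^-1` `[eps, +oo[).
  by rewrite -[X in measurable X]setTI; apply: measurable_rnorm.
by apply/seteqP; split=> w /=; rewrite in_itv/= andbT.
Qed.

(** * Contraction principle and positive probability of balls *)

Section summable_series.
Context {R : realType} (alpha : R).
Hypothesis alpha_gt0 : 0 < alpha.
Context d {Omega : measurableType d} (P : probability Omega R).
Variables (J : set int) (M : set int -> {RV P >-> borel R[i]^o}).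
Hypothesis isoM :
  isotropic_stable_random_measure alpha [set A | A `<=` J] (@counting int R) M.
Context {E : completeNormedModType R[i]}.
Hypothesis sepE : separable E.
Hypothesis typeE : stable_type E alpha.

Local Notation X := (coord J M).
Local Notation converges := (converges J M).
Local Notation ball_seq := (ball_seq J).

Definition summable (u : int -> E) : Prop :=
  (\esum_(n in J) ((rnorm (u n)) `^ alpha)%:E < +oo)%E.

Lemma summableZ (b : int -> R[i]) u : (forall n, J n -> complex.Re `|b n| <= 1) ->
  summable u -> summable (fun n => b n *: u n).
Proof.
move=> b1; apply: le_lt_trans; apply: le_esum => n Jn.
rewrite lee_fin ge0_ler_powR ?nnegrE ?rnorm_ge0 ?(ltW alpha_gt0)//.
by rewrite rnormZ ler_piMl ?rnorm_ge0// b1.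
Qed.

Lemma summable_converges u : summable u ->
  exists2 v : Omega -> E, measurable_fun [set: Omega] (v : Omega -> borel E) & converges u v.
Proof.
move=> su; have [v vP] := exists_sum alpha_gt0 isoM sepE typeE su.
exists v; first exact: measurable_funP.
exact/converges_balls.
Qed.

Lemma measurable_tail (u : int -> E) v K : measurable_fun [set: Omega] (v : Omega -> borel E) ->
  measurable_fun [set: Omega]
    (fun w => v w - \sum_(n <- ball_seq K) X n w *: u n : borel E).
Proof.
move=> mv; apply: (borel_measurableD sepE mv).
under eq_fun do rewrite -sumrN.
apply: (borel_measurable_sum sepE) => n.
under eq_fun do rewrite -scalerN.
by apply: (borel_measurable_cscale sepE); exact: complex_measurable_coord.
Qed.

Lemma tail_probability u v eps : measurable_fun [set: Omega] (v : Omega -> borel E) ->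
  converges u v -> 0 < eps ->
  P [set w | eps <= rnorm (v w - \sum_(n <- ball_seq k) X n w *: u n)] @[k --> \oo] --> 0%E.
Proof.
move=> mv uv; apply: ae_cvg_probability => //.
  by move=> k; exact: measurable_tail.
apply: filterS uv => w H; rewrite -[X in _ --> X](subrr (v w)).
exact: cvgB (cvg_cst _) H.
Qed.

(* A point of the closed unit disc is the mean of two points of the circle. *)
Lemma contraction (b : int -> R[i]) u v vb eps :
  (forall n, complex.Re `|b n| <= 1) -> summable u ->
  measurable_fun [set: Omega] (v : Omega -> borel E) ->
  measurable_fun [set: Omega] (vb : Omega -> borel E) ->
  converges u v -> converges (fun n => b n *: u n) vb ->
  (P [set w | (eps <= rnorm (vb w))%R] <=
   P [set w | (eps <= rnorm (v w))%R] + P [set w | (eps <= rnorm (v w))%R])%E.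
Proof.
move=> b1 su mv mvb cv cvb.
have /choice[k0 kP] n : exists k : R[i] * R[i], [/\ complex.Re `|k.1| = 1,
    complex.Re `|k.2| = 1 & b n = 2^-1%:C%C * (k.1 + k.2)].
  by have [k [k' ?]] := half_sum_unit (b1 n); exists (k, k').
have half (k : int -> R[i]) : (forall n, complex.Re `|k n| = 1) ->
    exists v', [/\ measurable_fun [set: Omega] (v' : Omega -> borel E),
      converges (fun n => k n *: u n) v' &
      P [set w | eps <= rnorm (v' w)] = P [set w | eps <= rnorm (v w)]].
  move=> k1; have [|v' mv' cv'] := @summable_converges (fun n => k n *: u n).
    by apply: summableZ => // n _; rewrite k1.
  exists v'; split => //.
  have law : eq_law P (v' : Omega -> borel E) P (v : Omega -> borel E).
    apply: (@converges_law _ _ alpha_gt0 _ _ _ _ _ isoM _ sepE k (fun=> 1) u) => //.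
      by move=> n _; rewrite k1 normr1.
    by under eq_fun do rewrite scale1r.
  apply: (law [set y : E | eps <= rnorm y]).
  exact: (@measurable_rnorm_ge _ _ _ (borel E) id).
have [v1 [mv1 cv1 P1]] := half (fun n => (k0 n).1) (fun n => let: And3 h _ _ := kP n in h).
have [v2 [mv2 cv2 P2]] := half (fun n => (k0 n).2) (fun n => let: And3 _ h _ := kP n in h).
have vE : {ae P, forall w, vb w = 2^-1%:C%C *: (v1 w + v2 w)}.
  apply: (converges_unique cvb).
  rewrite (_ : (fun n => b n *: u n) = fun n => 2^-1%:C%C *: ((k0 n).1 *: u n + (k0 n).2 *: u n)).
    by apply: convergesZ; exact: convergesD.
  by apply/funext => n; rewrite -scalerDl scalerA; case: (kP n) => _ _ ->.
have mA f : measurable_fun [set: Omega] (f : Omega -> borel E) ->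
    measurable [set w | eps <= rnorm (f w)].
  exact: measurable_rnorm_ge.
have mA12 := measurableU _ _ (mA _ mv1) (mA _ mv2).
apply: (@le_trans _ _ (P ([set w | eps <= rnorm (v1 w)] `|` [set w | eps <= rnorm (v2 w)]))).
  have := ae_measure_eq (P := P) (measurableI _ _ (mA _ mvb) mA12) (mA _ mvb).
  move=> /(_ _)/wrap[].
    apply: filterS vE => w vE; split => [[]//|/= h]; split => //.
    apply: contrapT => /not_orP[/= /negP h1 /negP h2]; move: h; rewrite vE rnormZ Re_norm_real.
    rewrite -!ltNge in h1 h2; have := ler_rnormD (v1 w) (v2 w).
    by rewrite ger0_norm//; lra.
  move=> <-; apply: le_measure; rewrite ?inE//; first exact: measurableI (mA _ mvb) mA12.
rewrite -{1}P1 -P2; apply: measureU2; exact: mA.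
Qed.

(* Dominated convergence in probability: all but finitely many terms are
   controlled, uniformly in N, by the contraction principle. *)
Lemma vanishing_coefficients (b : nat -> int -> R[i]) u (V : nat -> Omega -> E) eps :
  (forall N n, complex.Re `|b N n| <= 1) ->
  (forall n, J n -> complex.Re `|b N n| @[N --> \oo] --> (0 : R)) -> summable u ->
  (forall N, measurable_fun [set: Omega] (V N : Omega -> borel E)) ->
  (forall N, converges (fun n => b N n *: u n) (V N)) -> 0 < eps ->
  P [set w | eps <= rnorm (V N w)] @[N --> \oo] --> 0%E.
Proof.
move=> b1 b0 su mV cV e0.
have [v mv cv] := summable_converges su.
have e20 : 0 < eps / 2 by rewrite divr_gt0.
apply/probability_cvg0P => delta delta0.
(* One third serves the finite head, two thirds the tail, which contraction bounds by twice the
   deviation probability of the tail of v. *)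
have d30 : 0 < delta / 3 by rewrite divr_gt0.
have /probability_cvg0P/(_ _ d30) := tail_probability mv cv e20.
move=> [K _ /(_ K (leqnn K)) tailK].
have hV N : converges (fun n => b N n *: if n \in ball_seq K then 0 else u n)
    (fun w => V N w - \sum_(n <- ball_seq K) X n w *: (b N n *: u n)).
  have := converges_tail K (cV N).
  by congr (converges _ _); apply/funext => n; case: ifP => //; rewrite scaler0.
have su' : summable (fun n => if n \in ball_seq K then 0 else u n).
  have := @summableZ (fun n => (n \notin ball_seq K)%:R) u _ su.
  rewrite (_ : (fun n => _ *: u n) = fun n => if n \in ball_seq K then 0 else u n).
    by apply=> n _; case: (_ \in _); rewrite ?normr1 ?normr0.
  by apply/funext => n; case: (_ \in _); rewrite ?scale0r ?scale1r.
have mT N := measurable_tail (fun n => b N n *: u n) K (mV N).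
have hT N := contraction (eps / 2) (b1 N) su' (measurable_tail u K mv) (mT N)
  (converges_tail K cv) (hV N).
pose S N w := \sum_(n <- ball_seq K) X n w *: (b N n *: u n).
have mS N : measurable_fun [set: Omega] (S N : Omega -> borel E).
  exact: measurable_partial_sum.
have : {ae P, forall w, S N w @[N --> \oo] --> (0 : E)}.
  apply: aeW => w.
  have : forall s : seq int, (forall n, n \in s -> J n) ->
    \sum_(n <- s) X n w *: (b N n *: u n) @[N --> \oo] --> (0 : E).
    elim=> [_|n s IH sJ]; first by under eq_fun do rewrite big_nil; exact: cvg_cst.
    under eq_fun do rewrite big_cons.
    have /IH IHs : forall m, m \in s -> J m by move=> m ms; apply: sJ; rewrite inE ms orbT.
    suff bn0 : X n w *: (b N n *: u n) @[N --> \oo] --> (0 : E).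
      by have H := cvgD bn0 IHs; rewrite addr0 in H; exact: H.
    apply/cvg_rnormP => e e0'; have /b0 bn : J n by apply: sJ; rewrite mem_head.
    pose C := complex.Re `|X n w| * rnorm (u n) + 1.
    have C0 : 0 < C by rewrite ltr_wpDl// mulr_ge0 ?Re_normc_ge0 ?rnorm_ge0.
    have /cvgr0Pnorm_lt/(_ (e / C)) := bn; rewrite divr_gt0// => /(_ isT).
    apply: filterS => N; rewrite ger0_norm ?Re_normc_ge0// subr0 !rnormZ => bN.
    rewrite mulrCA (le_lt_trans (y := complex.Re `|b N n| * C))//.
      by rewrite ler_wpM2l ?Re_normc_ge0// lerDl.
    by rewrite -ltr_pdivlMr.
  by apply=> n; rewrite mem_ball_seq => /andP[/set_mem].
move=> /(ae_cvg_probability mS)/(_ e20)/probability_cvg0P.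
move=> /(_ _ d30); apply: filterS => N SN.
apply: (@le_lt_trans _ _ (P ([set w | eps / 2 <= rnorm (S N w)] `|`
    [set w | eps / 2 <= rnorm (V N w - S N w)]))).
  apply: le_measure; rewrite ?inE.
  - exact: measurable_rnorm_ge.
  - by apply: measurableU; apply: measurable_rnorm_ge => //; exact: mT.
  - move=> w /= h; apply/orP; rewrite -[_ || _]negbK negb_or -!ltNge.
    apply/negP => /andP[h1 h2]; have := ler_rnormD (S N w) (V N w - S N w).
    by rewrite addrC subrK; lra.
apply: le_lt_trans (measureU2 _ _ _) _.
- exact: measurable_rnorm_ge.
- by apply: measurable_rnorm_ge => //; exact: mT.
have -> : delta = delta / 3 + (delta / 3 + delta / 3) by field.
rewrite EFinD; apply: lteD => //.
by apply: le_lt_trans (hT N) _; rewrite EFinD; apply: lteD.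
Qed.

Hypothesis alpha_le2 : alpha <= 2.

Lemma finite_sum_near (c : int -> R[i]) (u : int -> E) K r : 0 < r ->
  (0 < P [set w | (rnorm (\sum_(n <- ball_seq K) X n w *: u n -
                          \sum_(n <- ball_seq K) c n *: u n) < r)%R])%E.
Proof.
move=> r0; set s := ball_seq K.
have sJ n : n \in s -> J n by rewrite mem_ball_seq => /andP[/set_mem].
(* One more than the number of terms keeps the division valid for an empty list and the total error
   strictly below r. *)
pose e := r / ((size s).+1)%:R.
have e0 : 0 < e by rewrite divr_gt0.
pose B n : set (borel R[i]^o) := [set z | rnorm ((z : R[i]) *: u n - c n *: u n) < e].
have mB n : measurable (B n).
  apply: (borel_ball (S := borel R[i]^o) (f := fun z => (z : R[i]) *: u n)).
  exact: (borel_measurable_cscale sepE _ (@complex_measurable_borel R)).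
have XB n : n \in s -> M [set n] @^-1` B n = [set w | rnorm (X n w *: u n - c n *: u n) < e].
  by move=> /sJ Jn; rewrite /B /coord mem_set.
apply: (@lt_le_trans _ _ (P (\bigcap_(n in [set` s]) (M [set n] @^-1` B n)))).
  rewrite (coord_indep isoM (ball_seq_uniq J K) sJ mB).
  rewrite big_seq; apply: (big_ind (fun x => 0 < x)%E) => [|x y|n ns]; first exact: lte01.
    exact: mule_gt0.
  rewrite XB//.
  by apply: (coord_near alpha_gt0 alpha_le2 isoM sepE) => //; exact: sJ.
apply: le_measure; rewrite ?inE.
- apply: fin_bigcap_measurable; first exact: finite_seq.
  by move=> n _; rewrite -[X in measurable X]setTI; exact: measurable_funP.
- apply: borel_ball; exact: measurable_partial_sum.
move=> w /= H; rewrite -sumrB.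
apply: le_lt_trans (rnorm_sum _ _ _) _.
apply: (@le_lt_trans _ _ (\sum_(n <- s) e)).
  rewrite big_seq [leRHS]big_seq; apply: ler_sum => n ns; apply: ltW.
  by have := H n ns; rewrite -[_ w]/((M [set n] @^-1` B n) w) XB.
rewrite big_const_seq count_predT iter_addr_0 -mulr_natl /e mulrCA gtr_pMr//.
by rewrite ltr_pdivrMr// mul1r ltr_nat.
Qed.

(** Redrawing the head up to k from an independent copy preserves the law of v, because coefficients
    0 and 1 satisfy |a|^alpha + |b|^alpha = 1. Head and tail then live on different factors, and the
    probabilities that the one is near its target and the other is small multiply. *)
Lemma sum_near (c : int -> R[i]) (u : int -> E) v K r :
  measurable_fun [set: Omega] (v : Omega -> borel E) -> converges u v -> 0 < r ->
  (0 < P [set w | (rnorm (v w - \sum_(n <- ball_seq K) c n *: u n) < r)%R])%E.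
Proof.
move=> mv cv r0; have r20 : 0 < r / 2 by rewrite divr_gt0.
pose S k w := \sum_(n <- ball_seq k) X n w *: u n.
have [k [Kk tail_k]] : exists k, (K <= k)%N /\ (0 < P [set w | (rnorm (v w - S k w) < r / 2)%R])%E.
  have /probability_cvg0P/(_ _ (ltr01)) [N _ NP] := tail_probability mv cv r20.
  exists (maxn K N); split; first exact: leq_maxl.
  set A := [set w | _]; have mA : measurable A.
    rewrite (_ : A = [set w | rnorm ((v w - S (maxn K N) w) - 0) < r / 2]).
      by apply: borel_ball; exact: measurable_tail.
    by apply/seteqP; split=> w /=; rewrite subr0.
  have := NP _ (leq_maxr K N).
  rewrite (_ : [set w | _] = ~` A); last by apply/seteqP; split=> w /=; rewrite leNgt => /negP.
  rewrite probability_setC// [(0 < _)%E]lt0e measure_ge0 andbT; apply: contraTN => /eqP ->.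
  by rewrite sube0 ltxx.
(* The head now runs up to k >= K; extending c by 0 keeps the target sum. *)
pose cK n := if n \in ball_seq K then c n else 0.
have cKE : \sum_(n <- ball_seq k) cK n *: u n = \sum_(n <- ball_seq K) c n *: u n.
  rewrite (eq_bigr (fun n => if n \in ball_seq K then c n *: u n else 0)); last first.
    by move=> n _; rewrite /cK; case: ifP; rewrite ?scale0r.
  rewrite -big_mkcond/= -[LHS]big_filter; apply: perm_big; apply: uniq_perm.
  - by rewrite filter_uniq// ball_seq_uniq.
  - exact: ball_seq_uniq.
  move=> n; rewrite mem_filter !mem_ball_seq; case: (n \in J) => //=.
  by case: (leqP `|n| K) => //= nK; rewrite (leq_trans nK).
pose a (n : int) : R[i] := if n \in ball_seq k then 1 else 0.
pose b (n : int) : R[i] := if n \in ball_seq k then 0 else 1.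
pose V (w : Omega * Omega) := S k w.1 + (v w.2 - S k w.2).
have mSk : measurable_fun [set: Omega] (S k : Omega -> borel E) by exact: measurable_partial_sum.
have mTk := measurable_tail u k mv.
have mV : measurable_fun [set: Omega * Omega] (V : Omega * Omega -> borel E).
  apply: (borel_measurableD sepE).
    exact: (measurableT_comp mSk measurable_fst).
  exact: (measurableT_comp mTk measurable_snd).
have law : eq_law (product_probability P P) (V : _ -> borel E) P (v : Omega -> borel E).
  apply: (@coord_series_law_add _ _ alpha_gt0 _ _ P J M isoM E sepE ball_seq u a b (fun=> 1)
    V v _ mV mv _ _).
  - have a0 : alpha != 0 by rewrite gt_eqF.
    move=> n _; rewrite /a /b; case: (n \in _);
      by rewrite normr1 normr0/= powR1 (powR0 a0) ?addr0 ?add0r.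
  - have h1 := ae_product_fst P (@converges_head R d Omega P J M E u k).
    have h2 := ae_product_snd P (converges_tail k cv).
    apply: filterS2 h1 h2 => w H1 H2; apply: cvg_trans (cvgD H1 H2).
    apply: near_eq_cvg; apply: nearW => N; rewrite fctE -big_split/=; apply: eq_bigr => n _.
    rewrite /a /b scalerDl; case: (n \in _); rewrite /= !(mul0r, mul1r, scale0r, scaler0)//.
  - by apply: filterS cv => w cw; under eq_fun do under eq_bigr do rewrite mul1r.
pose y := \sum_(n <- ball_seq K) c n *: u n.
have <- := law [set x : E | rnorm (x - y) < r] (borel_open (open_rnorm_ball _ _)).
pose A1 := [set w | rnorm (S k w - y) < r / 2].
pose A2 := [set w | rnorm (v w - S k w) < r / 2].
have mA1 : measurable A1 by exact: borel_ball.
have mA2 : measurable A2.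
  rewrite (_ : A2 = [set w | rnorm ((v w - S k w) - 0) < r / 2]); first exact: borel_ball.
  by apply/seteqP; split=> w /=; rewrite subr0.
apply: (@lt_le_trans _ _ (P A1 * P A2)%E).
  by apply: mule_gt0 => //; rewrite /A1 /y -cKE; exact: finite_sum_near.
rewrite -product_probabilityE//; apply: le_measure; rewrite ?inE.
- exact: measurableX.
- exact: (borel_preimage mV (borel_open (open_rnorm_ball _ _))).
move=> w [h1 h2] /=; rewrite /A1 /A2/= in h1 h2.
have := ler_rnormD (S k w.1 - y) (v w.2 - S k w.2).
by rewrite addrAC -/(V w); lra.
Qed.

End summable_series.

(** * Rotated ergodic means *)

(** Borel-Cantelli: at the index m j a deviation of 1/(j + 1) has probability at most 2^-(j + 1),
    and the exceptional set is the limsup of these events. *)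
Lemma cvg_subsequence (R : realType) (E : completeNormedModType R[i])
    d (T : measurableType d) (P : probability T R) (Y : nat -> T -> E) :
  (forall N, measurable_fun [set: T] (Y N : T -> borel E)) ->
  (forall eps, 0 < eps -> P [set w | eps <= rnorm (Y N w)] @[N --> \oo] --> 0%E) ->
  exists m : nat -> nat, {ae P, forall w, Y (m j) w @[j --> \oo] --> (0 : E)}.
Proof.
move=> mY Y0.
have /choice[m mP] j : exists m, (P [set w | (j.+1%:R^-1 <= rnorm (Y m w))%R] <= (1 / (2 ^ j.+1)%:R)%:E)%E.
  have j0 : 0 < j.+1%:R^-1 :> R by rewrite invr_gt0.
  have /probability_cvg0P := Y0 _ j0.
  have e0 : 0 < 1 / (2 ^ j.+1)%:R :> R by rewrite divr_gt0// ltr0n expn_gt0.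
  by move=> /(_ _ e0)[m _ /(_ m (leqnn m))/ltW]; exists m.
exists m; pose F j := [set w | j.+1%:R^-1 <= rnorm (Y (m j) w)].
have mF j : measurable (F j) by exact: measurable_rnorm_ge.
exists (lim_sup_set F); split.
- by apply: bigcapT_measurable => n; apply: bigcup_measurable => k _; exact: mF.
- apply: lim_sup_set_cvg0 => //.
  apply: le_lt_trans (_ : _ <= 1%:E)%E _; last exact: ltry.
  apply: le_trans (epsilon_trick0 xpredT ler01).
  by apply: lee_nneseries => // j _; exact: mP.
move=> w /= h; apply: contrapT => nF; apply: h; apply/cvg_rnormP => e e0.
have [q qe] := ltr_invS_exists e0.
have [n nw] : exists n, forall k, (n <= k)%N -> ~ F k w.
  apply: contrapT => /forallNP H; apply: nF => n _.
  by have /existsNP[k /not_implyP[nk /contrapT Fk]] := H n; exists k.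
exists (maxn n q) => // j /= nj; rewrite subr0.
have /negP := nw j (leq_trans (leq_maxl _ _) nj); rewrite -ltNge => /lt_trans; apply.
apply: le_lt_trans qe; rewrite lef_pV2 ?posrE// ler_nat ltnS.
exact: leq_trans (leq_maxr _ _) nj.
Qed.

Section cesaro.
Context {R : realType}.

Definition cesaro (z : R[i]) (N : nat) : R[i] := N.+1%:R^-1 * \sum_(k < N.+1) z ^+ k.

Lemma Re_norm_invn N : complex.Re `|N.+1%:R^-1 : R[i]| = N.+1%:R^-1.
Proof.
have := @Re_norm_real R N.+1%:R^-1; rewrite [RHS]ger0_norm ?invr_ge0// => <-.
by rewrite fmorphV rmorph_nat.
Qed.

Lemma cesaro_le1 z N : complex.Re `|z| = 1 -> complex.Re `|cesaro z N| <= 1.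
Proof.
move=> z1; rewrite /cesaro Re_normcM Re_norm_invn.
rewrite mulrC ler_pdivrMr// mul1r.
have := @rnorm_sum R R[i]^o _ (index_enum 'I_N.+1) xpredT (fun k => z ^+ k).
move=> /le_trans; apply.
rewrite (eq_bigr (fun=> 1)); first by rewrite sumr_const card_ord.
move=> k _; elim: (k : nat) => [|j IH]; first by rewrite expr0 /rnorm normr1.
by rewrite exprS /rnorm Re_normcM z1 mul1r.
Qed.

Lemma cesaro1 N : cesaro 1 N = 1.
Proof.
rewrite /cesaro; under eq_bigr do rewrite expr1n.
by rewrite sumr_const card_ord mulVf// pnatr_eq0.
Qed.

(** In the geometric sum the numerator z^(N + 1) - 1 has modulus at most 2. *)
Lemma cesaro_cvg z : complex.Re `|z| = 1 -> z != 1 ->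
  complex.Re `|cesaro z N| @[N --> \oo] --> (0 : R).
Proof.
move=> z1 zn1; have zn0 : 0 < complex.Re `|z - 1|.
  by rewrite lt_def Re_normc_ge0 Re_normc_eq0 subr_eq0 zn1.
apply: (@squeeze_cvgr _ _ _ _ (fun=> 0) (fun N => 2 / complex.Re `|z - 1| * N.+1%:R^-1)).
- apply: nearW => N; rewrite Re_normc_ge0 andTb.
  rewrite /cesaro Re_normcM Re_norm_invn.
  rewrite mulrC ler_pM2r ?invr_gt0// ler_pdivlMr// mulrC -Re_normcM -subrX1.
  have := @ler_rnormD R R[i]^o (z ^+ N.+1) (-1).
  move=> /le_trans; apply; rewrite rnormN /rnorm normr1 normrX.
  have -> : `|z| = 1 by have := @normE R R[i]^o z; rewrite /rnorm z1.
  by rewrite expr1n.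
- exact: cvg_cst.
- rewrite -[X in _ --> X](mulr0 (2 / complex.Re `|z - 1|)).
  by apply: cvgM; [exact: cvg_cst|exact: cvg_harmonic].
Qed.

End cesaro.

(** * Rotated means and an exactly invariant set *)

Section dynamics.
Context {R : realType} (alpha : R).
Hypothesis alpha_gt0 : 0 < alpha.
Hypothesis alpha_le2 : alpha <= 2.
Context d {Omega : measurableType d} (P : probability Omega R).
Variables (J : set int) (M : set int -> {RV P >-> borel R[i]^o}).
Hypothesis isoM :
  isotropic_stable_random_measure alpha [set A | A `<=` J] (@counting int R) M.
Context {E : completeNormedModType R[i]}.
Hypothesis sepE : separable E.
Hypothesis typeE : stable_type E alpha.
Variables (T : {linear E -> E}) (u : int -> E) (lambda : int -> R[i]).
Hypothesis contT : continuous T.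
Hypothesis su : summable alpha J u.
Hypothesis Tu : forall n, J n -> T (u n) = lambda n *: u n.
Hypothesis lambda1 : forall n, J n -> `|lambda n| = 1.

Local Notation X := (coord J M).
Local Notation converges := (converges J M).
Local Notation ball_seq := (ball_seq J).

Lemma eq_converges (u1 u2 : int -> E) v : (forall n, J n -> u1 n = u2 n) ->
  converges u1 v -> converges u2 v.
Proof.
move=> uE; apply: filterS => w; apply: cvg_trans; apply: near_eq_cvg.
apply: nearW => k; rewrite big_seq [RHS]big_seq; apply: eq_bigr => n.
by rewrite mem_ball_seq => /andP[/set_mem/uE ->].
Qed.

Lemma converges_T (a : int -> R[i]) v : converges (fun n => a n *: u n) v ->
  converges (fun n => (lambda n * a n) *: u n) (fun w => T (v w)).
Proof.
move=> cv; apply: (@eq_converges (fun n => T (a n *: u n))).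
  by move=> n Jn; rewrite linearZ/= Tu// scalerA mulrC.
apply: filterS cv => w cw.
have := cvg_comp _ _ cw (@contT (v w)); apply: cvg_trans; apply: near_eq_cvg.
apply: nearW => k /=; rewrite linear_sum; apply: eq_bigr => n _.
by rewrite -[RHS]linearZ.
Qed.

Lemma converges_iterT k v : converges u v ->
  converges (fun n => lambda n ^+ k *: u n) (fun w => iter k T (v w)).
Proof.
move=> cv; elim: k => [|k IH]; first by under eq_fun do rewrite expr0 scale1r.
by under eq_fun do rewrite exprS; exact: converges_T.
Qed.

Lemma converges_sum (I : Type) (s : seq I) (f : I -> int -> E) g :
  (forall i, converges (f i) (g i)) ->
  converges (fun n => \sum_(i <- s) f i n) (fun w => \sum_(i <- s) g i w).
Proof.
move=> fg; elim: s => [|i s IH].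
  apply: aeW => w; rewrite big_nil (_ : (fun _ => _) = fun=> 0); first exact: cvg_cst.
  by apply/funext => k; rewrite big1// => n _; rewrite big_nil scaler0.
under eq_fun do rewrite big_cons.
under [fun w => \sum_(_ <- _) g _ _]eq_fun do rewrite big_cons.
exact: convergesD.
Qed.

Section averages.
Variable mu : R[i].

Definition rotated_mean (N : nat) (x : E) : E :=
  N.+1%:R^-1 *: \sum_(k < N.+1) mu^-1 ^+ k *: iter k T x.

Lemma iterT_continuous k : continuous (iter k T).
Proof.
elim: k => [|k IH] x; first exact: cvg_id.
exact: (continuous_comp (IH x) (@contT _)).
Qed.

Lemma rotated_mean_continuous N : continuous (rotated_mean N).
Proof.
move=> x; apply: cvgZ; first exact: cvg_cst.
rewrite /continuous_at /index_enum.
elim: (Finite.enum _) => [|k s IH].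
  by under eq_fun do rewrite big_nil; rewrite big_nil; exact: cvg_cst.
under eq_fun do rewrite big_cons; rewrite big_cons; apply: cvgD => //.
by apply: cvgZ; [exact: cvg_cst|exact: iterT_continuous].
Qed.

Lemma iterTZ k c x : iter k T (c *: x) = c *: iter k T x.
Proof. by elim: k => [//|k IH]; rewrite !iterS IH linearZ. Qed.

Lemma rotated_mean_iter N k x : rotated_mean N (iter k T x) = iter k T (rotated_mean N x).
Proof.
rewrite /rotated_mean iterTZ; congr (_ *: _).
have iter_sum (I : Type) (s : seq I) (f : I -> E) :
    iter k T (\sum_(i <- s) f i) = \sum_(i <- s) iter k T (f i).
  by elim: k => [//|j IH]; rewrite iterS IH linear_sum.
rewrite iter_sum; apply: eq_bigr => j _; rewrite iterTZ; congr (_ *: _).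
by rewrite -!iterD addnC.
Qed.

(** T multiplies the coefficient of u n by lambda n, so the rotated mean multiplies it by the mean
    of the powers of lambda n / mu. *)
Lemma converges_rotated_mean N v : converges u v ->
  converges (fun n => cesaro (mu^-1 * lambda n) N *: u n) (fun w => rotated_mean N (v w)).
Proof.
move=> cv.
have := convergesZ N.+1%:R^-1 (converges_sum (index_enum 'I_N.+1)
  (fun k : 'I_N.+1 => convergesZ (mu^-1 ^+ k) (converges_iterT k cv))).
apply: eq_converges => n _; rewrite /cesaro -scalerA scaler_suml; congr (_ *: _).
by apply: eq_bigr => k _; rewrite exprMn scalerA.
Qed.

End averages.

Lemma convergesB (u1 u2 : int -> E) v1 v2 : converges u1 v1 -> converges u2 v2 ->
  converges (fun n => u1 n - u2 n) (fun w => v1 w - v2 w).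
Proof.
move=> cv1 cv2; have := convergesD cv1 (convergesZ (-1) cv2).
by under eq_fun do rewrite scaleN1r; apply: filterS => w; rewrite scaleN1r.
Qed.

Lemma ae_imply_gt0 (A B : set Omega) : measurable A -> measurable B ->
  {ae P, forall w, A w -> B w} -> (0 < P A)%E -> (0 < P B)%E.
Proof.
move=> mA mB AB; have -> : P A = P (A `&` B).
  apply: ae_measure_eq => //; first exact: measurableI.
  by apply: filterS AB => w AB; split=> [Aw|[]//]; split => //; exact: AB.
move=> /lt_le_trans; apply; apply: le_measure; rewrite ?inE//.
exact: measurableI.
Qed.

Lemma invariant_set n0 v : J n0 -> u n0 != 0 ->
  measurable_fun [set: Omega] (v : Omega -> borel E) -> converges u v ->
  exists B : set E, [/\ measurable (B : set (borel E)), T @^-1` B = B,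
    (0 < P (v @^-1` B))%E & (0 < P (v @^-1` (~` B)))%E].
Proof.
move=> Jn0 un0 mv cv; pose mu := lambda n0.
have mu1 : `|mu| = 1 by exact: lambda1.
have mu0 : mu != 0 by rewrite -normr_eq0 mu1 oner_eq0.
pose e n : R[i] := if lambda n == mu then 1 else 0.
have se : summable alpha J (fun n => e n *: u n).
  by apply: summableZ => // n _; rewrite /e; case: ifP; rewrite ?normr1 ?normr0.
have [Z mZ cZ] := summable_converges alpha_gt0 isoM sepE typeE se.
pose V N w := rotated_mean mu N (v w) - Z w.
have mV N : measurable_fun [set: Omega] (V N : Omega -> borel E).
  apply: (borel_measurableD sepE).
    exact: (borel_continuous (@rotated_mean_continuous mu N) mv).
  apply: (borel_continuous (g := fun x : E => - x) _ mZ) => x.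
  exact: (cvgN cvg_id).
(* Coefficients of the mean minus Z. They are cut to 0 outside J because the contraction bound is
   required for all integers, while lambda n has modulus 1 only on J. *)
pose b N n : R[i] := if (n \notin J) || (lambda n == mu) then 0
  else cesaro (mu^-1 * lambda n) N.
have z1 n : J n -> complex.Re `|mu^-1 * lambda n| = 1.
  by move=> Jn; rewrite normrM normfV mu1 lambda1// invr1 mulr1.
have b1 N n : complex.Re `|b N n| <= 1.
  rewrite /b; case: ifPn => [_|]; first by rewrite normr0.
  by rewrite negb_or negbK => /andP[/set_mem Jn _]; apply: cesaro_le1; exact: z1.
have b0 n : J n -> complex.Re `|b N n| @[N --> \oo] --> (0 : R).
  move=> Jn; have bE N : b N n = if lambda n == mu then 0 else cesaro (mu^-1 * lambda n) N.
    by rewrite /b mem_set.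
  under eq_fun do rewrite bE; case: (boolP (lambda n == mu)) => [_|ln].
    by rewrite normr0; exact: cvg_cst.
  apply: cesaro_cvg; first exact: z1.
  by apply: contra ln => /eqP h; rewrite -[lambda n](mulVKf mu0) h mulr1.
have cV N : converges (fun n => b N n *: u n) (V N).
  have := convergesB (converges_rotated_mean mu N cv) cZ.
  apply: eq_converges => n Jn; rewrite -scalerBl /b /e mem_set//=.
  case: ifPn => [/eqP ->|_]; last by rewrite subr0.
  by rewrite mulVf// cesaro1 subrr.
have V0 eps : 0 < eps -> P [set w | eps <= rnorm (V N w)] @[N --> \oo] --> 0%E.
  exact: (vanishing_coefficients alpha_gt0 isoM sepE typeE b1 b0 su mV cV).
have [m mE] := cvg_subsequence mV V0.
have TZ : {ae P, forall w, T (Z w) = mu *: Z w}.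
  apply: converges_unique (converges_T cZ) _; apply: eq_converges (convergesZ mu cZ) => n Jn.
  by rewrite scalerA /e; case: ifP => [/eqP ->//|_]; rewrite !mulr0.
(* Being within r of 0 or within r of u n0 puts the norm of Z on opposite sides of r. *)
pose r := rnorm (u n0) / 2; have r0 : 0 < r by rewrite divr_gt0// rnorm_gt0.
(* All iterates are covered at once: the means commute with T and T Z = mu Z, so every point of the
   orbit of v has the same limit of norms. *)
have limit : {ae P, forall w, forall k,
    rnorm (rotated_mean mu (m j) (iter k T (v w))) @[j --> \oo] --> rnorm (Z w)}.
  apply: filterS2 mE TZ => w mw Tw k.
  have -> : rnorm (Z w) = rnorm (iter k T (Z w)).
    elim: k => [//|k IH]; rewrite iterSr Tw iterTZ rnormZ -IH.
    by rewrite Re_normc1// mul1r.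
  under eq_fun do rewrite rotated_mean_iter.
  have Hr : rotated_mean mu (m j) (v w) @[j --> \oo] --> Z w.
    have H := cvgD mw (cvg_cst (Z w)); rewrite add0r in H.
    rewrite (_ : (fun j => rotated_mean mu (m j) (v w)) = (fun j => V (m j) w + Z w)); first exact: H.
    by apply/funext => j; rewrite /V subrK.
  exact: cvg_rnorm (cvg_comp _ _ Hr (@iterT_continuous k (Z w))).
(* Phrased with the means, not with Z, so that it is a Borel set of E. Almost surely v lies in A
   when the norm of Z is below r and outside A when it is above r. *)
pose A : set E := [set x | exists n, forall j, (n <= j)%N -> rnorm (rotated_mean mu (m j) x) < r].
(* Visiting A infinitely often, unlike lying in A, is an exactly invariant
   property. *)
pose B : set E := [set x | forall n, exists2 k, (n <= k)%N & A (iter k T x)].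
have mA : measurable (A : set (borel E)).
  rewrite (_ : A = \bigcup_n \bigcap_(j in [set j | (n <= j)%N])
      (rotated_mean mu (m j) @^-1` [set y : E | rnorm (y - 0) < r])).
    apply: bigcupT_measurable => n; apply: bigcap_measurable => [|j _].
      by exists n => /=.
    apply: borel_open; apply: open_comp; last exact: open_rnorm_ball.
    by move=> x _; exact: rotated_mean_continuous.
  apply/seteqP; split=> x [n].
    by move=> H; exists n => // j /= /H; rewrite subr0.
  by move=> _ H; exists n => j /H /=; rewrite subr0.
have mB : measurable (B : set (borel E)).
  rewrite (_ : B = \bigcap_n \bigcup_(k in [set k | (n <= k)%N]) (iter k T @^-1` A)).
    apply: bigcapT_measurable => n; apply: bigcup_measurable => k _.
    have mk : measurable_fun [set: borel E] (iter k T : borel E -> borel E).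
      apply: open_measurable_fun => U oU; apply: borel_open; apply: open_comp oU => x _.
      exact: iterT_continuous.
    by rewrite -[_ @^-1` _]setTI; exact: mk.
  by apply/seteqP; split=> x H n; [move=> _|]; have [] := H n => // k nk Ak; exists k.
exists B; split => //.
- apply/seteqP; split=> x H n.
    by have [k nk] := H n; rewrite -iterSr => Ak; exists k.+1 => //; exact: leq_trans nk _.
  (* A visit after time n + 1 excludes k = 0, so one iterate can be peeled off. *)
  have [[//|k] nk] := H n.+1; rewrite iterSr => Ak; exists k => //.
- apply: (@ae_imply_gt0 [set w | rnorm (Z w - 0) < r]).
  + exact: borel_ball.
  + exact: borel_preimage.
  + apply: filterS limit => w Lw /=; rewrite subr0 => Zr n; exists n => //.
    have [N _ NL] := cvgr_lt _ (Lw n) _ Zr.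
    by exists N => j /NL.
  + have := sum_near alpha_gt0 isoM sepE alpha_le2 (fun=> 0) 0%N mZ cZ r0.
    by rewrite big1// => n _; rewrite scale0r.
- apply: (@ae_imply_gt0 [set w | rnorm (Z w - u n0) < r]).
  + exact: borel_ball.
  + by apply: borel_preimage => //; exact: measurableC.
  + apply: filterS limit => w Lw /= Zr Bw.
    have rZ : r < rnorm (Z w).
      have := ler_rnormD (u n0 - Z w) (Z w); rewrite subrK rnorm_distC.
      by rewrite /r in Zr *; lra.
    have [k _ [q Aq]] := Bw 0%N; have [N _ NL] := cvgr_gt _ (Lw k) _ rZ.
    have := Aq (maxn q N) (leq_maxl _ _); apply/negP; rewrite -leNgt ltW//.
    by apply: NL => /=; exact: leq_maxr.
  (* The coefficients are concentrated at n0, which the ball of radius |n0| contains; the centre is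
     e n0 u n0 = u n0. *)
  + have := sum_near alpha_gt0 isoM sepE alpha_le2 (fun n => (n == n0)%:R) `|n0|%N mZ cZ r0.
    rewrite (bigD1_seq n0) ?ball_seq_uniq ?mem_ball_seq ?mem_set ?leqnn//=.
    rewrite eqxx scale1r /e eqxx scale1r big1 ?addr0// => n /negPf ->.
    by rewrite scale0r.
Qed.

End dynamics.

(** * The law of the sum *)

Section law_of_the_series.
Context {R : realType} (alpha : R).
Hypothesis alpha_gt0 : 0 < alpha.
Hypothesis alpha_le2 : alpha <= 2.
Context d {Omega : measurableType d} (P : probability Omega R).
Variables (J : set int) (M : set int -> {RV P >-> borel R[i]^o}).
Hypothesis isoM :
  isotropic_stable_random_measure alpha [set A | A `<=` J] (@counting int R) M.
Context {E : completeNormedModType R[i]}.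
Hypothesis sepE : separable E.
Variables (u : int -> E) (v : {RV P >-> borel E}).
Hypothesis cv : converges J M u v.

Local Notation X := (coord J M).
Local Notation ball_seq := (ball_seq J).

Let mv : measurable_fun [set: Omega] (v : Omega -> borel E) := measurable_funP v.

Lemma law_scale (c : R[i]) : `|c| = 1 ->
  eq_law P (fun w => c *: (v w : E) : borel E) P v.
Proof.
move=> c1; apply: (converges_law alpha_gt0 isoM sepE (a := fun=> c) (b := fun=> 1) (u := u)) => //.
- by move=> n _; rewrite c1 normr1.
- exact: (borel_continuous (@scaler_continuous _ E c) mv).
- exact: convergesZ.
- by under eq_fun do rewrite scale1r.
Qed.

Lemma sum_law (a b c : R) : 0 < a -> 0 < b -> 0 < c ->
  a `^ alpha + b `^ alpha = c `^ alpha ->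
  eq_law (product_probability P P)
    (fun w => a%:C%C *: (v w.1 : E) + b%:C%C *: (v w.2 : E) : borel E)
    P (fun w => c%:C%C *: (v w : E) : borel E).
Proof.
move=> a0 b0 c0 abc.
have Zc (q : R) : converges J M (fun n => q%:C%C *: u n) (fun w => q%:C%C *: (v w : E)).
  exact: convergesZ.
have mZ (q : R) : measurable_fun [set: Omega] (fun w => q%:C%C *: (v w : E) : borel E).
  exact: (borel_continuous (@scaler_continuous _ E q%:C%C) mv).
apply: (@coord_series_law_add _ _ alpha_gt0 _ _ P J M isoM E sepE ball_seq u
  (fun=> a%:C%C) (fun=> b%:C%C) (fun=> c%:C%C)) => //.
- by move=> n _; rewrite !Re_norm_real !gtr0_norm.
- apply: (borel_measurableD sepE).
    exact: (measurableT_comp (mZ a) measurable_fst).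
  exact: (measurableT_comp (mZ b) measurable_snd).
- have h1 := ae_product_fst P (Zc a); have h2 := ae_product_snd P (Zc b).
  apply: filterS2 h1 h2 => w H1 H2; apply: cvg_trans (cvgD H1 H2).
  apply: near_eq_cvg; apply: nearW => N; rewrite fctE -big_split/=; apply: eq_bigr => n _.
  by rewrite scalerDl !scalerA mulrC [X in _ + X *: _]mulrC.
- apply: filterS (Zc c) => w; apply: cvg_trans; apply: near_eq_cvg; apply: nearW => N.
  by apply: eq_bigr => n _; rewrite scalerA mulrC.
Qed.

Lemma independent_pair d' (Omega' : measurableType d') (P' : probability Omega' R)
    (X1 X2 : {RV P' >-> borel E}) (A B : set (borel E)) :
  independent (fun i : bool => if i then X1 else X2) -> measurable A -> measurable B ->
  P' (X1 @^-1` A `&` X2 @^-1` B) = (P' (X1 @^-1` A) * P' (X2 @^-1` B))%E.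
Proof.
move=> ind mA mB.
have := ind [:: true; false] (fun i => if i then A else B) isT.
move=> /(_ _)/wrap[]; first by case.
rewrite !big_cons big_nil mule1 => <-; congr (P' _).
apply/seteqP; split=> w /=; first by move=> [wA wB] [].
by move=> H; split; [exact: (H true)|exact: (H false)].
Qed.

(** The shift z is 0. The given copies live on an arbitrary space, but independence fixes the law of
    the pair, which is therefore that of the coordinates on the product of P with itself. *)
Lemma stable_series : stable_vector alpha v.
Proof.
move=> a b a0 b0; exists 0 => d' Omega' P' X1 X2 ind law1 law2 A mA.
pose c := (a `^ alpha + b `^ alpha) `^ alpha^-1.
have s0 : 0 < a `^ alpha + b `^ alpha by rewrite addr_gt0// powR_gt0.
have c0 : 0 < c by rewrite powR_gt0.
have cE : a `^ alpha + b `^ alpha = c `^ alpha.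
  by rewrite -powRrM mulVf ?gt_eqF// powRr1// ltW.
have <- : P ((fun w => c%:C%C *: (v w : E)) @^-1` A) =
    P ((fun w => 0 + c%:C%C *: (v w : E)) @^-1` A).
  by congr (P _); apply/funext => w; rewrite /preimage/= add0r.
rewrite -[RHS](sum_law a0 b0 c0 cE mA).
pose G : set (borel E * borel E) := [set x | A (a%:C%C *: (x.1 : E) + b%:C%C *: (x.2 : E))].
have mZ dT (S : measurableType dT) (f : S -> borel E) (q : R) : measurable_fun setT f ->
    measurable_fun [set: S] (fun w => q%:C%C *: (f w : E) : borel E).
  by move=> mf; exact: (borel_continuous (@scaler_continuous _ E q%:C%C) mf).
have mG : measurable G.
  have mS : measurable_fun [set: borel E * borel E]
      (fun x => a%:C%C *: (x.1 : E) + b%:C%C *: (x.2 : E) : borel E).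
    by apply: (borel_measurableD sepE); apply: mZ; [exact: measurable_fst|exact: measurable_snd].
  by rewrite -[G]setTI; exact: mS.
apply: (pair_law (P1 := P') (P2 := product_probability P P)
  (f1 := X1) (g1 := X2) (f2 := fun w => v w.1) (g2 := fun w => v w.2) _ _ _ _ _ mG) => //.
- exact: (measurableT_comp mv measurable_fst).
- exact: (measurableT_comp mv measurable_snd).
move=> B C mB mC; rewrite (independent_pair ind mB mC) law1// law2//.
rewrite -product_probabilityE//.
- by rewrite -[v @^-1` B]setTI; exact: mv.
- by rewrite -[v @^-1` C]setTI; exact: mv.
Qed.

Lemma isotropic_series : isotropic_stable_vector alpha v.
Proof.
split; last exact: law_scale.
split; first exact: stable_series.
move=> A mA; have N1 : `|-1 : R[i]| = 1 by rewrite normrN normr1.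
rewrite -(law_scale N1 mA); congr (P _); apply/funext => w.
by rewrite /preimage/= scaleN1r.
Qed.

Lemma full_support_series : dense (lin_span (u @` J)) -> full_support (distribution P v).
Proof.
move=> dense_u U oU U0; have [y [Uy [m [c [e [eJ yE]]]]]] := dense_u _ U0 oU.
have /choice[n nP] i : exists n, J n /\ u n = e i by have [n Jn nE] := eJ i; exists n.
pose K := (\max_(i < m) `|n i|)%N.
(* The chosen indices n i may coincide, so the coefficients that fall on one index are added. *)
pose c' k := \sum_(i < m | n i == k) c i.
have {}yE : y = \sum_(k <- ball_seq K) c' k *: u k.
  under eq_bigr do rewrite /c' scaler_suml.
  rewrite yE (exchange_big_dep xpredT)//=; apply: eq_bigr => i _.
  rewrite big_mkcond/= (bigD1_seq (n i)) ?ball_seq_uniq//=; last first.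
    rewrite mem_ball_seq mem_set/=; last exact: (nP i).1.
    exact: (leq_bigmax_cond (F := fun i => `|n i|%N)).
  rewrite eqxx (nP i).2 big1 ?addr0// => k /negPf; rewrite eq_sym => ->.
  by [].
have /nbhs_rnormP[r r0 rU] : nbhs y U by exact: open_nbhs_nbhs.
apply: lt_le_trans (sum_near alpha_gt0 isoM sepE alpha_le2 c' K mv cv r0) _.
apply: le_measure; rewrite ?inE; first exact: borel_ball.
  exact: borel_preimage (borel_open oU).
by move=> w; rewrite /= -yE; exact: rU.
Qed.

End law_of_the_series.

Lemma coord_sum (R : realType) d (Omega : measurableType d) (P : probability Omega R)
    (J : set int) (M : set int -> {RV P >-> borel R[i]^o}) (E : normedModType R[i])
    (u : int -> E) (F : nat -> set int) (k : nat) w : finite_exhaustion J F ->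
  \sum_(n \in F k) (M [set n] w : R[i]) *: u n = \sum_(n \in F k) coord J M n w *: u n.
Proof.
move=> [_ _ FJ]; apply: eq_fsbigr => n /set_mem Fn.
by rewrite /coord mem_set// -FJ; exists k.
Qed.

(** The sum is determined only up to null sets, so its properties are proved for every measurable
    version of it, next to the existence of one. *)
Theorem theorem4p2 (R : realType) (E : completeNormedModType R[i]) (alpha : R)
    (d : measure_display) (Omega : measurableType d) (P : probability Omega R)
    (J : set int) (T : {linear E -> E}) (u : int -> E) (lambda : int -> R[i])
    (M : set int -> {RV P >-> borel R[i]^o}) :
  0 < alpha -> alpha <= 2 ->
  ~ finite_dimensional E ->
  separable E ->
  stable_type E alpha ->
  bounded_near T (nbhs (0 : E)) ->
  (\esum_(n in J) ((rnorm (u n)) `^ alpha)%:E < +oo)%E ->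
  (forall n, J n -> T (u n) = lambda n *: u n) ->
  (forall n, J n -> `|lambda n| = 1) ->
  isotropic_stable_random_measure alpha [set A | A `<=` J] (@counting int R) M ->
  dense (lin_span (u @` J)) ->
  let v_series := fun n w => (M [set n] w : R[i]) *: u n in
  (exists v : {RV P >-> borel E}, as_series_sum P J v_series v) /\
  (forall v : {RV P >-> borel E}, as_series_sum P J v_series v ->
    [/\ invariant_measure T (distribution P v),
        full_support (distribution P v),
        isotropic_stable_vector alpha v
      & ~ ergodic_measure T (distribution P v)]).
Proof.
move=> alpha_gt0 alpha_le2 infE sepE typeE bT su Tu lambda1 isoM dense_u v_series.
have contT : continuous T by apply/linear_bounded_continuous.
split.
  have [v vP] := exists_sum alpha_gt0 isoM sepE typeE su.
  exists v => F exF.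
  apply: filterS (cvg_sum_unique alpha_gt0 isoM typeE su vP exF) => w.
  by under eq_fun do rewrite -(coord_sum _ _ _ _ exF).
move=> v vP.
have mv : measurable_fun [set: Omega] (v : Omega -> borel E) by exact: measurable_funP.
have cv : converges J M u v.
  apply/converges_balls; have exb := exhaustion_balls J.
  by apply: filterS (vP _ exb) => w; under eq_fun do rewrite (coord_sum _ _ _ _ exb).
split.
- have law : eq_law P ((fun w => T (v w)) : Omega -> borel E) P (v : Omega -> borel E).
    apply: (converges_law alpha_gt0 isoM sepE (a := lambda) (b := fun=> 1) (u := u)) => //.
    + by move=> n Jn; rewrite lambda1// normr1.
    + by apply: (borel_continuous (g := T) (f := v)).
    + apply: eq_converges (converges_T contT Tu (a := fun=> 1) (v := v) _) => [n _|].
        by rewrite mulr1.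
      by under eq_fun do rewrite scale1r.
    + by under eq_fun do rewrite scale1r.
  by move=> A mA; exact: law.
- exact: (full_support_series alpha_gt0 alpha_le2 isoM sepE cv).
- exact: (isotropic_series alpha_gt0 isoM sepE cv).
- move=> [_ ergv].
  (* If all u n vanished, the dense span would be reduced to 0, and so would E, which the empty set
     would then span. *)
  have [n0 [Jn0 un0]] : exists n, J n /\ u n != 0.
    apply: contrapT => /forallNP u0; apply: infE; exists set0; first exact: finite_set0.
    apply/seteqP; split=> // x _; exists 0%N, (fun=> 0), (fun=> 0); split; first by case.
    rewrite big_ord0; apply/eqP; apply: contrapT => /negP x0.
    have [] := dense_u [set y | rnorm (y - x) < rnorm x].
    + by exists x; rewrite /= subrr rnorm0 rnorm_gt0.
    + exact: open_rnorm_ball.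
    move=> y [/= yx [m [c [e [eJ yE]]]]]; move: yx.
    rewrite yE big1 ?sub0r ?rnormN ?ltxx// => i _.
    have [n Jn <-] := eJ i; have /not_andP[//|/negP/negPn/eqP ->] := u0 n.
    by rewrite scaler0.
  have [B [mB TB B0 B1]] := invariant_set alpha_gt0 alpha_le2 isoM sepE typeE contT su
    Tu lambda1 Jn0 un0 mv cv.
  have mvB : measurable (v @^-1` B) by exact: borel_preimage.
  have [vB|vB] := ergv B mB TB.
    by move: B0; rewrite [P _]vB ltxx.
  by move: B1; rewrite preimage_setC probability_setC// [P _]vB subee ?ltxx.
Qed.
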